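(* Assume that: (i) for every $\Lambda\subset\{1,\dots,d\}$ and all $x,x'\in\mathbb{Z}^{\Lambda,d}_+$ there is a finite sequence $z_0,\dots,z_k\in\mathbb{Z}^{\Lambda,d}_+$ with $z_0=x$, $z_k=x'$ and $\mu(z_j-z_{j-1})>0$ for all $j=1,\dots,k$; (ii) the function $\varphi(a)=\sum_{z\in\mathbb{Z}^d}\mu(z)\exp(a\cdot z)$ is finite in a neighborhood of the set $D=\{a\in\mathbb{R}^d:\varphi(a)\le 1\}$; (iii) $M=\sum_{x\in\mathbb{Z}^d}\mu(x)\,x\neq 0$. Suppose moreover that the coordinates of $M$ are non-negative. Then: (1) For any harmonic function $f>0$ of the induced Markov chain $(X_M(t))$, the function $$h(x)=f\bigl(x^{\Lambda(M)}\bigr)-\mathbb{E}_x\bigl(f(S^{\Lambda(M)}(\tau)),\ \tau<\tau_{\Lambda(M)}\bigr),\qquad x\in\mathbb{Z}^d_+,$$ is strictly positive and harmonic for $(Z(t))$. (2) For any sequence $x_n\in\mathbb{Z}^d_+$ which is fundamental for $(Z(t))$ and satisfies $\lim_n|x_n|=\infty$ and $\lim_n x_n/|x_n|=M/|M|$, there is a harmonic function $f>0$ of $(X_M(t))$ such that for any $x\in\mathbb{Z}^d_+$, $$\lim_n\frac{G(x,x_n)}{G(x_0,x_n)}=\frac{f\bigl(x^{\Lambda(M)}\bigr)-\mathbb{E}_x\bigl(f(S^{\Lambda(M)}(\tau)),\ \tau<\tau_{\Lambda(M)}\bigr)}{f\bigl(x_0^{\Lambda(M)}\bigr)-\mathbb{E}_{x_0}\bigl(f(S^{\Lambda(M)}(\tau)),\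 \tau<\tau_{\Lambda(M)}\bigr)}.\qquad( * )$$ (3) If moreover the harmonic function $f>0$ of $(X_M(t))$ is unique up to constant multiples, then any sequence $x_n\in\mathbb{Z}^d_+$ with $\lim_n|x_n|=\infty$ and $\lim_n x_n/|x_n|=M/|M|$ is fundamental for $(Z(t))$ and satisfies $( * )$ with this $f$ for all $x\in\mathbb{Z}^d_+$.
   Context: $d\ge1$, $\mu$ is a probability measure on $\mathbb{Z}^d$, $|\cdot|$ is the Euclidean norm, $x^i$ is the $i$-th coordinate of $x$. $\mathbb{Z}^d_+=\{x\in\mathbb{Z}^d:x^i>0\ \forall i\}$. For $\Lambda\subset\{1,\dots,d\}$: $x^\Lambda=(x^i)_{i\in\Lambda}$, $\mathbb{Z}^{\Lambda}$ is the set of integer vectors indexed by $\Lambda$, $\mathbb{Z}^\Lambda_+=\{u\in\mathbb{Z}^\Lambda:u^i>0\ \forall i\in\Lambda\}$, and $\mathbb{Z}^{\Lambda,d}_+=\{x\in\mathbb{Z}^d:x^i>0\ \forall i\in\Lambda\}$. $(S(t))_{t\in\mathbb{N}}$ is the random walk on $\mathbb{Z}^d$ with transition probabilities $p(x,x')=\mu(x'-x)$; $\mathbb{P}_x,\mathbb{E}_x$ refer to the start $S(0)=x$; $S^\Lambda(t)=(S^i(t))_{i\in\Lambda}$; $\mathbb{E}_x(Y,A)=\mathbb{E}_x(Y\mathbf{1}_A)$. $\tau_i=\inf\{n\ge0:S^i(n)\le0\}$, $\tau_\Lambda=\min_{i\in\Lambda}\tau_i$, $\tau_\emptyset=+\infty$,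 $\tau=\tau_{\{1,\dots,d\}}$. $(Z(t))$ is the substochastic Markov chain on $\mathbb{Z}^d_+$ with transition matrix $(\mu(x'-x))_{x,x'\in\mathbb{Z}^d_+}$, i.e. $S(t)$ killed at time $\tau$. Its Green function is $G(x,x')=\sum_{t\ge0}\mathbb{P}_x(S(t)=x',\ \tau>t)$. $x_0\in\mathbb{Z}^d_+$ is a fixed reference point. A sequence $x_n\in\mathbb{Z}^d_+$ with $|x_n|\to\infty$ is called fundamental for $(Z(t))$ if $G(x,x_n)/G(x_0,x_n)$ converges for every $x\in\mathbb{Z}^d_+$. $\Lambda(M)=\{i:M^i=0\}$. The induced Markov chain $(X_M(t))$ is the substochastic chain on $\mathbb{Z}^{\Lambda(M)}_+$ with transition matrix $\mu_{\Lambda(M)}(u'-u)$, where $\mu_\Lambda(u)=\sum_{x\in\mathbb{Z}^d:\,x^\Lambda=u}\mu(x)$; that is, $S^{\Lambda(M)}(t)$ killed at time $\tau_{\Lambda(M)}$. If $\Lambda(M)=\emptyset$, the chain $(X_M(t))$ is constant on a one-point state space, so its harmonic functions are the constants and $f(x^{\emptyset})$ denotes this constant. A function $f$ on the state space $E$ of a (sub)stochastic chain with transition matrix $(p(u,u'))$ is harmonic if $\sum_{u'\in E}p(u,u')f(u')=f(u)$ for all $u\in E$. *)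

(* Defs.v *)
From HB Require Import structures.
From mathcomp Require Export all_boot all_order all_algebra.
From mathcomp Require Export all_classical all_reals all_analysis.
Export Order.TTheory GRing.Theory Num.Theory.
Export numFieldNormedType.Exports.

Set Implicit Arguments.
Unset Strict Implicit.
Unset Printing Implicit Defensive.

#[export] Set Implicit Arguments.
#[export] Unset Strict Implicit.
#[export] Unset Printing Implicit Defensive.

Local Open Scope classical_set_scope.
Local Open Scope ring_scope.

(* Integer vectors indexed by a finite type: Z^d is [zvec 'I_d], and for
   L : {set 'I_d}, Z^L is [zvec {i | i \in L}] (a one-point type if L = set0). *)
Notation zvec I := {ffun I -> int}.

Definition restr d (L : {set 'I_d}) (x : zvec 'I_d) : zvec {i | i \in L} :=
  [ffun i => x (val i)].

Definition orthant (I : finType) : set (zvec I) :=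
  [set x | forall i, 0 < x i].

Definition orthant_on d (L : {set 'I_d}) : set (zvec 'I_d) :=
  [set x | forall i, i \in L -> 0 < x i].

(* Sum of a signed family. An equality of [ssum E f] with a finite value entails
   absolute convergence, because +oo - +oo = -oo in \bar R. *)
Definition ssum (R : realType) (X : choiceType) (E : set X) (f : X -> R)
    : \bar R :=
  (esum E (EFin \o f)^\+ - esum E (EFin \o f)^\-)%E.

Definition is_pmf (R : realType) (X : choiceType) (mu : X -> R) : Prop :=
  (forall x, 0 <= mu x) /\ (\esum_(x in [set: X]) (mu x)%:E = 1)%E.

Section vectors.
Context {R : realType} {d : nat}.

Definition vec_of (x : zvec 'I_d) : 'rV[R]_d := \row_i (x i)%:~R.

(* The Euclidean norm; [`|v|] on 'rV[R]_d is the sup norm. *)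
Definition enorm (v : 'rV[R]_d) : R := Num.sqrt (\sum_i v 0 i ^+ 2).

Variable mu : zvec 'I_d -> R.

Definition laplace (a : 'rV[R]_d) : \bar R :=
  \esum_(z in [set: zvec 'I_d])
    (mu z * expR (\sum_i a 0 i * vec_of z 0 i))%:E.

Definition mean : 'rV[R]_d :=
  \row_i fine (ssum [set: zvec 'I_d] (fun x => mu x * vec_of x 0 i)).

(* mu_L; L = set0 gives the one-point chain with transition probability 1. *)
Definition marginal (L : {set 'I_d}) (u : zvec {i | i \in L}) : R :=
  fine (\esum_(x in [set x | restr L x = u]) (mu x)%:E).

Definition irreducible_on (L : {set 'I_d}) : Prop :=
  forall x x', orthant_on L x -> orthant_on L x' ->
  exists s : seq (zvec 'I_d),
    [/\ {in s, forall z, orthant_on L z}, last x s = x' &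
        path (fun y z => 0 < mu (z - y)) x s].

End vectors.

Section chains.
Context {R : realType} {X : choiceType}.

(* f and p are total, but only their values on the state space E are used. *)
Definition harmonic (E : set X) (p : X -> X -> R) (f : X -> R) : Prop :=
  forall u, E u -> ssum E (fun u' => p u u' * f u') = (f u)%:E.

Definition positive_harmonic (E : set X) (p : X -> X -> R) (f : X -> R) : Prop :=
  (forall u, E u -> 0 < f u) /\ harmonic E p f.

(* Under P x, the process S is the Markov chain with transition probabilities p
   started at x. *)
Definition is_markov_chain disp (T : measurableType disp) (p : X -> X -> R)
    (P : X -> probability T R) (S : nat -> T -> X) : Prop :=
  (forall t y, measurable (S t @^-1` [set y])) /\
  forall (x : X) (t : nat) (y : nat -> X),
    P x [set w | forall s, (s <= t)%N -> S s w = y s] =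
    ((y 0%N == x)%:R * \prod_(s < t) p (y s) (y s.+1))%:E.

End chains.

Definition walk_kernel (R : realType) (I : finType) (m : zvec I -> R)
  (u u' : zvec I) : R := m (u' - u).

Section walk.
Context {R : realType} {d : nat} {disp : measure_display}
  {T : measurableType disp}.
Variables (P : zvec 'I_d -> probability T R) (S : nat -> T -> zvec 'I_d).

(* An infimum over the empty set is +oo, and so is [exit set0]. *)
Definition exit_coord (i : 'I_d) (w : T) : \bar R :=
  ereal_inf [set (n%:R)%:E | n in [set n : nat | S n w i <= 0]].

Definition exit (L : {set 'I_d}) (w : T) : \bar R :=
  \big[mine/+oo%E]_(i in L) exit_coord i w.

(* S(tau) for tau the exit time from Z^d_+; only meaningful when tau < +oo. *)
Definition S_exit (w : T) : zvec 'I_d :=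
  S (Num.truncn (fine (exit [set: 'I_d]%SET w))) w.

(* E_x(f(S^L(tau)), tau < tau_L); on this event S^L(tau) lies in Z^L_+. *)
Definition exit_expectation (L : {set 'I_d}) (f : zvec {i | i \in L} -> R)
    (x : zvec 'I_d) : \bar R :=
  \int[P x]_(w in [set w | (exit [set: 'I_d]%SET w < exit L w)%E])
    (f (restr L (S_exit w)))%:E.

Definition h_of (L : {set 'I_d}) (f : zvec {i | i \in L} -> R)
    (x : zvec 'I_d) : R :=
  f (restr L x) - fine (exit_expectation f x).

Definition green (x x' : zvec 'I_d) : \bar R :=
  \sum_(0 <= t <oo)
    P x [set w | S t w = x' /\ ((t%:R)%:E < exit [set: 'I_d]%SET w)%E].

(* G(x, x') / G(x0, x'); the Green function of a transient chain is finite. *)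
Definition martin_kernel (x0 x x' : zvec 'I_d) : R :=
  fine (green x x') / fine (green x0 x').

Definition escaping (xs : nat -> zvec 'I_d) : Prop :=
  (forall n, orthant (xs n)) /\
  enorm (vec_of (xs n) : 'rV[R]_d) @[n --> \oo] --> +oo%R.

Definition fundamental (x0 : zvec 'I_d) (xs : nat -> zvec 'I_d) : Prop :=
  escaping xs /\
  forall x, orthant x -> cvgn (fun n => martin_kernel x0 x (xs n)).

End walk.

Definition has_direction (R : realType) d (xs : nat -> zvec 'I_d)
    (M : 'rV[R]_d) : Prop :=
  (enorm (vec_of (xs n) : 'rV[R]_d))^-1 *: vec_of (xs n) @[n --> \oo]
    --> (enorm M)^-1 *: M.

Definition zero_coords (R : realType) d (M : 'rV[R]_d) : {set 'I_d} :=
  [set i | M 0 i == 0]%SET.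

(* Main.v *)
Require Import Defs.
From mathcomp Require Import measurable_realfun ring lra zify.

(* Let O be the orthant, L the set of coordinates with zero drift, and E the set of
   points whose coordinates in L are positive. Harmonic functions of the induced
   chain are the functions F on E that depend only on the coordinates in L and are
   invariant under the walk killed outside E.

   Superharmonic functions on E satisfy a lower bound along the drift: following
   the line of speed M + s^2 v during a time t costs only exp(- C s^3 t), by an
   exponential tilt of order s^2 and a second order expansion of the Laplace
   transform. Hence F grows subexponentially, and so do the ratios
   G_E(., x_n) / G_E(x_0, x_n) as soon as x_n / |x_n| tends to M / |M|. A shift w
   with w^L = 0 preserves E, so that a power of the transition operator splits
   into a multiple of this shift and a positive operator commuting with it; as
   the number of shifts in a product is concentrated, G_E(x + w, y) and G_E(x, y)
   are asymptotically equal. Every limit of the ratios is therefore such an F.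

   When the walk leaves O without leaving E, a coordinate of positive drift becomes
   nonpositive; a sum of exponentials of linear forms decreasing in such a coordinate
   is a supersolution which controls this exit uniformly. Thus G_O, which is G_E minus its
   expectation at the exit from O, also passes to the limit, along every
   ultrafilter; and h is the limit of the iterates of the walk killed outside O
   applied to F, positive far from the faces of positive drift and so everywhere.
   Convergence follows by comparing the limits along all ultrafilters. *)

Local Open Scope classical_set_scope.
Local Open Scope ring_scope.

(** * Sums of real families *)

(** The coordinates in L are centred, so no exponential tilt gives decay in these directions; bounds
    there must be subexponential at every rate, and this dictates the orders in s. A tilt of order
    s^2 creates an inward speed of order s^2 at a cost of order s^4 per step for the change of
    measure. A tube of width of order s^3 t around the line is left with probability at most exp(- c
    s^6 t) up to a constant, and crossing this width by the Harnack inequality costs exp(- C s^3 t),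
    the dominant term. Climbing r levels takes a time r / s^2, hence costs exp(- C s r) with s as
    small as desired.

    Domination at a rate below that of the supersolution is enough for the exit from O: the sums
    over exit times then have geometric tails, uniformly in n, and the exit expectation commutes
    with the limit of the ratios. An ultrafilter provides the limit at all lattice points at once,
    without extracting subsequences; the normalization F(x_0) = 1 survives in the limit and the
    Harnack inequality turns it into positivity everywhere. *)

Lemma ge0_esumZ (R : realType) (X : choiceType) (A : set X) (c : R) (b : X -> \bar R) :
  0 <= c -> (forall x, A x -> 0 <= b x)%E ->
  (\esum_(x in A) (c%:E * b x) = c%:E * \esum_(x in A) b x)%E.
Proof.
have key (a : R) (h : X -> \bar R) : 0 <= a -> (forall x, A x -> 0 <= h x)%E ->
    (\esum_(x in A) (a%:E * h x) <= a%:E * \esum_(x in A) h x)%E.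
  move=> a0 h0; apply: ge_ereal_sup => _ [J [fJ JA] <-].
  have -> : (\sum_(x \in J) (a%:E * h x) = a%:E * \sum_(x \in J) h x)%E.
    rewrite !fsbig_finite//= !big_seq ge0_sume_distrr// => x; rewrite in_fset_set// => /set_mem Jx.
    exact/h0/JA.
  rewrite lee_pmul// ?lee_fin ?esum_ge//; last by exists J.
  by apply: fsume_ge0 => x Jx; exact/h0/JA.
move=> c0 b0; have [->|cn0] := eqVneq c 0.
  by rewrite mul0e; apply: esum1 => x _; rewrite mul0e.
have cp : 0 < c by rewrite lt0r cn0.
apply/eqP; rewrite eq_le key//=.
have /= := key c^-1 (fun x => c%:E * b x)%E _ _; rewrite invr_ge0 => /(_ c0).
have cb x : A x -> (0 <= c%:E * b x)%E by move=> Ax; rewrite mule_ge0 ?lee_fin ?b0.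
move=> /(_ cb); under eq_esum do rewrite muleA -EFinM mulVf// mul1e.
by rewrite lee_pdivlMl.
Qed.

Section real_sums.
Context {R : realType} {X : choiceType}.
Implicit Types f g p q D : X -> R.

Definition abs_summable f := (\esum_(x in [set: X]) `|f x|%:E < +oo)%E.

(** An infinite part is sent to 0 by [fine], which is why additivity and monotonicity below carry
    the hypothesis [abs_summable]. *)
Definition rsum f : R :=
  fine (\esum_(x in [set: X]) (Num.max (f x) 0)%:E) -
  fine (\esum_(x in [set: X]) (Num.max (- f x) 0)%:E).

Lemma abs_summable_le f g :
  (forall x, `|f x| <= g x) -> abs_summable g -> abs_summable f.
Proof.
move=> fg; apply: le_lt_trans; apply: le_esum => x _; rewrite lee_fin.
exact: le_trans (fg x) (ler_norm _).
Qed.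

Lemma abs_summable_norm f : abs_summable f -> abs_summable (fun x => `|f x|).
Proof. by rewrite /abs_summable => sf; under eq_esum do rewrite normr_id. Qed.

Lemma abs_summableD f g : abs_summable f -> abs_summable g ->
  abs_summable (fun x => f x + g x).
Proof.
rewrite /abs_summable => sf sg.
apply: (@le_lt_trans _ _ (\esum_(x in [set: X]) (`|f x|%:E + `|g x|%:E))%E).
  by apply: le_esum => x _; rewrite lee_fin ler_normD.
by rewrite esumD ?lte_add_pinfty// => x _; rewrite lee_fin.
Qed.

Lemma esumZ (c : R) f : 0 <= c -> (forall x, 0 <= f x) ->
  (\esum_(x in [set: X]) (c * f x)%:E = c%:E * \esum_(x in [set: X]) (f x)%:E)%E.
Proof. by move=> c0 f0; rewrite -ge0_esumZ// => x _; rewrite lee_fin. Qed.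

Lemma abs_summableZ (c : R) f : abs_summable f -> abs_summable (fun x => c * f x).
Proof.
rewrite /abs_summable => sf; under eq_esum do rewrite normrM.
by rewrite esumZ// lte_mul_pinfty// ?esum_ge0// => x _; rewrite lee_fin.
Qed.

Lemma abs_summableN f : abs_summable f -> abs_summable (fun x => - f x).
Proof. by rewrite /abs_summable => sf; under eq_esum do rewrite normrN. Qed.

Lemma abs_summableB f g : abs_summable f -> abs_summable g ->
  abs_summable (fun x => f x - g x).
Proof. by move=> sf sg; apply: abs_summableD => //; apply: abs_summableN. Qed.

Lemma abs_summable0 : abs_summable (fun _ : X => 0 : R).
Proof. by rewrite /abs_summable esum1// => x _; rewrite normr0. Qed.

Lemma abs_summable_sum (I : Type) (r : seq I) (P : pred I) (F : I -> X -> R) :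
  (forall i, abs_summable (F i)) ->
  abs_summable (fun x => \sum_(i <- r | P i) F i x).
Proof.
move=> sF; elim: r => [|i r IH].
  by apply: abs_summable_le abs_summable0 => x; rewrite big_nil normr0.
have [Pi|Pi] := boolP (P i).
  have := abs_summableD (sF i) IH; congr abs_summable.
  by apply/funext => x; rewrite big_cons Pi.
move: IH; congr abs_summable.
by apply/funext => x; rewrite big_cons (negbTE Pi).
Qed.

Lemma fine_esumD p q : (forall x, 0 <= p x) -> (forall x, 0 <= q x) ->
  abs_summable p -> abs_summable q ->
  fine (\esum_(x in [set: X]) (p x + q x)%:E)%E =
  fine (\esum_(x in [set: X]) (p x)%:E)%E + fine (\esum_(x in [set: X]) (q x)%:E)%E.
Proof.
rewrite /abs_summable => p0 q0 sp sq.
have fin_p : (\esum_(x in [set: X]) (p x)%:E)%E \is a fin_num.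
  rewrite ge0_fin_numE ?esum_ge0//; last by move=> x _; rewrite lee_fin.
  by move: sp; under eq_esum do rewrite ger0_norm//.
have fin_q : (\esum_(x in [set: X]) (q x)%:E)%E \is a fin_num.
  rewrite ge0_fin_numE ?esum_ge0//; last by move=> x _; rewrite lee_fin.
  by move: sq; under eq_esum do rewrite ger0_norm//.
under eq_esum do rewrite EFinD.
by rewrite esumD ?fineD// => x _; rewrite lee_fin.
Qed.

(** Any splitting into summable nonnegative parts may replace the canonical one, since max(f, 0) + q
    = p + max(- f, 0) pointwise. Additivity reduces to this. *)
Lemma rsumE f p q : (forall x, 0 <= p x) -> (forall x, 0 <= q x) ->
  abs_summable p -> abs_summable q -> (forall x, f x = p x - q x) ->
  rsum f = fine (\esum_(x in [set: X]) (p x)%:E)%E -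
           fine (\esum_(x in [set: X]) (q x)%:E)%E.
Proof.
move=> p0 q0 sp sq fE; rewrite /rsum.
have m0 g x : 0 <= Num.max (g x) 0 by rewrite le_max lexx orbT.
have s1 : abs_summable (fun x => Num.max (f x) 0).
  apply: abs_summable_le sp => x; rewrite ger0_norm// fE ge_max p0 andbT.
  by rewrite gerBl.
have s2 : abs_summable (fun x => Num.max (- f x) 0).
  apply: abs_summable_le sq => x; rewrite ger0_norm ?le_max ?lexx ?orbT// fE ge_max q0 andbT.
  by rewrite opprB gerBl.
apply/eqP; rewrite subr_eq addrAC eq_sym subr_eq eq_sym; apply/eqP.
rewrite -!fine_esumD//; last by move=> x; rewrite le_max lexx orbT.
congr fine; apply: eq_esum => x _; congr EFin.
by rewrite fE; case: (lerP (p x - q x) 0) => h; case: (lerP (- (p x - q x)) 0) => h'; lra.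
Qed.

Lemma rsum_ge0E f : (forall x, 0 <= f x) ->
  rsum f = fine (\esum_(x in [set: X]) (f x)%:E).
Proof.
move=> f0; rewrite /rsum [X in _ - fine X]esum1 ?subr0.
  by congr fine; apply: eq_esum => x _; rewrite max_l.
by move=> x _; rewrite max_r// oppr_le0.
Qed.

Lemma esum_rsum f : (forall x, 0 <= f x) -> abs_summable f ->
  (\esum_(x in [set: X]) (f x)%:E = (rsum f)%:E)%E.
Proof.
move=> f0; rewrite /abs_summable; under eq_esum do rewrite ger0_norm//.
move=> sf; rewrite rsum_ge0E// fineK// ge0_fin_numE// esum_ge0// => x _.
by rewrite lee_fin.
Qed.

Lemma abs_summable_esum f (r : \bar R) : (forall x, 0 <= f x) ->
  (\esum_(x in [set: X]) (f x)%:E < r)%E -> abs_summable f.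
Proof.
move=> f0 h; rewrite /abs_summable; under eq_esum do rewrite ger0_norm//.
by apply: lt_le_trans h _; rewrite leey.
Qed.

Lemma rsum_ge0 f : (forall x, 0 <= f x) -> 0 <= rsum f.
Proof.
by move=> f0; rewrite rsum_ge0E// fine_ge0// esum_ge0// => x _; rewrite lee_fin.
Qed.

Let pos f x := Num.max (f x) 0.
Let pos_ge0 f x : 0 <= pos f x. Proof. by rewrite le_max lexx orbT. Qed.
Let posE f x : f x = pos f x - pos (fun x => - f x) x.
Proof. by rewrite /pos; case: (lerP (f x) 0) => h; case: (lerP (- f x) 0) => h'; lra. Qed.
Let sm_pos f : abs_summable f -> abs_summable (pos f).
Proof.
move=> sf; apply: (@abs_summable_le _ (fun x => `|f x|)).
  by move=> x; rewrite ger0_norm// /pos ge_max normr_ge0 ler_norm.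
exact: abs_summable_norm.
Qed.
Let rsumpos f : rsum f = fine (\esum_(x in [set: X]) (pos f x)%:E)%E -
   fine (\esum_(x in [set: X]) (pos (fun x => - f x) x)%:E)%E.
Proof. by []. Qed.

Lemma rsumD f g : abs_summable f -> abs_summable g ->
  rsum (fun x => f x + g x) = rsum f + rsum g.
Proof.
move=> sf sg.
rewrite (@rsumE _ (fun x => pos f x + pos g x)
  (fun x => pos (fun x => - f x) x + pos (fun x => - g x) x)).
- have [pf pg] := (sm_pos sf, sm_pos sg).
  have [nf ng] := (sm_pos (abs_summableN sf), sm_pos (abs_summableN sg)).
  rewrite (fine_esumD (pos_ge0 f) (pos_ge0 g) pf pg).
  rewrite (fine_esumD (pos_ge0 _) (pos_ge0 _) nf ng) !rsumpos.
  by ring.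
- by move=> x; rewrite addr_ge0.
- by move=> x; rewrite addr_ge0.
- by apply: abs_summableD; exact: sm_pos.
- by apply: abs_summableD; apply/sm_pos/abs_summableN.
- by move=> x; rewrite [in LHS](posE f) [in LHS](posE g); ring.
Qed.

Lemma rsumN f : rsum (fun x => - f x) = - rsum f.
Proof.
rewrite /rsum opprB; congr (_ - fine _).
by apply: eq_esum => x _; rewrite opprK.
Qed.

Lemma rsumB f g : abs_summable f -> abs_summable g ->
  rsum (fun x => f x - g x) = rsum f - rsum g.
Proof. by move=> sf sg; rewrite rsumD ?rsumN//; exact: abs_summableN. Qed.

Lemma rsumZ (c : R) f : rsum (fun x => c * f x) = c * rsum f.
Proof.
wlog c0 : c / 0 <= c.
  move=> H; have [c0|/ltW c0] := leP 0 c; first exact: H.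
  rewrite -[c]opprK mulNr -H ?oppr_ge0// -rsumN; congr rsum.
  by apply/funext => x; rewrite mulNr.
have mx (a : R) : Num.max (c * a) 0 = c * Num.max a 0.
  by rewrite maxr_pMr// mulr0.
rewrite /rsum mulrBr.
under eq_esum do rewrite mx.
under [X in _ - fine X]eq_esum do rewrite -mulrN mx.
have fM (e : \bar R) : fine (c%:E * e)%E = c * fine e.
  case: e => //= ; have [->|cn0] := eqVneq c 0; rewrite ?mul0e ?mul0r//=;
  have cp : 0 < c by rewrite lt0r cn0.
  by rewrite gt0_muley//= mulr0.
  by rewrite gt0_muleNy//= mulr0.
by rewrite !esumZ ?fM// => x; rewrite le_max lexx orbT.
Qed.

Lemma rsumZr (c : R) f : rsum (fun x => f x * c) = rsum f * c.
Proof. by rewrite mulrC -rsumZ; congr rsum; apply/funext => x; rewrite mulrC. Qed.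

Lemma abs_summableZr (c : R) f : abs_summable f -> abs_summable (fun x => f x * c).
Proof.
by move/(abs_summableZ c); congr abs_summable; apply/funext => x; rewrite mulrC.
Qed.

Lemma rsum_le f g : abs_summable f -> abs_summable g -> (forall x, f x <= g x) ->
  rsum f <= rsum g.
Proof.
by move=> sf sg fg; rewrite -subr_ge0 -rsumB// rsum_ge0// => x; rewrite subr_ge0.
Qed.

Lemma eq_rsum f g : f =1 g -> rsum f = rsum g.
Proof. by move=> /funext ->. Qed.

Lemma rsum0 : rsum (fun _ : X => 0 : R) = 0.
Proof. by rewrite rsum_ge0E// esum1. Qed.

Lemma rsum_sum (I : Type) (r : seq I) (P : pred I) (F : I -> X -> R) :
  (forall i, abs_summable (F i)) ->
  rsum (fun x => \sum_(i <- r | P i) F i x) = \sum_(i <- r | P i) rsum (F i).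
Proof.
move=> sF; elim: r => [|i r IH].
  by rewrite big_nil -[RHS]rsum0; apply: eq_rsum => x; rewrite big_nil.
rewrite big_cons; have [Pi|Pi] := boolP (P i).
  rewrite -IH -rsumD//; last exact: abs_summable_sum.
  by apply: eq_rsum => x; rewrite big_cons Pi.
by rewrite -IH; apply: eq_rsum => x; rewrite big_cons (negbTE Pi).
Qed.

Lemma ler_norm_rsum f : abs_summable f -> `|rsum f| <= rsum (fun x => `|f x|).
Proof.
move=> sf; have sa : abs_summable (fun x => `|f x|).
  exact: abs_summable_norm.
have sa' : abs_summable (fun x => `|f x|) := sa.
rewrite ler_norml -rsumN; apply/andP; split; apply: rsum_le => //.
- exact: abs_summableN.
- by move=> x; rewrite lerNl -normrN ler_norm.
- by move=> x; rewrite ler_norm.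
Qed.

Lemma abs_summable_single f x0 : (forall x, x != x0 -> f x = 0) -> abs_summable f.
Proof.
move=> f0; rewrite /abs_summable.
rewrite (_ : (\esum_(x in [set: X]) _)%E = (\esum_(x in [set x0]) `|f x|%:E)%E).
  by rewrite esum_set1 ?ltry// lee_fin.
rewrite [RHS]esum_mkcond; apply: eq_esum => x _.
case: ifPn => // /negP xx0; rewrite f0 ?normr0//; apply/eqP => ?; apply: xx0.
by rewrite inE.
Qed.

Lemma rsum_single f x0 : (forall x, x != x0 -> f x = 0) -> rsum f = f x0.
Proof.
move=> f0; rewrite /rsum.
have H (g : X -> R) : (forall x, x != x0 -> g x = 0) -> (forall x, 0 <= g x) ->
   (\esum_(x in [set: X]) (g x)%:E = (g x0)%:E)%E.
  move=> g0 gp.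
  rewrite (_ : (\esum_(x in [set: X]) _)%E = (\esum_(x in [set x0]) (g x)%:E)%E).
    by rewrite esum_set1 ?ltry// lee_fin.
  rewrite [RHS]esum_mkcond; apply: eq_esum => x _.
  case: ifPn => // /negP xx0; rewrite g0//; apply/eqP => ?; apply: xx0.
  by rewrite inE.
rewrite !H/=.
- by case: (lerP (f x0) 0) => h; case: (lerP (- f x0) 0) => h'; lra.
- by move=> x /f0 ->; rewrite oppr0 max_l.
- by move=> x; rewrite le_max lexx orbT.
- by move=> x /f0 ->; rewrite max_l.
- by move=> x; rewrite le_max lexx orbT.
Qed.

Lemma le_rsum_term f x0 : (forall x, 0 <= f x) -> abs_summable f -> f x0 <= rsum f.
Proof.
move=> f0 sf; pose g x := if x == x0 then f x0 else 0.
have g1 : forall x, x != x0 -> g x = 0 by move=> x; rewrite /g => /negbTE ->.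
rewrite -[leLHS](_ : rsum g = _); last by rewrite (rsum_single g1) /g eqxx.
apply: rsum_le => //; first exact: abs_summable_single g1.
by move=> x; rewrite /g; case: eqP => // ->.
Qed.

Lemma esum_bij (h k : X -> X) (a : X -> \bar R) : cancel h k -> cancel k h ->
  (forall x, 0 <= a x)%E ->
  (\esum_(x in [set: X]) a x = \esum_(x in [set: X]) a (h x))%E.
Proof.
move=> hk kh a0; apply: reindex_esum => //.
split => //=; first by move=> x y _ _ /(can_inj hk).
by move=> x _; exists (k x).
Qed.

Lemma rsum_tail f (e : R) : (forall x, 0 <= f x) -> abs_summable f -> 0 < e ->
  exists s : seq X, rsum (fun x => if x \in s then 0 else f x) <= e.
Proof.
move=> f0 sf e0.
have /esym E := esum_rsum f0 sf.
have [] := @ub_ereal_sup_adherent R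
  [set (\sum_(x \in A) (f x)%:E)%E | A in fsets [set: X]] e e0.
  by rewrite -/(esum _ _) -E.
move=> _ [A [finA _] <-]; rewrite -/(esum _ _) -E => h.
exists (finmap.enum_fset (fset_set A)).
have s1 : abs_summable (fun x => if x \in finmap.enum_fset (fset_set A) then 0 else f x).
  by apply: abs_summable_le sf => x; case: ifP; rewrite ?normr0// ger0_norm.
have s2 : abs_summable (fun x => if x \in finmap.enum_fset (fset_set A) then f x else 0).
  by apply: abs_summable_le sf => x; case: ifP; rewrite ?normr0// ger0_norm.
have Ef : rsum f = rsum (fun x => if x \in finmap.enum_fset (fset_set A) then 0 else f x) +
    rsum (fun x => if x \in finmap.enum_fset (fset_set A) then f x else 0).
  by rewrite -rsumD//; apply: eq_rsum => x; case: ifP; rewrite ?addr0 ?add0r.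
suff : rsum f - e <= rsum (fun x => if x \in finmap.enum_fset (fset_set A) then f x else 0) by lra.
rewrite -lee_fin EFinB; apply: le_trans (ltW h) _.
rewrite -esum_rsum//; last by move=> x; case: ifP.
apply: (@esum_ge _ _ _ _ (\sum_(x \in A) (f x)%:E)%E).
exists A => //; rewrite le_eqVlt; apply/orP; left; apply/eqP; apply: eq_fsbigr => x; rewrite inE => Ax.
by rewrite in_fset_set// mem_set.
Qed.

(** Dominated convergence along any proper filter, because limits are taken along ultrafilters as
    well as along sequences. Outside a finite set [D] has mass at most e / 3 and the difference is
    at most 2 D; on the finite set pointwise convergence gives e / 3. *)
Lemma rsum_cvg (F : set_system nat) (FF : ProperFilter F)
    (f : nat -> X -> R) g D :
  abs_summable D -> (\forall n \near F, forall x, `|f n x| <= D x) ->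
  (forall x, f n x @[n --> F] --> g x) -> rsum (f n) @[n --> F] --> rsum g.
Proof.
move=> sD fD fg.
have D0 x : 0 <= D x.
  have [n] := filter_ex fD; move=> /(_ x); exact: le_trans.
have gD x : `|g x| <= D x.
  apply: (@ler_cvg_to _ _ FF _ (fun n => `|f n x|) (fun=> D x)).
  - by apply: cvg_norm; exact: fg.
  - exact: cvg_cst.
  - by apply: filterS fD => n; exact.
have sg : abs_summable g by apply: abs_summable_le sD.
apply/cvgrPdist_le => e e0.
have e3 : 0 < e / 3 by rewrite divr_gt0.
have [s hs] := rsum_tail D0 sD e3.
have fin : (\sum_(x <- undup s) `|g x - f n x|) @[n --> F] --> (0 : R).
  rewrite -[X in _ --> X](_ : \sum_(x <- undup s) 0 = _); last by rewrite big1.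
  apply: cvg_big => [|x _]; first exact: add_continuous.
  rewrite -[X in _ --> X](normr0 R) -(subrr (g x)).
  by apply: cvg_norm; apply: cvgB; [exact: cvg_cst|exact: fg].
near=> n.
have fn : forall x, `|f n x| <= D x by near: n.
have sf : abs_summable (f n) by apply: abs_summable_le sD.
rewrite -rsumB//; apply: le_trans (ler_norm_rsum _) _; first exact: abs_summableB.
pose t x := if x \in s then 0 else D x.
have st : abs_summable t.
  by apply: abs_summable_le sD => x; rewrite /t; case: ifP; rewrite ?normr0// ger0_norm.
pose u y x := if x == y then `|g y - f n y| else 0.
have u0 y x : x != y -> u y x = 0 by rewrite /u => /negbTE ->.
have su y : abs_summable (u y) by exact: abs_summable_single (u0 y).
apply: (@le_trans _ _ (rsum (fun x => \sum_(y <- undup s) u y x + 2 * t x))).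
  apply: rsum_le.
  - by apply: abs_summable_norm; exact: abs_summableB.
  - by apply: abs_summableD; [exact: abs_summable_sum|exact: abs_summableZ].
  - move=> x; rewrite /t; case: ifPn => xs.
      rewrite mulr0 addr0 (bigD1_seq x) ?mem_undup ?undup_uniq//= {1}/u eqxx.
      by rewrite lerDl sumr_ge0// => y _; rewrite /u; case: ifP.
    apply: (@le_trans _ _ (2 * D x)).
      by apply: le_trans (ler_normB _ _) _; rewrite mulrDl !mul1r lerD.
    by rewrite lerDr sumr_ge0// => y _; rewrite /u; case: ifP.
rewrite rsumD//; [|exact: abs_summable_sum|exact: abs_summableZ].
rewrite rsumZ rsum_sum//.
under eq_bigr => y _ do rewrite (rsum_single (u0 y)) /u eqxx.
suff : \sum_(x <- undup s) `|g x - f n x| <= e / 3 by rewrite -/t in hs *; lra.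
have : `|0 - \sum_(x <- undup s) `|g x - f n x| | <= e / 3.
  by near: n; move/cvgrPdist_le : fin; exact.
by rewrite sub0r normrN ger0_norm// sumr_ge0.
Unshelve. all: by end_near. Qed.

End real_sums.

(** * The transition operator of the killed walk *)

Section lattice.
Context {R : realType} {d : nat}.
Notation X := (zvec 'I_d).
Implicit Types (x y z : X) (a b : 'I_d -> R).

Definition l1 x : R := \sum_i `|(x i)%:~R|.

Definition dot a x : R := \sum_i a i * (x i)%:~R.

Definition unitv (i : 'I_d) : X := [ffun j => (j == i)%:R].

Lemma zvecD x y i : (x + y) i = x i + y i :> int. Proof. by rewrite ffunE. Qed.

Lemma zvecB x y i : (x - y) i = x i - y i :> int. Proof. by rewrite !ffunE. Qed.

Lemma unitv_val i j : unitv i j = if j == i then 1 else 0 :> int.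
Proof. by rewrite ffunE; case: eqP. Qed.

Lemma unitv_mulrn i (r : nat) j :
  (unitv i *+ r) j = if j == i then r%:Z else 0 :> int.
Proof.
elim: r => [|r IH]; first by rewrite mulr0n ffunE; case: ifP.
by rewrite mulrS zvecD IH unitv_val; case: ifP; rewrite ?addr0// -intS.
Qed.

Lemma l1_ge0 x : 0 <= l1 x. Proof. exact: sumr_ge0. Qed.

Lemma l1D x y : l1 (x + y) <= l1 x + l1 y.
Proof.
by rewrite /l1 -big_split; apply: ler_sum => i _; rewrite ffunE rmorphD ler_normD.
Qed.

Lemma l1N x : l1 (- x) = l1 x.
Proof. by apply: eq_bigr => i _; rewrite ffunE rmorphN normrN. Qed.

Lemma l1B x y : l1 (x - y) <= l1 x + l1 y.
Proof. by rewrite -[l1 y]l1N l1D. Qed.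

Lemma ler_coord_l1 x i : `|(x i)%:~R| <= l1 x.
Proof. by rewrite /l1 (bigD1 i)//= lerDl sumr_ge0. Qed.

Lemma dotD a x y : dot a (x + y) = dot a x + dot a y.
Proof.
by rewrite /dot -big_split; apply: eq_bigr => i _; rewrite ffunE rmorphD mulrDr.
Qed.

Lemma dotN a x : dot a (- x) = - dot a x.
Proof.
by rewrite /dot -sumrN; apply: eq_bigr => i _; rewrite ffunE rmorphN mulrN.
Qed.

Lemma dotB a x y : dot a (x - y) = dot a x - dot a y.
Proof. by rewrite dotD dotN. Qed.

Lemma dot0 a : dot a 0 = 0.
Proof. by rewrite /dot big1// => i _; rewrite ffunE mulr0. Qed.

Lemma dotDl a b x : dot (fun i => a i + b i) x = dot a x + dot b x.
Proof. by rewrite /dot -big_split; apply: eq_bigr => i _; rewrite mulrDl. Qed.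

Lemma dotZl (k : R) a x : dot (fun i => k * a i) x = k * dot a x.
Proof. by rewrite /dot mulr_sumr; apply: eq_bigr => i _; rewrite mulrA. Qed.

Lemma dotNl a x : dot (fun i => - a i) x = - dot a x.
Proof. by rewrite /dot -sumrN; apply: eq_bigr => i _; rewrite mulNr. Qed.

Lemma dot_unitv (i : 'I_d) x : dot (fun j => (j == i)%:R) x = (x i)%:~R.
Proof.
rewrite /dot (bigD1 i)//= eqxx mul1r big1 ?addr0// => j /negbTE ->.
by rewrite mul0r.
Qed.

Lemma ler_dot_l1 a (c : R) x : (forall i, `|a i| <= c) -> `|dot a x| <= c * l1 x.
Proof.
move=> ac; apply: le_trans (ler_norm_sum _ _ _) _.
by rewrite mulr_sumr; apply: ler_sum => i _; rewrite normrM ler_wpM2r.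
Qed.

Lemma unitvE i j : (unitv i j)%:~R = (j == i)%:R :> R.
Proof. by rewrite ffunE; case: eqP. Qed.

Lemma l1_unitv i : l1 (unitv i) = 1.
Proof.
rewrite /l1 (bigD1 i)//= unitvE eqxx normr1 big1 ?addr0// => j /negbTE ji.
by rewrite unitvE ji normr0.
Qed.

(** The largest coordinate satisfies [l1 x <= d * |x i|]. This trades the exponential of a norm for
    2 d exponentials of linear forms, whose means are Laplace transforms. *)
Lemma l1_max (c : R) x : (0 < d)%N -> 0 <= c ->
  expR (c * l1 x) <= \sum_i (expR (c * d%:R * (x i)%:~R) + expR (- (c * d%:R) * (x i)%:~R)).
Proof.
move=> d0 c0.
have [i ixmax] : exists i, forall j, `|(x j)%:~R| <= `|(x i)%:~R| :> R.
  have [i _ h] := @Order.TotalTheory.arg_maxP _ _ _ (Ordinal d0) xpredT (fun i => `|(x i)%:~R : R|) isT.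
  by exists i => j; exact: h.
rewrite (bigD1 i)//= -[leLHS]addr0 lerD//; last first.
  by apply: sumr_ge0 => j _; rewrite addr_ge0// expR_ge0.
have : expR (c * l1 x) <= expR (c * d%:R * `|(x i)%:~R|).
  rewrite ler_expR -mulrA ler_wpM2l// /l1.
  apply: le_trans (ler_sum _ (fun j _ => ixmax j)) _.
  by rewrite sumr_const card_ord mulr_natl.
move=> /le_trans; apply; have [h|h] := leP 0 ((x i)%:~R : R).
  by rewrite ger0_norm// lerDl expR_ge0.
by rewrite ltr0_norm// mulrN mulNr lerDr expR_ge0.
Qed.

End lattice.

Section kernel.
Context {R : realType} {d : nat}.
Notation X := (zvec 'I_d).
Variables (mu : X -> R) (c0 : R).
Hypotheses (mu_ge0 : forall z, 0 <= mu z) (c0_ge0 : 0 <= c0)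
  (mu_exp : abs_summable (fun z => mu z * expR (c0 * l1 z))).
Implicit Types (A : set X) (g h D : X -> R) (x y z : X).

(** The growth allowed by the exponential moment: as [l1] is subadditive, [step] is summable on this
    class and preserves it, so it can be iterated freely. *)
Definition exp_bounded g := exists C, forall x, `|g x| <= C * expR (c0 * l1 x).

Lemma exp_bounded_le g h : (forall x, `|g x| <= h x) -> exp_bounded h -> exp_bounded g.
Proof.
move=> gh [C hC]; exists C => x; apply: le_trans (gh x) _.
exact: le_trans (ler_norm _) (hC x).
Qed.

Lemma exp_bounded_pos g : exp_bounded g ->
  exists2 C, 0 <= C & forall x, `|g x| <= C * expR (c0 * l1 x).
Proof.
move=> [C hC]; exists `|C| => // x; apply: le_trans (hC x) _.
by rewrite ler_wpM2r ?expR_ge0// ler_norm.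
Qed.

Lemma exp_boundedD g h : exp_bounded g -> exp_bounded h ->
  exp_bounded (fun x => g x + h x).
Proof.
move=> [C hC] [C' hC']; exists (C + C') => x; apply: le_trans (ler_normD _ _) _.
by rewrite mulrDl lerD.
Qed.

Lemma exp_boundedZ (k : R) g : exp_bounded g -> exp_bounded (fun x => k * g x).
Proof.
move=> [C hC]; exists (`|k| * C) => x; rewrite normrM -mulrA.
by rewrite ler_wpM2l.
Qed.

Lemma exp_boundedB g h : exp_bounded g -> exp_bounded h ->
  exp_bounded (fun x => g x - h x).
Proof.
move=> gb hb; apply: exp_boundedD => //.
by have := exp_boundedZ (-1) hb; congr exp_bounded; apply/funext => x; rewrite mulN1r.
Qed.

Lemma exp_bounded_norm g : exp_bounded g -> exp_bounded (fun x => `|g x|).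
Proof. by move=> [C hC]; exists C => x; rewrite normr_id. Qed.

Lemma exp_bounded0 : exp_bounded (fun=> 0).
Proof. by exists 0 => x; rewrite normr0 mul0r. Qed.

Lemma exp_bounded_sum (I : Type) (r : seq I) (P : pred I) (F : I -> X -> R) :
  (forall i, exp_bounded (F i)) -> exp_bounded (fun x => \sum_(i <- r | P i) F i x).
Proof.
move=> sF; elim: r => [|i r IH].
  by have := exp_bounded0; congr exp_bounded; apply/funext => x; rewrite big_nil.
have [Pi|Pi] := boolP (P i).
  have := exp_boundedD (sF i) IH; congr exp_bounded.
  by apply/funext => x; rewrite big_cons Pi.
move: IH; congr exp_bounded.
by apply/funext => x; rewrite big_cons (negbTE Pi).
Qed.

Lemma exp_bounded_shift g y : exp_bounded g -> exp_bounded (fun x => g (x + y)).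
Proof.
move=> /exp_bounded_pos[C C0 hC]; exists (C * expR (c0 * l1 y)) => x.
apply: le_trans (hC _) _; rewrite -mulrA ler_wpM2l// -expRD ler_expR -mulrDr.
by rewrite ler_wpM2l// addrC l1D.
Qed.

Lemma exp_bounded_dot (a : 'I_d -> R) : (forall i, `|a i| <= c0) ->
  exp_bounded (fun x => expR (dot a x)).
Proof.
move=> ac; exists 1 => x; rewrite ger0_norm ?expR_ge0// mul1r ler_expR.
exact: le_trans (ler_norm _) (ler_dot_l1 _ ac).
Qed.

Lemma exp_bounded_delta y : exp_bounded (fun x => (x == y)%:R).
Proof.
exists 1 => x; rewrite mul1r; apply: (@le_trans _ _ 1).
  by case: eqP; rewrite ?normr1 ?normr0.
by rewrite -expR0 ler_expR mulr_ge0// l1_ge0.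
Qed.

Definition cut A g y := if y \in A then g y else 0.

Lemma ler_norm_cut A g y : `|cut A g y| <= `|g y|.
Proof. by rewrite /cut; case: ifP => // _; rewrite normr0. Qed.

Lemma exp_bounded_cut A g : exp_bounded g -> exp_bounded (cut A g).
Proof. by move/exp_bounded_norm; apply: exp_bounded_le => x; exact: ler_norm_cut. Qed.

(* The transition operator of the walk killed outside A. *)
Definition step A g x := rsum (fun z => mu z * cut A g (x + z)).

Definition step_summable A g x := abs_summable (fun z => mu z * cut A g (x + z)).

Lemma exp_bounded_step_summable A g x : exp_bounded g -> step_summable A g x.
Proof.
move=> /(exp_bounded_cut A)/(@exp_bounded_shift _ x)[C hC].
apply: abs_summable_le (abs_summableZ C mu_exp) => z.
rewrite normrM (ger0_norm (mu_ge0 z)) mulrCA ler_wpM2l//.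
by rewrite addrC; exact: hC.
Qed.

Lemma step_summable_le A g h x : (forall y, A y -> `|g y| <= h y) ->
  step_summable A h x -> step_summable A g x.
Proof.
move=> gh; apply: abs_summable_le => z; rewrite normrM (ger0_norm (mu_ge0 z)).
rewrite ler_wpM2l// /cut; case: ifPn => [/set_mem/gh//|_]; by rewrite normr0.
Qed.

Lemma eq_step A g h x : (forall y, A y -> g y = h y) -> step A g x = step A h x.
Proof.
move=> gh; apply: eq_rsum => z; congr (_ * _); rewrite /cut; case: ifPn => //.
by move=> /set_mem/gh.
Qed.

Lemma step_le A g h x : step_summable A g x -> step_summable A h x ->
  (forall y, A y -> g y <= h y) -> step A g x <= step A h x.
Proof.
move=> sg sh gh; apply: rsum_le => // z; rewrite ler_wpM2l// /cut.
by case: ifPn => // /set_mem/gh.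
Qed.

Lemma step_ge0 A g x : (forall y, A y -> 0 <= g y) -> 0 <= step A g x.
Proof.
move=> g0; apply: rsum_ge0 => z; rewrite mulr_ge0// /cut.
by case: ifPn => // /set_mem/g0.
Qed.

Lemma stepD A g h x : step_summable A g x -> step_summable A h x ->
  step A (fun y => g y + h y) x = step A g x + step A h x.
Proof.
move=> sg sh; rewrite -rsumD//; apply: eq_rsum => z; rewrite -mulrDr /cut.
by case: ifP; rewrite ?addr0.
Qed.

Lemma stepZ A (k : R) g x : step A (fun y => k * g y) x = k * step A g x.
Proof.
rewrite -rsumZ; apply: eq_rsum => z; rewrite mulrCA /cut.
by case: ifP; rewrite ?mulr0.
Qed.

Lemma step0 A x : step A (fun=> 0) x = 0.
Proof.
by rewrite -[RHS](@rsum0 R X); apply: eq_rsum => z; rewrite /cut if_same mulr0.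
Qed.

Lemma step_sum (I : Type) (r : seq I) (P : pred I) (F : I -> X -> R) A x :
  (forall i, exp_bounded (F i)) ->
  step A (fun y => \sum_(i <- r | P i) F i y) x = \sum_(i <- r | P i) step A (F i) x.
Proof.
move=> sF; rewrite -rsum_sum => [|i]; last exact: exp_bounded_step_summable.
apply: eq_rsum => z; rewrite -mulr_sumr; congr (_ * _); rewrite /cut.
by case: ifP => // _; rewrite big1.
Qed.

Lemma exp_bounded_step A g : exp_bounded g -> exp_bounded (step A g).
Proof.
move=> gb; have /exp_bounded_pos[C C0 hC] := exp_bounded_cut A gb.
exists (C * rsum (fun z => mu z * expR (c0 * l1 z))) => x.
apply: le_trans (ler_norm_rsum _) _.
  exact: exp_bounded_step_summable.
rewrite -mulrA -rsumZr -rsumZ; apply: rsum_le.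
- by apply: abs_summable_norm; exact: exp_bounded_step_summable.
- by apply: abs_summableZ; exact: abs_summableZr.
move=> z; rewrite normrM (ger0_norm (mu_ge0 z)) mulrA mulrCA -!mulrA ler_wpM2l//.
apply: le_trans (hC _) _; rewrite ler_wpM2l// -expRD ler_expR -mulrDr ler_wpM2l//.
by rewrite addrC; exact: l1D.
Qed.

Definition shift (w : X) g x := g (x + w).

Lemma step_shift A g w x : (forall y, A (y + w) <-> A y) ->
  step A (shift w g) x = shift w (step A g) x.
Proof.
move=> Aw; apply: eq_rsum => z.
rewrite /cut /shift (_ : x + z + w = x + w + z); last by rewrite addrAC.
have -> : (x + z \in A) = (x + w + z \in A) by
  rewrite (addrAC x w); apply/idP/idP; rewrite !inE => /Aw.
by [].
Qed.

Lemma step_cvg (F : set_system nat) (FF : ProperFilter F) A (f : nat -> X -> R) g D x :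
  exp_bounded D -> (\forall n \near F, forall y, A y -> `|f n y| <= D y) ->
  (forall y, A y -> f n y @[n --> F] --> g y) -> step A (f n) x @[n --> F] --> step A g x.
Proof.
move=> bD fD fg; apply: (@rsum_cvg _ _ _ _ _ _ (fun z => mu z * cut A D (x + z))).
- exact: exp_bounded_step_summable.
- apply: filterS fD => n h z; rewrite normrM (ger0_norm (mu_ge0 z)) ler_wpM2l//.
  by rewrite /cut; case: ifPn => [/set_mem/h//|]; rewrite normr0.
- move=> z; apply: cvgM; first exact: cvg_cst.
  by rewrite /cut; case: ifPn => [/set_mem/fg//|_]; exact: cvg_cst.
Qed.

Definition phi (a : 'I_d -> R) := rsum (fun z => mu z * expR (dot a z)).

Lemma phi_summable a : (forall i, `|a i| <= c0) ->
  abs_summable (fun z => mu z * expR (dot a z)).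
Proof.
move=> ac; apply: abs_summable_le mu_exp => z.
rewrite normrM (ger0_norm (mu_ge0 z)) ler_wpM2l// ger0_norm ?expR_ge0// ler_expR.
exact: le_trans (ler_norm _) (ler_dot_l1 _ ac).
Qed.

Lemma phi_ge0 a : 0 <= phi a.
Proof. by apply: rsum_ge0 => z; rewrite mulr_ge0// expR_ge0. Qed.

(** Without killing this would be an equality; the points outside A contribute 0 instead of a
    nonnegative term. *)
Lemma step_expR A a x : (forall i, `|a i| <= c0) ->
  step A (fun y => expR (dot a y)) x <= phi a * expR (dot a x).
Proof.
move=> ac; rewrite /step -rsumZr; apply: rsum_le.
- exact/exp_bounded_step_summable/exp_bounded_dot.
- exact/abs_summableZr/phi_summable.
- move=> z; rewrite -mulrA ler_wpM2l// -expRD addrC -dotD /cut.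
  by case: ifP => // _; rewrite expR_ge0.
Qed.

Lemma exp_bounded_iter A n g : exp_bounded g -> exp_bounded (iter n (step A) g).
Proof. by move=> gb; elim: n => //= n; exact: exp_bounded_step. Qed.

Lemma iter_step_ge0 A n g x : (forall y, A y -> 0 <= g y) -> A x ->
  0 <= iter n (step A) g x.
Proof.
move=> g0; elim: n x => [|n IH] x Ax /=; first exact: g0.
by apply: step_ge0.
Qed.

Lemma iter_step_le A n g h x : exp_bounded g -> exp_bounded h ->
  (forall y, A y -> g y <= h y) -> A x ->
  iter n (step A) g x <= iter n (step A) h x.
Proof.
move=> bg bh gh; elim: n x => [|n IH] x Ax /=; first exact: gh.
by apply: step_le => //; apply/exp_bounded_step_summable/exp_bounded_iter.
Qed.

Lemma iter_stepZ A n (k : R) g x :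
  iter n (step A) (fun y => k * g y) x = k * iter n (step A) g x.
Proof.
elim: n x => [|n IH] x; first by [].
by rewrite !iterS -stepZ; apply: eq_step => y _; exact: IH.
Qed.

Lemma iter_stepD A n g h x : exp_bounded g -> exp_bounded h ->
  iter n (step A) (fun y => g y + h y) x = iter n (step A) g x + iter n (step A) h x.
Proof.
move=> bg bh; elim: n x => [|n IH] x; first by [].
rewrite !iterS -stepD.
- by apply: eq_step => y _; exact: IH.
- by apply: exp_bounded_step_summable => //; exact: exp_bounded_iter.
- by apply: exp_bounded_step_summable => //; exact: exp_bounded_iter.
Qed.

Lemma iter_step_shift A n g w x : (forall y, A (y + w) <-> A y) ->
  iter n (step A) (shift w g) x = shift w (iter n (step A) g) x.
Proof.
move=> Aw; elim: n x => [|n IH] x; first by [].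
by rewrite !iterS -step_shift//; apply: eq_step => y _; exact: IH.
Qed.

Lemma iter_step_expR A n a x : (forall i, `|a i| <= c0) -> A x ->
  iter n (step A) (fun y => expR (dot a y)) x <= phi a ^+ n * expR (dot a x).
Proof.
move=> ac; have eb := exp_bounded_dot ac.
elim: n x => [|n IH] x Ax /=; first by rewrite expr0 mul1r.
apply: (@le_trans _ _ (step A (fun y => phi a ^+ n * expR (dot a y)) x)).
  apply: step_le => //; apply: exp_bounded_step_summable.
    exact: exp_bounded_iter.
  exact: exp_boundedZ.
rewrite stepZ exprSr -mulrA ler_wpM2l ?exprn_ge0 ?phi_ge0//.
exact: step_expR.
Qed.

Lemma iter_step_cvg (F : set_system nat) (FF : ProperFilter F) A n
    (f : nat -> X -> R) g D x :
  exp_bounded D -> (\forall k \near F, forall y, A y -> `|f k y| <= D y) ->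
  (forall k, exp_bounded (f k)) ->
  (forall y, A y -> f k y @[k --> F] --> g y) -> A x ->
  iter n (step A) (f k) x @[k --> F] --> iter n (step A) g x.
Proof.
move=> bD fD fb fg; elim: n x => [|n IH] x Ax /=; first exact: fg.
apply: (@step_cvg _ _ _ _ _ (iter n (step A) D)) => //.
  exact: exp_bounded_iter.
apply: filterS fD => k fD y Ay; rewrite ler_norml; apply/andP; split; last first.
  apply: iter_step_le => // z Az; exact: le_trans (ler_norm _) (fD _ Az).
rewrite lerNl.
have -> : - iter n (step A) (f k) y = iter n (step A) (fun y => - 1 * f k y) y.
  by rewrite iter_stepZ mulN1r.
apply: iter_step_le => //; first exact: exp_boundedZ.
move=> z Az; rewrite mulN1r -[leRHS]mulr1; apply: le_trans (ler_norm _) _.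
by rewrite normrN mulr1 fD.
Qed.

End kernel.

(** * Lower bounds for superharmonic functions *)

Section superharmonic.
Context {R : realType} {d : nat}.
Notation X := (zvec 'I_d).
Variable mu : X -> R.
Hypothesis mu_ge0 : forall z, 0 <= mu z.
Implicit Types (A : set X) (g h D : X -> R) (x y z : X).

(** Summability is part of the definition, because [step] of a family that is not summable has a
    meaningless value. *)
Definition superharmonic A g := (forall x, A x -> 0 <= g x) /\
  forall x, A x -> step_summable mu A g x /\ step mu A g x <= g x.

Lemma step_ge_term A g x y : (forall z, A z -> 0 <= g z) -> step_summable mu A g x ->
  A y -> mu (y - x) * g y <= step mu A g x.
Proof.
move=> g0 sg Ay.
have <- : cut A g (x + (y - x)) = g y by rewrite addrC subrK /cut mem_set.
apply: (@le_rsum_term _ _ (fun z => mu z * cut A g (x + z))) => // z.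
by rewrite mulr_ge0// /cut; case: ifPn => // /set_mem/g0.
Qed.

Fixpoint path_weight x (s : seq X) : R :=
  if s is y :: s' then mu (y - x) * path_weight y s' else 1.

Lemma path_weight_gt0 x s : path (fun y z => 0 < mu (z - y)) x s -> 0 < path_weight x s.
Proof.
elim: s x => [|y s IH] x //= /andP[h /IH ?]; exact: mulr_gt0.
Qed.

(** The translation by [t] lets a path found near the corner of the domain be used everywhere in
    it. *)
Lemma superharmonic_path A g x s t : superharmonic A g ->
  {in x :: s, forall y, A (y + t)} ->
  path_weight x s * g (last x s + t) <= g (x + t).
Proof.
move=> [g0 hg]; elim: s x => [|y s IH] x As /=; first by rewrite mul1r.
have [sx gx] := hg (x + t) (As x (mem_head _ _)).
have Ay : A (y + t) by apply: As; rewrite inE mem_head orbT.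
apply: le_trans gx; apply: le_trans (step_ge_term g0 sx Ay).
rewrite (_ : y + t - (x + t) = y - x); last by rewrite opprD addrACA subrr addr0.
rewrite -mulrA ler_wpM2l//; apply: IH => z zs; apply: As.
by rewrite inE zs orbT.
Qed.

(** Irreducibility yields paths from the point with all coordinates 1 to each neighbour
    [one + unitv i] and back. Translated by [x - one], which is nonnegative on L, they stay in the
    domain, so a unit step costs a factor bounded below independently of x and g. Joining x to y
    takes [l1 (y - x)] unit steps. *)
Lemma superharmonic_harnack (L : {set 'I_d}) : irreducible_on mu L ->
  exists2 C, 0 <= C & forall g x y, superharmonic (orthant_on L) g ->
    orthant_on L x -> orthant_on L y -> expR (- (C * l1 (y - x))) * g y <= g x.
Proof.
move=> irr.
pose one : X := [ffun=> 1].
have oneE i : one i = 1 by rewrite ffunE.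
have one_in : orthant_on L one by move=> i _; rewrite oneE.
have onei_in i : orthant_on L (one + unitv i).
  by move=> j _; rewrite zvecD oneE unitv_val; case: eqP.
have lift_in x y : orthant_on L x -> orthant_on L y -> orthant_on L (y + (x - one)).
  by move=> hx hy i iL; have := hx i iL; have := hy i iL; rewrite zvecD zvecB oneE => *; lia.
have /choice[c hc] : forall i, exists c : R, [/\ 0 < c, c <= 1 &
    forall g x, superharmonic (orthant_on L) g -> orthant_on L x ->
    c * g (x + unitv i) <= g x /\ c * g x <= g (x + unitv i)].
  move=> i.
  have [s1 [s1L ls1 p1]] := irr one (one + unitv i) one_in (onei_in i).
  have [s2 [s2L ls2 p2]] := irr (one + unitv i) one (onei_in i) one_in.
  have w1 := path_weight_gt0 p1; have w2 := path_weight_gt0 p2.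
  exists (Num.min 1 (Num.min (path_weight one s1) (path_weight (one + unitv i) s2))).
  split; first by rewrite !lt_min ltr01 w1.
    by rewrite ge_min lexx.
  move=> g x sg xL; have [g0 _] := sg.
  have xiL : orthant_on L (x + unitv i).
    by move=> j jL; have := xL j jL; rewrite zvecD unitv_val; case: eqP => _ *; lia.
  split.
    have := @superharmonic_path (orthant_on L) g one s1 (x - one) sg.
    rewrite ls1 (_ : one + unitv i + (x - one) = x + unitv i); last by rewrite addrAC addrCA subrr addr0.
    rewrite (_ : one + (x - one) = x); last by rewrite addrCA subrr addr0.
    move=> H; apply: le_trans (H _).
      by rewrite ler_wpM2r ?g0// !ge_min lexx orbT.
    by move=> y; rewrite inE => /predU1P[->|/s1L]; exact: lift_in.
  have := @superharmonic_path (orthant_on L) g (one + unitv i) s2 (x - one) sg.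
  rewrite ls2 (_ : one + unitv i + (x - one) = x + unitv i); last by rewrite addrAC addrCA subrr addr0.
  rewrite (_ : one + (x - one) = x); last by rewrite addrCA subrr addr0.
  move=> H; apply: le_trans (H _).
    by rewrite ler_wpM2r ?g0// !ge_min lexx !orbT.
  by move=> y; rewrite inE => /predU1P[->|/s2L]; exact: lift_in.
pose c1 := \prod_i c i.
have c1_gt0 : 0 < c1 by apply: prodr_gt0 => i _; have [] := hc i.
have c1_le i : c1 <= c i.
  rewrite /c1 (bigD1 i)//= ler_piMr//; first by have [/ltW] := hc i.
  by apply: prodr_ile1 => j _; have [/ltW h0 h1] := hc j; rewrite h0.
have c1_le1 : c1 <= 1.
  by apply: prodr_ile1 => j _; have [/ltW h0 h1] := hc j; rewrite h0.
exists (- ln c1); first by rewrite oppr_ge0 ln_le0.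
move=> g x y sg.
pose N (x : X) := (\sum_i `|x i|)%N.
have NE z : l1 z = (N z)%:R :> R.
  rewrite /l1 /N natr_sum; apply: eq_bigr => i _.
  by rewrite -intr_norm -natr_absz.
have [n] := ubnP (N (y - x)); elim: n x => // n IH x hn xL yL.
have [g0 _] := sg.
have [->|yx] := eqVneq y x.
  by rewrite subrr /l1 big1 ?mulr0 ?oppr0 ?expR0 ?mul1r// => i _; rewrite ffunE normr0.
have [i yxi] : exists i, y i != x i.
  apply/existsP; rewrite -negb_forall; apply: contra yx => /forallP h.
  by apply/eqP/ffunP => i; apply/eqP/h.
(* The moved coordinate stays between x i and y i, hence positive if i is in L. *)
pose x' := if x i < y i then x + unitv i else x - unitv i.
have x'L : orthant_on L x'.
  move=> j jL; have := xL j jL; have := yL j jL; rewrite /x'.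
  case: (ltP (x i) (y i)) => h; rewrite ?zvecB ?zvecD unitv_val; case: eqP h => [->|_] h *; lia.
have x'N : N (y - x) = (N (y - x')).+1.
  rewrite /N (bigD1 i)//= [in RHS](bigD1 i)//= -addSn; congr addn.
    by rewrite /x'; case: (ltP (x i) (y i)) => h; rewrite !(zvecB, zvecD) unitv_val eqxx; lia.
  apply: eq_bigr => j /negbTE ji; rewrite /x'.
  by case: ltP => h; rewrite !(zvecB, zvecD) unitv_val ji ?subr0 ?addr0.
have step1 : c1 * g x' <= g x.
  have [_ _ H] := hc i.
  rewrite /x'; case: (ltP (x i) (y i)) => h.
    have [h1 _] := H g x sg xL; apply: le_trans h1.
    rewrite ler_wpM2r// g0//.
    by move: x'L; rewrite /x' h.
  have xi : orthant_on L (x - unitv i).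
    by move: x'L; rewrite /x' ltNge h.
  have [_ h1] := H g _ sg xi; rewrite subrK in h1; apply: le_trans h1.
  by rewrite ler_wpM2r// g0.
apply: le_trans step1.
have -> : expR (- (- ln c1 * l1 (y - x))) = c1 * expR (- (- ln c1 * l1 (y - x'))).
  by rewrite NE x'N -natr1 -NE mulrDr mulr1 opprD expRD opprK lnK ?posrE// mulrC.
rewrite -mulrA ler_wpM2l ?(ltW c1_gt0)//.
by apply: IH => //; rewrite -ltnS -x'N.
Qed.

End superharmonic.

(** * Superharmonic functions along a tube around a line *)

Section tube.
Context {R : realType} {d : nat}.
Notation X := (zvec 'I_d).
Variables (mu : X -> R) (c0 : R).
Hypotheses (mu_ge0 : forall z, 0 <= mu z) (c0_ge0 : 0 <= c0)
  (mu_exp : abs_summable (fun z => mu z * expR (c0 * l1 z))).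
Implicit Types (A : set X) (g h D : X -> R) (x y z : X).

Lemma iter_step_path A g x s t : exp_bounded c0 g -> (forall z, A z -> 0 <= g z) ->
  {in x :: s, forall y, A (y + t)} ->
  path_weight mu x s * g (last x s + t) <= iter (size s) (step mu A) g (x + t).
Proof.
move=> bg g0; elim: s x => [|y s IH] x As /=; first by rewrite mul1r.
have Ay : A (y + t) by apply: As; rewrite inE mem_head orbT.
apply: le_trans (step_ge_term mu_ge0 _ _ Ay).
- rewrite (_ : y + t - (x + t) = y - x); last by rewrite opprD addrACA subrr addr0.
  rewrite -mulrA ler_wpM2l//; apply: IH => z zs; apply: As.
  by rewrite inE zs orbT.
- by move=> z Az; exact: iter_step_ge0.
- apply: (exp_bounded_step_summable mu_ge0 c0_ge0 mu_exp).
  exact: (exp_bounded_iter mu_ge0 c0_ge0 mu_exp).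
Qed.

(** Under the law tilted by a, the walk moves at speed about v. The hypothesis on [phi] controls, up
    to a factor [expR chi] per step, the exponential moments of its deviation from the line x + n v,
    so it leaves the tube of width w before time t with probability at most 2 d exp(chi t - k w). In
    the tube, g dominates what the tilted walk collects: a factor [phi mu a] per step, the density
    of the tilt and the final bound m. *)
Lemma tube_bound A g (a v : 'I_d -> R) (k chi w m : R) (t : nat) x :
  superharmonic mu A g -> 0 <= k -> 0 <= chi -> (forall i, `|a i| + k <= c0) ->
  (forall i (b : bool),
     phi mu (fun j => a j + (-1) ^+ b * k * (j == i)%:R) * expR (- ((-1) ^+ b * k * v i)) <=
     phi mu a * expR chi) ->
  (forall n z, (n <= t)%N ->
     (forall i, `|(z i)%:~R - (x i)%:~R - n%:R * v i| <= w) -> A z) ->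
  0 <= m ->
  (forall z, (forall i, `|(z i)%:~R - (x i)%:~R - t%:R * v i| <= w) ->
     m <= expR (- dot a z) * g z) ->
  0 <= w ->
  m * phi mu a ^+ t * expR (dot a x) * (1 - 2 * d%:R * expR (chi * t%:R - k * w)) <= g x.
Proof.
move=> sg k0 chi0 ac hphi htube m0 hm w0; have [g0 hg] := sg.
have ac0 i : `|a i| <= c0 by apply: le_trans (ac i); rewrite lerDl.
have acb i (b : bool) j : `|a j + (-1) ^+ b * k * (j == i)%:R| <= c0.
  apply: le_trans (ler_normD _ _) (le_trans _ (ac j)).
  rewrite lerD2l !normrM normrX normrN1 expr1n mul1r ger0_norm//.
  by case: eqP; rewrite ?normr1 ?mulr1// normr0 mulr0.
(* A supermartingale of the tilted walk, at least 1 outside the tube up to time t; the term chi (t -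
   n) compensates the loss [expR chi] of each step. *)
pose W (n : nat) z : R := \sum_i \sum_(b : bool)
  expR ((-1) ^+ b * k * ((z i)%:~R - (x i)%:~R - n%:R * v i) + (chi * (t%:R - n%:R) - k * w)).
have W0 n z : 0 <= W n z.
  by apply: sumr_ge0 => i _; apply: sumr_ge0 => b _; rewrite expR_ge0.
(* A subsolution vanishing outside the tube. It is compared with g by backward induction, starting
   at n = t where m bounds [expR (- dot a z) * g z] from below. *)
pose B n z := m * phi mu a ^+ (t - n) * expR (dot a z) * Num.max 0 (1 - W n z).
have main r : forall n z, (n + r)%N = t ->
    (forall i, `|(z i)%:~R - (x i)%:~R - n%:R * v i| <= w) -> B n z <= g z.
  elim: r => [|r IH] n z nrt hz.
    rewrite addn0 in nrt; rewrite /B -nrt subnn expr0 mulr1.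
    apply: (@le_trans _ _ (m * expR (dot a z))).
      rewrite ler_piMr// ?mulr_ge0 ?expR_ge0// ge_max ler01/=.
      by rewrite gerBl.
    rewrite nrt in hz; apply: le_trans (ler_wpM2r _ (hm z hz)) _; rewrite ?expR_ge0//.
    by rewrite mulrAC -expRD addNr expR0 mul1r.
  have nt : (n < t)%N by rewrite -nrt -addSnnS leq_addr.
  have Az : A z by exact: (htube n z (ltnW nt) hz).
  have [sz gz] := hg z Az.
  have [W1|W1] := leP 1 (W n z).
    by rewrite /B max_l ?mulr0 ?g0// subr_le0.
  apply: le_trans gz; rewrite /B max_r ?subr_ge0 ?(ltW W1)//.
  (* One step multiplies each exponential of W by [phi] at the perturbed tilt, which [hphi] compares
     with [phi mu a]. *)
  have chW : rsum (fun z' => mu z' * (expR (dot a z') * W n.+1 (z + z'))) <=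
      phi mu a * W n z.
    rewrite [leLHS](_ : _ = \sum_i \sum_(b : bool)
      expR ((-1) ^+ b * k * ((z i)%:~R - (x i)%:~R - n%:R * v i) +
           (chi * (t%:R - n.+1%:R) - k * w)) * expR (- ((-1) ^+ b * k * v i)) *
      phi mu (fun j => a j + (-1) ^+ b * k * (j == i)%:R)).
      rewrite /W mulr_sumr; apply: ler_sum => i _.
      rewrite mulr_sumr; apply: ler_sum => b _.
      rewrite -mulrA (mulrC (expR (- ((-1) ^+ b * k * v i)))).
      apply: le_trans (ler_wpM2l (expR_ge0 _) (hphi i b)) _.
      rewrite mulrCA -expRD ler_wpM2l ?phi_ge0// ler_expR -natr1; lra.
    transitivity (rsum (fun z' => \sum_i \sum_(b : bool)
      expR ((-1) ^+ b * k * ((z i)%:~R - (x i)%:~R - n%:R * v i) +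
           (chi * (t%:R - n.+1%:R) - k * w)) * expR (- ((-1) ^+ b * k * v i)) *
      (mu z' * expR (dot (fun j => a j + (-1) ^+ b * k * (j == i)%:R) z')))).
      apply: eq_rsum => z'; rewrite /W mulrA mulr_sumr; apply: eq_bigr => i _.
      rewrite mulr_sumr; apply: eq_bigr => b _.
      rewrite mulrCA -!mulrA; congr (_ * _); rewrite -!expRD mulrC -?expRD; congr expR.
      rewrite dotDl dotZl dot_unitv ffunE rmorphD -natr1; ring.
    rewrite rsum_sum => [|i]; last first.
      by apply: abs_summable_sum => b; apply: abs_summableZ; apply: (phi_summable mu_ge0 mu_exp).
    apply: eq_bigr => i _; rewrite rsum_sum => [|b]; last first.
      by apply: abs_summableZ; apply: (phi_summable mu_ge0 mu_exp).
    by apply: eq_bigr => b _; rewrite rsumZ.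
  have sW : abs_summable (fun z' => mu z' * (expR (dot a z') * W n.+1 (z + z'))).
    have : abs_summable (fun z' => \sum_i \sum_(b : bool)
      expR ((-1) ^+ b * k * ((z i)%:~R - (x i)%:~R - n%:R * v i) +
           (chi * (t%:R - n.+1%:R) - k * w)) * expR (- ((-1) ^+ b * k * v i)) *
      (mu z' * expR (dot (fun j => a j + (-1) ^+ b * k * (j == i)%:R) z'))).
      by apply: abs_summable_sum => i; apply: abs_summable_sum => b;
        apply: abs_summableZ; apply: (phi_summable mu_ge0 mu_exp).
    congr abs_summable; apply/funext => z'.
    apply/esym; rewrite /W mulrA mulr_sumr; apply: eq_bigr => i _.
    rewrite mulr_sumr; apply: eq_bigr => b _.
    rewrite mulrCA -!mulrA; congr (_ * _); rewrite -!expRD mulrC -?expRD; congr expR.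
    rewrite dotDl dotZl dot_unitv ffunE rmorphD -natr1; ring.
  pose K := m * phi mu a ^+ (t - n.+1) * expR (dot a z).
  have K0 : 0 <= K by rewrite !mulr_ge0 ?exprn_ge0 ?phi_ge0 ?expR_ge0.
  apply: (@le_trans _ _ (rsum (fun z' => K * (mu z' * expR (dot a z') -
     mu z' * (expR (dot a z') * W n.+1 (z + z')))))).
    rewrite rsumZ rsumB//; last exact: (phi_summable mu_ge0 mu_exp).
    rewrite -/(phi mu a).
    rewrite (_ : m * _ ^+ _ * _ * _ = K * (phi mu a - phi mu a * W n z)).
      by rewrite ler_wpM2l// lerD2l lerN2.
    rewrite /K (_ : (t - n = (t - n.+1).+1)%N); last by rewrite subnSK.
    by rewrite exprS; ring.
  apply: rsum_le => //.
    apply: abs_summableZ; apply: abs_summableB => //; exact: (phi_summable mu_ge0 mu_exp).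
  move=> z'; rewrite [leLHS](_ : _ = mu z' *
    (m * phi mu a ^+ (t - n.+1) * expR (dot a (z + z')) * (1 - W n.+1 (z + z')))); last first.
    by rewrite dotD expRD /K; ring.
  rewrite ler_wpM2l//.
  apply: (@le_trans _ _ (B n.+1 (z + z'))).
    rewrite /B ler_wpM2l ?le_max ?lexx ?orbT//.
    by rewrite !mulr_ge0 ?exprn_ge0 ?phi_ge0 ?expR_ge0.
  have [hy|hy] := pselect (forall i, `|((z + z') i)%:~R - (x i)%:~R - n.+1%:R * v i| <= w).
    rewrite /cut mem_set; first by apply: IH => //; rewrite addSnnS.
    exact: (htube n.+1).
  have : 1 <= W n.+1 (z + z').
    move/existsNP : hy => [i /negP]; rewrite -ltNge => hi.
    rewrite /W (bigD1 i)//= -[leLHS]addr0 lerD//; last first.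
      by apply: sumr_ge0 => j _; apply: sumr_ge0 => b _; rewrite expR_ge0.
    have ct : 0 <= chi * (t%:R - n.+1%:R) by rewrite mulr_ge0// subr_ge0 ler_nat.
    set u := _ - _ - _ in hi *; rewrite big_bool /= expr0 expr1 !mulN1r mul1r.
    have e1 (q : R) : 0 <= q -> 1 <= expR q by move=> q0; rewrite -expR0 ler_expR.
    have kw : k * w <= k * `|u| by rewrite ler_wpM2l// ltW.
    have [u0|u0] := leP 0 u.
      rewrite -[leLHS]add0r lerD ?expR_ge0// e1//.
      by rewrite ger0_norm// in kw; lra.
    rewrite -[leLHS]addr0 lerD ?expR_ge0// e1//.
    by rewrite ltr0_norm// mulrN in kw; lra.
  move=> W2; rewrite /B max_l ?subr_le0// mulr0 /cut; case: ifPn => // /set_mem.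
  exact: g0.
have hx i : `|(x i)%:~R - (x i)%:~R - 0%:R * v i| <= w by rewrite subrr mul0r subr0 normr0.
apply: le_trans (main t 0%N x (add0n t) hx).
rewrite /B subn0 ler_wpM2l ?mulr_ge0 ?exprn_ge0 ?phi_ge0 ?expR_ge0//.
rewrite le_max; apply/orP; right; rewrite lerD2l lerN2 /W.
rewrite (eq_bigr (fun=> expR (chi * t%:R - k * w) *+ 2)).
  by rewrite sumr_const card_ord -mulrnA -[leLHS]mulr_natl natrM.
move=> i _; rewrite big_bool /= mulr2n !subrr mul0r !subr0 !mulr0 !add0r.
by [].
Qed.

End tube.

Lemma is_derive_bound {R : realType} (f df : R -> R) (y K : R) :
  (forall x : R, is_derive x 1 f (df x)) -> f 0 = 0 ->
  (forall c : R, `|c| <= `|y| -> `|df c| <= K) -> `|f y| <= K * `|y|.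
Proof.
move=> fd f0 dfK.
have cf a b : {within `[a, b], continuous f}.
  apply: continuous_subspaceT => x; apply: differentiable_continuous.
  by apply/derivable1_diffP; have [] := fd x.
have [y0|y0] := leP 0 y.
  have [c cy E] := MVT_segment y0 (fun x _ => fd x) (cf 0 y).
  rewrite f0 !subr0 in E; rewrite E normrM ler_wpM2r// dfK//.
  by move: cy; rewrite in_itv/= => /andP[c0 cy]; rewrite !ger0_norm.
have [c cy E] := MVT_segment (ltW y0) (fun x _ => fd x) (cf y 0).
rewrite f0 !sub0r in E; rewrite -normrN E normrM normrN ler_wpM2r// dfK//.
move: cy; rewrite in_itv/= => /andP[yc c0].
by rewrite ler0_norm// ltr0_norm// lerN2.
Qed.

(** Three applications of the mean value inequality, each integrating the previous remainder; the
    factor 1/6 is given up. *)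
Lemma expR_taylor2 {R : realType} (y : R) :
  `|expR y - 1 - y - y ^+ 2 / 2| <= `|y| ^+ 3 * expR `|y|.
Proof.
have h1 (x : R) : `|expR x - 1| <= expR `|x| * `|x|.
  apply: (@is_derive_bound _ (fun x => expR x - 1) expR).
  - by move=> z; apply: is_derive_eq; rewrite oppr0 addr0.
  - by rewrite expR0 subrr.
  - by move=> c cx; rewrite ger0_norm ?expR_ge0// ler_expR (le_trans (ler_norm _) cx).
have h2 (x : R) : `|expR x - 1 - x| <= (expR `|x| * `|x|) * `|x|.
  apply: (@is_derive_bound _ (fun x => expR x - 1 - x) (fun x => expR x - 1)).
  - by move=> z; apply: is_derive_eq; rewrite oppr0 addr0.
  - by rewrite expR0 subrr subr0.
  - by move=> c cx; apply: le_trans (h1 c) _; rewrite ler_pM ?expR_ge0 ?ler_expR.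
have := @is_derive_bound _ (fun x => expR x - 1 - x - x ^+ 2 / 2) (fun x => expR x - 1 - x) y
  (expR `|y| * `|y| * `|y|).
rewrite (_ : `|y| ^+ 3 * expR `|y| = expR `|y| * `|y| * `|y| * `|y|); last by ring.
apply.
- move=> z; apply: is_derive_eq.
  rewrite /GRing.scale /=; lra.
- by rewrite expR0; ring.
- by move=> c cx; apply: le_trans (h2 c) _; rewrite !ler_pM ?mulr_ge0 ?expR_ge0 ?ler_expR.
Qed.

(** Here p and P stand for [psi] at s^2 beta and at s^2 beta perturbed by s^3 in direction i, q for
    the quadratic form at s^2 beta, w for (cov beta) i and c for cov i i. The cross term u of order
    s^5 is the only part of P - p above order s^6, and the exponential on the left removes it: (p -
    1) u is O(s^6), and p >= 1 turns the additive error into a factor. *)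
Lemma tilt_arith {R : realType} (s k p P q w c : R) (b : bool) :
  0 <= s -> s <= 1 -> 0 <= k -> 1 <= p ->
  `|p - 1 - q / 2| <= k * s ^+ 6 ->
  `|P - 1 - (q + 2 * ((-1) ^+ b * s ^+ 5 * w) + s ^+ 6 * c) / 2| <= k * s ^+ 6 ->
  `|q| <= k * s ^+ 4 -> `|w| <= k -> `|c| <= k ->
  P * expR (- ((-1) ^+ b * s ^+ 5 * w)) <= p * expR ((3 * k + 2 * k ^+ 2) * s ^+ 6).
Proof.
move=> s0 s1 k0 p1 hp hP hq hw hc.
set u := (-1) ^+ b * s ^+ 5 * w in hP *.
have s6 : 0 <= s ^+ 6 by rewrite exprn_ge0.
have s4 : 0 <= s ^+ 4 by rewrite exprn_ge0.
have hu : `|u| <= k * s ^+ 2.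
  rewrite /u !normrM normrX normrN1 expr1n mul1r mulrC ler_pM//.
  by rewrite (ger0_norm s0) -[leLHS]/(s ^+ 5) ler_wiXn2l.
have s64 : s ^+ 6 <= s ^+ 4 by rewrite ler_wiXn2l.
have hp' : `|1 - p| <= 2 * k * s ^+ 4.
  have h : k * s ^+ 6 <= k * s ^+ 4 by rewrite ler_wpM2l.
  by move: hp hq; rewrite !ler_norml => /andP[? ?] /andP[? ?]; apply/andP; split; lra.
have hpu : (1 - p) * u <= 2 * k ^+ 2 * s ^+ 6.
  apply: le_trans (ler_norm _) _; rewrite normrM.
  apply: le_trans (ler_pM _ _ hp' hu) _ => //.
  by rewrite le_eqVlt; apply/orP; left; apply/eqP; ring.
have hsc : s ^+ 6 * c <= s ^+ 6 * k.
  by rewrite ler_wpM2l// (le_trans (ler_norm _) hc).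
have hP1 : P <= p + p * u + (3 * k + 2 * k ^+ 2) * s ^+ 6.
  have : 0 <= k * s ^+ 6 by rewrite mulr_ge0.
  move: hp hP; rewrite !ler_norml => /andP[? ?] /andP[? ?] ?.
  have -> : p * u = u - (1 - p) * u by ring.
  lra.
have hP2 : P <= p * expR (u + (3 * k + 2 * k ^+ 2) * s ^+ 6).
  apply: le_trans hP1 (le_trans _ (ler_wpM2l _ (expR_ge1Dx _))); last by lra.
  have h : (3 * k + 2 * k ^+ 2) * s ^+ 6 <= p * ((3 * k + 2 * k ^+ 2) * s ^+ 6).
    by rewrite ler_peMl// mulr_ge0// addr_ge0// mulr_ge0// exprn_ge0.
  lra.
apply: le_trans (ler_wpM2r (expR_ge0 _) hP2) _.
by rewrite -mulrA -expRD addrAC subrr add0r.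
Qed.

(** * Second order expansion of the Laplace transform *)

Section moments.
Context {R : realType} {d : nat}.
Notation X := (zvec 'I_d).
Variables (mu : X -> R) (c0 : R).
Hypotheses (mu_ge0 : forall z, 0 <= mu z) (mu_mass : rsum mu = 1) (c0_gt0 : 0 < c0)
  (mu_exp : abs_summable (fun z => mu z * expR (c0 * l1 z))).
Implicit Types (a b beta : 'I_d -> R) (x y z : X).

Let c0_ge0 : 0 <= c0 := ltW c0_gt0.

Definition drift (i : 'I_d) : R := rsum (fun z => mu z * (z i)%:~R).

Definition cov (i j : 'I_d) : R :=
  rsum (fun z => mu z * (((z i)%:~R - drift i) * ((z j)%:~R - drift j))).

Definition rdot (a b : 'I_d -> R) : R := \sum_i a i * b i.

(** The Laplace transform of the centred step, whose expansion at 0 has no linear term. *)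
Definition psi a : R := rsum (fun z => mu z * expR (dot a z - rdot a drift)).

Definition qform a : R := \sum_i \sum_j a i * a j * cov i j.

Lemma exp_bounded_poly1 (g : X -> R) (k m : R) : 0 <= k -> 0 <= m ->
  (forall z, `|g z| <= k * (l1 z + m)) -> abs_summable (fun z => mu z * g z).
Proof.
move=> k0 m0 hg.
apply: (abs_summable_le (g := fun z => (k * expR (c0 * m) / c0) * (mu z * expR (c0 * l1 z)))).
  move=> z; rewrite normrM (ger0_norm (mu_ge0 z)) mulrCA ler_wpM2l//.
  apply: le_trans (hg z) _; rewrite -!mulrA ler_wpM2l//.
  rewrite mulrCA ler_pdivlMl// -expRD -mulrDr addrC.
  apply: le_trans _ (expR_ge1Dx _); lra.
exact: abs_summableZ.
Qed.

Lemma abs_summable_mu : abs_summable mu.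
Proof.
have := @exp_bounded_poly1 (fun=> 1) 1 1 ler01 ler01 _; rewrite /=.
have -> : (fun z => mu z * 1) = mu by apply/funext => z; rewrite mulr1.
by apply => z; rewrite normr1 mul1r lerDr l1_ge0.
Qed.

Let m1 := \sum_i `|drift i|.
Let m1_ge0 : 0 <= m1. Proof. exact: sumr_ge0. Qed.

Lemma abs_summable_coord i : abs_summable (fun z => mu z * (z i)%:~R).
Proof.
apply: (@exp_bounded_poly1 _ 1 0) => // z.
by rewrite mul1r addr0 ler_coord_l1.
Qed.

Lemma dot_centered a z : dot a z - rdot a drift = \sum_i a i * ((z i)%:~R - drift i).
Proof.
rewrite /dot /rdot -sumrB; apply: eq_bigr => i _; ring.
Qed.

Lemma ler_dot_centered a (s : R) z : 0 <= s -> (forall i, `|a i| <= s) ->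
  `|dot a z - rdot a drift| <= s * (l1 z + m1).
Proof.
move=> s0 ha; rewrite dot_centered; apply: le_trans (ler_norm_sum _ _ _) _.
rewrite /l1 /m1 -big_split mulr_sumr; apply: ler_sum => i _.
by rewrite normrM ler_pM// ler_normB.
Qed.

Let cube_exp (u : R) : 0 <= u -> u ^+ 3 * expR (c0 / 2 * u) <= (6 / (c0 / 2) ^+ 3) * expR (c0 * u).
Proof.
move=> u0; have h : u ^+ 3 <= (6 / (c0 / 2) ^+ 3) * expR (c0 / 2 * u).
  have cp : 0 < (c0 / 2) ^+ 3 by rewrite exprn_gt0// divr_gt0.
  have := @expR_ge1Dxn R (c0 / 2 * u) 2 (mulr_ge0 (divr_ge0 c0_ge0 (ler0n _ _)) u0).
  rewrite (_ : 3`!%:R = 6)// exprMn => H.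
  rewrite mulrAC ler_pdivlMr// mulrC; lra.
apply: le_trans (ler_wpM2r (expR_ge0 _) h) _.
rewrite -[leLHS]mulrA -expRD ler_wpM2l ?divr_ge0 ?exprn_ge0 ?divr_ge0//.
by rewrite ler_expR -mulrDl -splitr.
Qed.

Let exp3_summable : abs_summable (fun z => mu z * expR (c0 * (l1 z + m1))).
Proof.
have := abs_summableZr (expR (c0 * m1)) mu_exp; congr abs_summable.
by apply/funext => z; rewrite -mulrA -expRD mulrDr.
Qed.

Lemma sq_centered_summable i j :
  abs_summable (fun z => mu z * (((z i)%:~R - drift i) * ((z j)%:~R - drift j))).
Proof.
apply: (abs_summable_le (g := fun z => (2 / c0 ^+ 2) * (mu z * expR (c0 * (l1 z + m1))))).
  move=> z; rewrite normrM (ger0_norm (mu_ge0 z)) mulrCA ler_wpM2l//.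
  have u0 : 0 <= l1 z + m1 by rewrite addr_ge0// l1_ge0.
  have hb k : `|(z k)%:~R - drift k| <= l1 z + m1.
    apply: le_trans (ler_normB _ _) (lerD (ler_coord_l1 _ _) _).
    by rewrite /m1 (bigD1 k)//= lerDl sumr_ge0.
  rewrite normrM; apply: (@le_trans _ _ ((l1 z + m1) ^+ 2)).
    by rewrite expr2 ler_pM.
  have := @expR_ge1Dxn R (c0 * (l1 z + m1)) 1 (mulr_ge0 c0_ge0 u0).
  rewrite (_ : 2`!%:R = 2)// exprMn => H.
  by rewrite mulrAC ler_pdivlMr ?exprn_gt0// mulrC; lra.
exact: abs_summableZ.
Qed.

Lemma qform_rsum a :
  abs_summable (fun z => mu z * (dot a z - rdot a drift) ^+ 2) /\
  rsum (fun z => mu z * (dot a z - rdot a drift) ^+ 2) = qform a.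
Proof.
pose y z := dot a z - rdot a drift.
have y2E z : y z ^+ 2 = \sum_i \sum_j a i * a j * (((z i)%:~R - drift i) * ((z j)%:~R - drift j)).
  rewrite /y dot_centered expr2 mulr_suml; apply: eq_bigr => i _.
  by rewrite mulr_sumr; apply: eq_bigr => j _; ring.
have sy2F : (fun z => mu z * y z ^+ 2) = (fun z => \sum_i \sum_j a i * a j *
    (mu z * (((z i)%:~R - drift i) * ((z j)%:~R - drift j)))).
  apply/funext => z; rewrite y2E mulr_sumr; apply: eq_bigr => i _.
  by rewrite mulr_sumr; apply: eq_bigr => j _; rewrite mulrCA.
have sij i j : abs_summable (fun z => a i * a j *
    (mu z * (((z i)%:~R - drift i) * ((z j)%:~R - drift j)))).
  exact/abs_summableZ/sq_centered_summable.
have sy2 : abs_summable (fun z => mu z * y z ^+ 2).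
  rewrite sy2F; apply: abs_summable_sum => i; exact: abs_summable_sum.
have y2sum : rsum (fun z => mu z * y z ^+ 2) = qform a.
  rewrite sy2F rsum_sum => [|i]; last exact: abs_summable_sum.
  apply: eq_bigr => i _; rewrite rsum_sum//; apply: eq_bigr => j _.
  by rewrite rsumZ.
by split.
Qed.

(** The centred linear term sums to 0 and the quadratic one to [qform]. The cubic remainder is
    summable because s <= c0 / 2 leaves half of the exponential moment to absorb the cube of
    [l1 z + m1]. *)
Lemma psi_taylor : exists2 K, 0 <= K & forall a (s : R), 0 <= s -> s <= c0 / 2 ->
  (forall i, `|a i| <= s) -> `|psi a - 1 - qform a / 2| <= K * s ^+ 3.
Proof.
pose K := rsum (fun z => mu z * expR (c0 * (l1 z + m1))) * (6 / (c0 / 2) ^+ 3).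
exists K.
  rewrite mulr_ge0 ?divr_ge0 ?exprn_ge0 ?divr_ge0//.
  by apply: rsum_ge0 => z; rewrite mulr_ge0// expR_ge0.
move=> a s s0 sc ha; pose y z := dot a z - rdot a drift.
have hy z : `|y z| <= s * (l1 z + m1) by exact: ler_dot_centered.
have sy : abs_summable (fun z => mu z * y z).
  exact: (exp_bounded_poly1 s0 m1_ge0 hy).
have [sy2 y2sum] := qform_rsum a.
have y1sum : rsum (fun z => mu z * y z) = 0.
  rewrite [LHS](_ : _ = rsum (fun z => \sum_i a i * (mu z * (z i)%:~R - drift i * mu z))).
    rewrite rsum_sum; last first.
      move=> i; apply: abs_summableZ; apply: abs_summableB; first exact: abs_summable_coord.
      exact/abs_summableZ/abs_summable_mu.
    rewrite big1// => i _; rewrite rsumZ rsumB; last 2 first.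
    - exact: abs_summable_coord.
    - exact/abs_summableZ/abs_summable_mu.
    by rewrite rsumZ mu_mass mulr1 -/(drift i) subrr mulr0.
  apply: eq_rsum => z; rewrite /y dot_centered mulr_sumr; apply: eq_bigr => i _; ring.
have spsi : abs_summable (fun z => mu z * expR (y z)).
  apply: abs_summable_le exp3_summable => z.
  rewrite normrM (ger0_norm (mu_ge0 z)) ler_wpM2l// ger0_norm ?expR_ge0// ler_expR.
  apply: le_trans (ler_norm _) (le_trans (hy z) _).
  rewrite ler_wpM2r ?addr_ge0 ?l1_ge0//; lra.
have -> : psi a - 1 - qform a / 2 =
    rsum (fun z => mu z * (expR (y z) - 1 - y z - y z ^+ 2 / 2)).
  rewrite [RHS](_ : _ = rsum (fun z => (mu z * expR (y z) - mu z) -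
     (mu z * y z + mu z * y z ^+ 2 / 2))).
    rewrite rsumB; last 2 first.
    - by apply: abs_summableB => //; exact: abs_summable_mu.
    - by apply: abs_summableD => //; exact: abs_summableZr.
    rewrite rsumB//; last exact: abs_summable_mu.
    rewrite rsumD//; last exact: abs_summableZr.
    by rewrite rsumZr y2sum y1sum mu_mass add0r.
  by apply: eq_rsum => z; ring.
have hpt z : `|mu z * (expR (y z) - 1 - y z - y z ^+ 2 / 2)| <=
    (6 / (c0 / 2) ^+ 3) * s ^+ 3 * (mu z * expR (c0 * (l1 z + m1))).
  rewrite normrM (ger0_norm (mu_ge0 z)) mulrCA ler_wpM2l//.
  apply: le_trans (expR_taylor2 _) _.
  have u0 : 0 <= l1 z + m1 by rewrite addr_ge0// l1_ge0.
  apply: (@le_trans _ _ ((s * (l1 z + m1)) ^+ 3 * expR (c0 / 2 * (l1 z + m1)))).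
    rewrite ler_pM ?exprn_ge0 ?expR_ge0//.
      by rewrite lerXn2r ?nnegrE// mulr_ge0.
    by rewrite ler_expR; apply: le_trans (hy z) _; rewrite ler_wpM2r.
  rewrite exprMn -[leLHS]mulrA (mulrC (6 / _)) -[leRHS]mulrA ler_wpM2l ?exprn_ge0//.
  exact: cube_exp.
have sD : abs_summable (fun z => (6 / (c0 / 2) ^+ 3) * s ^+ 3 * (mu z * expR (c0 * (l1 z + m1)))).
  exact: abs_summableZ.
have sN := abs_summable_le hpt sD.
apply: le_trans (ler_norm_rsum sN) _.
apply: le_trans (rsum_le (abs_summable_norm sN) sD hpt) _.
by rewrite rsumZ /K mulrC mulrA.
Qed.

(** Jensen's inequality, through 1 + y <= exp(y). *)
Lemma psi_ge1 a : (forall i, `|a i| <= c0) -> 1 <= psi a.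
Proof.
move=> ha.
have hy z : `|dot a z - rdot a drift| <= c0 * (l1 z + m1) by exact: ler_dot_centered.
have spsi : abs_summable (fun z => mu z * expR (dot a z - rdot a drift)).
  apply: abs_summable_le exp3_summable => z.
  rewrite normrM (ger0_norm (mu_ge0 z)) ler_wpM2l// ger0_norm ?expR_ge0// ler_expR.
  exact: le_trans (ler_norm _) (hy z).
have sl : abs_summable (fun z => \sum_i a i * (mu z * (z i)%:~R - drift i * mu z)).
  apply: abs_summable_sum => i; apply: abs_summableZ; apply: abs_summableB.
    exact: abs_summable_coord.
  exact/abs_summableZ/abs_summable_mu.
have : rsum (fun z => mu z + \sum_i a i * (mu z * (z i)%:~R - drift i * mu z)) = 1.
  rewrite rsumD//; last exact: abs_summable_mu.
  rewrite mu_mass rsum_sum; last first.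
    move=> i; apply: abs_summableZ; apply: abs_summableB.
      exact: abs_summable_coord.
    exact/abs_summableZ/abs_summable_mu.
  rewrite big1 ?addr0// => i _; rewrite rsumZ rsumB; last 2 first.
  - exact: abs_summable_coord.
  - exact/abs_summableZ/abs_summable_mu.
  by rewrite rsumZ mu_mass mulr1 -/(drift i) subrr mulr0.
move=> <-; apply: rsum_le => //.
  by apply: abs_summableD => //; exact: abs_summable_mu.
move=> z; apply: le_trans (ler_wpM2l (mu_ge0 z) (expR_ge1Dx _)).
rewrite mulrDr mulr1 lerD2l dot_centered mulr_sumr le_eqVlt; apply/orP; left; apply/eqP.
by apply: eq_bigr => i _; ring.
Qed.

Lemma phi_psi a : phi mu a = psi a * expR (rdot a drift).
Proof.
rewrite /psi -rsumZr; apply: eq_rsum => z.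
by rewrite -mulrA -expRD subrK.
Qed.

Lemma cov_sym i j : cov i j = cov j i.
Proof. by apply: eq_rsum => z; rewrite [X in _ * X]mulrC. Qed.

(** To first order, a small tilt by beta adds this vector to the speed of the walk. *)
Definition cov_mul beta i : R := \sum_j cov i j * beta j.

Lemma qform_shift a (k : R) i :
  qform (fun j => a j + k * (j == i)%:R) =
  qform a + 2 * (k * cov_mul a i) + k ^+ 2 * cov i i.
Proof.
rewrite /qform.
have E j l : (a j + k * (j == i)%:R) * (a l + k * (l == i)%:R) * cov j l =
   a j * a l * cov j l + ((l == i)%:R * (k * (a j * cov j l)) +
   (j == i)%:R * (k * (a l * cov j l))) + (j == i)%:R * ((l == i)%:R * (k ^+ 2 * cov j l)).
  ring.
have D (F : 'I_d -> R) : \sum_j (j == i)%:R * F j = F i.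
  by rewrite (bigD1 i)//= eqxx mul1r big1 ?addr0// => j /negbTE ->; rewrite mul0r.
under eq_bigr => j _ do under eq_bigr => l _ do rewrite E.
under eq_bigr => j _ do rewrite !big_split /= D -!mulr_sumr D.
rewrite !big_split /= !D -mulr_sumr.
have -> : \sum_j a j * cov j i = cov_mul a i.
  by apply: eq_bigr => j _; rewrite cov_sym mulrC.
have -> : \sum_j a j * cov i j = cov_mul a i.
  by apply: eq_bigr => j _; rewrite mulrC.
ring.
Qed.

Lemma qformZ (k : R) a : qform (fun i => k * a i) = k ^+ 2 * qform a.
Proof.
rewrite /qform mulr_sumr; apply: eq_bigr => i _; rewrite mulr_sumr.
by apply: eq_bigr => j _; ring.
Qed.

Lemma cov_mulZ (k : R) a i : cov_mul (fun i => k * a i) i = k * cov_mul a i.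
Proof. by rewrite /cov_mul mulr_sumr; apply: eq_bigr => j _; ring. Qed.

(* With tilt s^2 beta the walk moves at speed drift + s^2 cov beta up to an error
   of order s^3, which is negligible with respect to the gain s^2. *)
Lemma tilt_estimate beta : exists C s0 : R, [/\ 0 <= C, 0 < s0, s0 <= 1 &
  forall s, 0 < s -> s <= s0 ->
  [/\ (forall i, `|s ^+ 2 * beta i| + s ^+ 3 <= c0),
      (forall i (b : bool),
        phi mu (fun j => s ^+ 2 * beta j + (-1) ^+ b * s ^+ 3 * (j == i)%:R) *
        expR (- ((-1) ^+ b * s ^+ 3 * (drift i + s ^+ 2 * cov_mul beta i))) <=
        phi mu (fun j => s ^+ 2 * beta j) * expR (C * s ^+ 6)) &
      expR (rdot (fun j => s ^+ 2 * beta j) drift) <= phi mu (fun j => s ^+ 2 * beta j)]].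
Proof.
have [K K0 hK] := psi_taylor.
pose B := \sum_i `|beta i|.
have B0 : 0 <= B by exact: sumr_ge0.
have hB i : `|beta i| <= B by rewrite /B (bigD1 i)//= lerDl sumr_ge0.
(* One constant above all the coefficients that enter [tilt_arith]. *)
pose k := K * (B + 1) ^+ 3 + `|qform beta| + \sum_i (`|cov_mul beta i| + `|cov i i|).
have sum0 : 0 <= \sum_i (`|cov_mul beta i| + `|cov i i|).
  by apply: sumr_ge0 => i _; rewrite addr_ge0.
have KB0 : 0 <= K * (B + 1) ^+ 3 by rewrite mulr_ge0// exprn_ge0// addr_ge0.
have k0 : 0 <= k by rewrite !addr_ge0.
have kK : K * (B + 1) ^+ 3 <= k by rewrite /k -addrA lerDl addr_ge0.
have kq : `|qform beta| <= k.
  by rewrite /k [K * _ + _]addrC -addrA lerDl addr_ge0.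
have kci i : `|cov_mul beta i| + `|cov i i| <= k.
  apply: (@le_trans _ _ (\sum_i (`|cov_mul beta i| + `|cov i i|))).
    rewrite [leRHS](bigD1 i)//= lerDl; apply: sumr_ge0 => j _.
    by rewrite addr_ge0.
  by rewrite /k lerDr addr_ge0.
have kc i : `|cov_mul beta i| <= k by apply: le_trans (kci i); rewrite lerDl.
have kii i : `|cov i i| <= k by apply: le_trans (kci i); rewrite lerDr.
have B1 : 0 < B + 1 by rewrite ltr_wpDl.
exists (3 * k + 2 * k ^+ 2), (Num.min 1 (c0 / 2 / (B + 1))); split.
- by rewrite addr_ge0// mulr_ge0// exprn_ge0.
- by rewrite lt_min ltr01 !divr_gt0.
- by rewrite ge_min lexx.
move=> s s_gt0; rewrite le_min => /andP[s1 sB].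
have s_ge0 := ltW s_gt0.
have s2_ge0 : 0 <= s ^+ 2 by rewrite exprn_ge0.
have s3_ge0 : 0 <= s ^+ 3 by rewrite exprn_ge0.
have s32 : s ^+ 3 <= s ^+ 2 by rewrite ler_wiXn2l.
have s21 : s ^+ 2 <= s by rewrite -{2}(expr1 s) ler_wiXn2l.
(* As s^3 <= s^2, this bounds the perturbed tilts too, and the Taylor error K s'^3 is of order
   s^6. *)
pose s' := s ^+ 2 * (B + 1).
have s'0 : 0 <= s' by rewrite mulr_ge0// ltW.
have s'c : s' <= c0 / 2.
  by rewrite /s' -ler_pdivlMr//; exact: le_trans s21 sB.
have c2 : c0 / 2 <= c0 by rewrite ler_pdivrMr// ler_peMr// ler1n.
have ha i : `|s ^+ 2 * beta i| + s ^+ 3 <= s'.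
  rewrite normrM (ger0_norm s2_ge0) /s' mulrDr mulr1 lerD// ler_wpM2l//.
have ha' i : `|s ^+ 2 * beta i| <= s' by apply: le_trans (ha i); rewrite lerDl.
have ha0 i : `|s ^+ 2 * beta i| <= c0 by apply: le_trans (ha' i) (le_trans s'c c2).
have hs'3 : K * s' ^+ 3 <= k * s ^+ 6.
  rewrite /s' exprMn -exprM mulrCA mulrC ler_wpM2r ?exprn_ge0//.
have p1 := psi_ge1 ha0.
split.
- by move=> i; apply: le_trans (ha i) (le_trans s'c c2).
- move=> i b; rewrite !phi_psi.
  set P := psi _; set p := psi _.
  have -> : rdot (fun j => s ^+ 2 * beta j + (-1) ^+ b * s ^+ 3 * (j == i)%:R) drift =
    rdot (fun j => s ^+ 2 * beta j) drift + (-1) ^+ b * s ^+ 3 * drift i.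
    rewrite /rdot; under eq_bigr do rewrite mulrDl.
    rewrite big_split /=; congr +%R; rewrite (bigD1 i)//= eqxx mulr1 big1 ?addr0//.
    by move=> j /negbTE ->; rewrite mulr0 mul0r.
  set u := rdot _ _.
  rewrite -mulrA -expRD (_ : _ + - _ = u + - ((-1) ^+ b * s ^+ 5 * cov_mul beta i)); last by ring.
  rewrite expRD [expR u * _]mulrC mulrA [leRHS]mulrAC ler_wpM2r ?expR_ge0//.
  apply: (@tilt_arith _ _ _ _ _ (qform (fun j => s ^+ 2 * beta j)) _ (cov i i)) => //.
  + by apply: le_trans (hK _ s' s'0 s'c ha') hs'3.
  + rewrite [X in _ + X](_ : _ = - (qform (fun j => s ^+ 2 * beta j +
       (-1) ^+ b * s ^+ 3 * (j == i)%:R) / 2)).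
      apply: le_trans (hK _ s' s'0 s'c _) hs'3 => j.
      apply: le_trans (ler_normD _ _) (le_trans _ (ha j)).
      rewrite lerD2l normrM normrM normrX normrN1 expr1n mul1r (ger0_norm s3_ge0).
      by case: eqP; rewrite ?normr1 ?mulr1// normr0 mulr0.
    rewrite qform_shift cov_mulZ exprMn -exprM mulnC exprM sqrrN expr1n expr1n mul1r.
    by congr (- (_ / _)); ring.
  + rewrite qformZ normrM -exprM ger0_norm ?exprn_ge0// mulrC.
    by rewrite ler_wpM2r// exprn_ge0.
- rewrite phi_psi ler_peMl// expR_ge0//.
Qed.

End moments.

(** * Lower bound along the lines of speed drift + s^2 cov beta *)

Section lower_bound.
Context {R : realType} {d : nat}.
Notation X := (zvec 'I_d).
Variables (mu : X -> R) (c0 : R).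
Hypotheses (mu_ge0 : forall z, 0 <= mu z) (mu_mass : rsum mu = 1) (c0_gt0 : 0 < c0)
  (mu_exp : abs_summable (fun z => mu z * expR (c0 * l1 z))).
Implicit Types (a b beta : 'I_d -> R) (x y z : X).


(** If cov beta = 0, the linear form beta has variance 0 under mu, so every possible jump changes it
    by its mean m. A path of n1 > 0 jumps from 0 to [unitv i] and one of n2 jumps from 0 to
    [- unitv i] give beta i = n1 m and - beta i = n2 m, whence m = 0. *)
Lemma cov_mul_inj beta : irreducible_on mu finset.set0 -> (forall i, cov_mul mu beta i = 0) ->
  forall i, beta i = 0.
Proof.
move=> irr h0.
have q0 : qform mu beta = 0.
  rewrite /qform big1// => i _; rewrite [LHS](_ : _ = beta i * cov_mul mu beta i).
    by rewrite h0 mulr0.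
  by rewrite /cov_mul mulr_sumr; apply: eq_bigr => j _; ring.
have [ss sE] := qform_rsum mu_ge0 c0_gt0 mu_exp beta.
pose m := rdot beta (drift mu).
have hm z : 0 < mu z -> dot beta z = m.
  move=> muz; apply/eqP; rewrite -subr_eq0 -sqrf_eq0.
  have := @le_rsum_term _ _ _ z _ ss; rewrite sE q0 => /(_ _)/wrap[|h].
    by move=> y; rewrite mulr_ge0// sqr_ge0.
  by rewrite eq_le sqr_ge0 andbT -(pmulr_rle0 _ muz).
have hpath x s : path (fun y z => 0 < mu (z - y)) x s ->
    dot beta (last x s) = dot beta x + (size s)%:R * m.
  elim: s x => [|y s IH] x /=; first by rewrite mul0r addr0.
  move=> /andP[/hm hy /IH ->]; rewrite -natr1 mulrDl mul1r -hy dotB; ring.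
have all_in x : orthant_on finset.set0 x by move=> i; rewrite inE.
move=> i.
have [s1 [_ ls1 /hpath]] := irr 0 (unitv i) (all_in _) (all_in _).
have [s2 [_ ls2 /hpath]] := irr 0 (- unitv i) (all_in _) (all_in _).
have bi : dot beta (unitv i) = beta i.
  rewrite /dot (bigD1 i)//= unitvE eqxx mulr1 big1 ?addr0// => j /negbTE ji.
  by rewrite unitvE ji mulr0.
rewrite ls1 ls2 dotN dot0 !add0r bi => e2 e1.
have s1n : (0 < size s1)%N.
  case: s1 ls1 {e1} => //= h; have : (unitv i) i = 0 :> int by rewrite -h ffunE.
  by rewrite unitv_val eqxx.
have : ((size s1)%:R + (size s2)%:R) * m = 0 by rewrite mulrDl -e1 -e2 subrr.
move=> /eqP; rewrite mulf_eq0 => /orP[|/eqP m0].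
  by rewrite -natrD pnatr_eq0 addn_eq0 => /andP[/eqP s10 _]; rewrite s10 in s1n.
by rewrite e1 m0 mulr0.
Qed.

Lemma cov_mul_surj (i : 'I_d) : irreducible_on mu finset.set0 ->
  exists beta, forall j, cov_mul mu beta j = (j == i)%:R.
Proof.
move=> irr; pose A := \matrix_(j, k) cov mu j k.
have uA : A \in unitmx.
  rewrite -row_free_unit; apply: inj_row_free => v vA0.
  apply/rowP => j; rewrite mxE; apply: (cov_mul_inj irr (beta := fun j => v 0 j)) => k.
  have /rowP/(_ k) := vA0; rewrite !mxE => E.
  by rewrite -[RHS]E; apply: eq_bigr => l _; rewrite mxE cov_sym mulrC.
pose D : 'rV[R]_d := delta_mx 0 i.
exists (fun k => (D *m invmx A) 0 k) => j.
have /rowP/(_ j) : (D *m invmx A) *m A = D.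
  by rewrite -mulmxA mulVmx// mulmx1.
rewrite [LHS]mxE [RHS]mxE eqxx /= => <-.
by apply: eq_bigr => l _; rewrite [A l j]mxE cov_sym mulrC.
Qed.

(* The walk tilted by s^2 beta stays near the line of speed drift + s^2 cov beta,
   which does not leave the domain since cov beta is nonnegative on L. *)
Lemma lower_bound (L : {set 'I_d}) beta : irreducible_on mu L ->
  (forall i, i \in L -> drift mu i = 0) -> (forall i, i \in L -> 0 <= cov_mul mu beta i) ->
  exists C s0 : R, [/\ 0 <= C, 0 < s0 & forall s, 0 < s -> s <= s0 ->
  exists T0 : nat, forall (t : nat) g x y, (T0 <= t)%N ->
  superharmonic mu (orthant_on L) g -> orthant_on L x -> orthant_on L y ->
  expR (- (C * (s ^+ 3 * t%:R + \sum_i `|(y i)%:~R - (x i)%:~R -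
     t%:R * (drift mu i + s ^+ 2 * cov_mul mu beta i)|))) * g y <= 2 * g x].
Proof.
move=> irr driftL covL.
have [Ch Ch0 harn] := superharmonic_harnack mu_ge0 irr.
have [C1 [s0 [C10 s0_gt0 s01 hs]]] := tilt_estimate mu_ge0 mu_mass c0_gt0 mu_exp beta.
pose B := \sum_i `|beta i|.
have B0 : 0 <= B by exact: sumr_ge0.
have hB i : `|beta i| <= B by rewrite /B (bigD1 i)//= lerDl sumr_ge0.
pose c1 := C1 + 1.
have c1_gt0 : 0 < c1 by rewrite ltr_wpDl.
pose Q := `|rdot beta (cov_mul mu beta)|.
pose C := Q + 2 * B * d%:R * c1 + Ch * (2 * d%:R * (2 * c1 + 1) + 2 * d%:R * c1) + Ch.
have Q0 : 0 <= Q by exact: normr_ge0.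
have c1_ge0 := ltW c1_gt0.
have CCh : 0 <= C - Ch.
  by rewrite /C addrK; do ?[apply: addr_ge0 | apply: mulr_ge0].
exists C, s0; split => //.
  by rewrite -(subrK Ch C) addr_ge0.
move=> s s_gt0 ss0; have [ac hphi hphi1] := hs s s_gt0 ss0.
have s_ge0 := ltW s_gt0; have s1 : s <= 1 := le_trans ss0 s01.
have s3_gt0 : 0 < s ^+ 3 by rewrite exprn_gt0.
have s6_gt0 : 0 < s ^+ 6 by rewrite exprn_gt0.
(* For t >= T0, s^3 t >= 1 absorbs the rounding of the width, and c1 s^6 t >= 4 d makes the
   probability of leaving the tube at most 1/2. *)
pose T0 := (Num.truncn (4 * d%:R / (c1 * s ^+ 6) + 1 / s ^+ 3)).+1.
exists T0 => t g x y T0t sg xL yL.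
have tbig : 4 * d%:R / (c1 * s ^+ 6) + 1 / s ^+ 3 <= t%:R.
  apply: (@le_trans _ _ T0%:R); last by rewrite ler_nat.
  by apply: ltW; rewrite truncnS_gt.
have t1 : 1 <= s ^+ 3 * t%:R.
  rewrite mulrC -ler_pdivrMr//; apply: le_trans tbig; rewrite lerDr.
  by rewrite divr_ge0 ?mulr_ge0// ltW.
have t2 : 4 * d%:R <= c1 * s ^+ 6 * t%:R.
  rewrite [leRHS]mulrC -ler_pdivrMr ?mulr_gt0//; apply: le_trans tbig; rewrite lerDl.
  by rewrite divr_ge0// ltW.
(* With k = s^3 and chi = c1 s^6 this width gives k w = 2 chi t, so chi t - k w = - c1 s^6 t. *)
pose w := 2 * c1 * s ^+ 3 * t%:R.
have w0 : 0 <= w by rewrite !mulr_ge0// ltW.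
(* Starting from x raised by H > w in every coordinate keeps the tube inside the domain, since the
   speed is nonnegative on L. *)
pose H := (Num.truncn w).+1.
have wH : w < H%:R by rewrite truncnS_gt.
have Hw : H%:R <= w + 1 by rewrite -natr1 lerD2r truncn_le.
pose up : X := [ffun=> H%:Z].
pose x1 := x + up.
have upE i : up i = H%:Z by rewrite ffunE.
have x1E i : (x1 i)%:~R = (x i)%:~R + H%:R :> R.
  by rewrite zvecD upE rmorphD.
have x1L : orthant_on L x1 by move=> i iL; rewrite zvecD upE ltr_wpDr// xL.
pose a i := s ^+ 2 * beta i.
pose v i := drift mu i + s ^+ 2 * cov_mul mu beta i.
set D := \sum_i _.
have D0 : 0 <= D by apply: sumr_ge0.
(* Lower bound at the end of the tube: the tilt is evaluated at the centre of its end section, with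
   an error due to the width w, and g z is compared with g y by the Harnack inequality. *)
pose m := expR (- (dot a x1 + t%:R * rdot a v + s ^+ 2 * B * (d%:R * w))) *
  (expR (- (Ch * (D + d%:R * H%:R + d%:R * w))) * g y).
have [g0 _] := sg.
have m0 : 0 <= m by rewrite !mulr_ge0 ?expR_ge0// g0.
have sumw (u : 'I_d -> R) : (forall i, `|u i| <= w) -> \sum_i `|u i| <= d%:R * w.
  move=> hu; apply: le_trans (ler_sum _ (fun i _ => hu i)) _.
  by rewrite sumr_const card_ord mulr_natl.
have tube n z : (n <= t)%N ->
     (forall i, `|(z i)%:~R - (x1 i)%:~R - n%:R * v i| <= w) -> orthant_on L z.
  move=> _ hz i iL; have := hz i; rewrite ler_norml => /andP[+ _].
  have vi : 0 <= n%:R * v i.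
    by rewrite mulr_ge0// /v driftL// add0r mulr_ge0 ?exprn_ge0// covL.
  have xi : 0 < (x i)%:~R :> R by rewrite ltr0z xL.
  by rewrite x1E => hh; rewrite -(@ltr0z R); lra.
have := @tube_bound R d mu c0 mu_ge0 mu_exp (orthant_on L) g a v (s ^+ 3)
  (c1 * s ^+ 6) w m t x1 sg (ltW s3_gt0) (mulr_ge0 (ltW c1_gt0) (ltW s6_gt0)) ac _ tube m0 _ w0.
move=> /(_ _ _)/wrap[||].
- move=> i b; apply: le_trans (hphi i b) _; rewrite ler_wpM2l ?phi_ge0// ler_expR.
  by rewrite ler_wpM2r ?(ltW s6_gt0)// /c1 lerDl.
- move=> z hz.
  have zL : orthant_on L z := tube t z (leqnn t) hz.
  rewrite /m ler_pM ?expR_ge0// ?mulr_ge0 ?expR_ge0 ?g0//.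
    rewrite ler_expR lerN2 -lerBlDl opprD.
    have -> : dot a z + (- dot a x1 + - (t%:R * rdot a v)) =
        \sum_i a i * ((z i)%:~R - (x1 i)%:~R - t%:R * v i).
      by rewrite /dot /rdot mulr_sumr -!sumrN -!big_split; apply: eq_bigr => i _ /=; ring.
    apply: le_trans (ler_norm _) (le_trans (ler_norm_sum _ _ _) _).
    apply: (@le_trans _ _ (\sum_i s ^+ 2 * B * `|(z i)%:~R - (x1 i)%:~R - t%:R * v i|)).
      apply: ler_sum => i _; rewrite normrM ler_wpM2r// /a normrM ger0_norm ?exprn_ge0//.
      by rewrite ler_wpM2l ?exprn_ge0.
    by rewrite -mulr_sumr ler_wpM2l ?sumw// mulr_ge0 ?exprn_ge0.
  apply: le_trans (harn g z y sg zL yL).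
  rewrite ler_wpM2r ?g0// ler_expR lerN2 ler_wpM2l//.
  apply: (@le_trans _ _ (\sum_i (`|(y i)%:~R - (x i)%:~R - t%:R * v i| + H%:R +
     `|(z i)%:~R - (x1 i)%:~R - t%:R * v i|))).
    rewrite /l1; apply: ler_sum => i _; rewrite zvecB rmorphB /= x1E.
    have -> : (y i)%:~R - (z i)%:~R = ((y i)%:~R - (x i)%:~R - t%:R * v i) - H%:R -
       ((z i)%:~R - ((x i)%:~R + H%:R) - t%:R * v i) :> R by ring.
    apply: le_trans (ler_normB _ _) _; rewrite lerD2r.
    by apply: le_trans (ler_normB _ _) _; rewrite lerD2l ger0_norm.
  rewrite !big_split /= sumr_const card_ord mulr_natl lerD ?sumw// lerD//.
move=> hmain.
have half : 1 / 2 <= 1 - 2 * d%:R * expR (c1 * s ^+ 6 * t%:R - s ^+ 3 * w).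
  have -> : c1 * s ^+ 6 * t%:R - s ^+ 3 * w = - (c1 * s ^+ 6 * t%:R) by rewrite /w; ring.
  rewrite expRN; set u := c1 * s ^+ 6 * t%:R in t2 *.
  have eu : 4 * d%:R <= expR u.
    by apply: le_trans (expR_ge1Dx _); lra.
  have eu0 : 0 < expR u := expR_gt0 u.
  suff : 2 * d%:R * (expR u)^-1 <= 1 / 2 by lra.
  by rewrite ler_pdivrMr//; lra.
have phit : expR (t%:R * rdot a (drift mu)) <= phi mu a ^+ t.
  by rewrite expRM_natl lerXn2r ?nnegrE ?expR_ge0 ?phi_ge0.
have gx := harn g x x1 sg xL x1L.
have l1up : l1 (x1 - x) = d%:R * H%:R :> R.
  rewrite /x1 addrAC subrr add0r /l1.
  under eq_bigr do rewrite upE.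
  by rewrite sumr_const card_ord mulr_natl normr_nat.
rewrite l1up in gx.
have step1 : m * expR (t%:R * rdot a (drift mu)) * expR (dot a x1) * (1 / 2) <= g x1.
  apply: le_trans hmain.
  apply: ler_pM => //.
  - by apply: mulr_ge0; [apply: mulr_ge0 => //|]; exact: expR_ge0.
  - by rewrite ler_wpM2r ?expR_ge0// ler_wpM2l.
have e1 : expR (- (Ch * (d%:R * H%:R))) * (m * expR (t%:R * rdot a (drift mu)) * expR (dot a x1)) <= 2 * g x.
  have := ler_wpM2l (expR_ge0 (- (Ch * (d%:R * H%:R)))) step1.
  move: gx; rewrite mulrA; lra.
apply: le_trans e1.
have -> : expR (- (Ch * (d%:R * H%:R))) * (m * expR (t%:R * rdot a (drift mu)) * expR (dot a x1)) =
  expR (- (Ch * (d%:R * H%:R)) - (dot a x1 + t%:R * rdot a v + s ^+ 2 * B * (d%:R * w)) -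
    Ch * (D + d%:R * H%:R + d%:R * w) + t%:R * rdot a (drift mu) + dot a x1) * g y.
  by rewrite /m !expRD; ring.
rewrite ler_wpM2r ?g0// ler_expR.
(* As [phi mu a] pays for a.drift, the tilt costs only a.v - a.drift per step, which is of order
   s^4. *)
have Eq : rdot a v = rdot a (drift mu) + s ^+ 4 * rdot beta (cov_mul mu beta).
  rewrite /rdot mulr_sumr -big_split; apply: eq_bigr => i _.
  by rewrite /= /a /v; ring.
rewrite Eq.
have hQ : s ^+ 4 * rdot beta (cov_mul mu beta) <= s ^+ 3 * Q.
  apply: (@le_trans _ _ (s ^+ 4 * Q)).
    by rewrite ler_wpM2l ?exprn_ge0// ler_norm.
  by rewrite ler_wpM2r ?normr_ge0// ler_wiXn2l.
have hQt : t%:R * (s ^+ 4 * rdot beta (cov_mul mu beta)) <= t%:R * (s ^+ 3 * Q).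
  by rewrite ler_wpM2l.
have hs2 : s ^+ 2 * B * (d%:R * w) <= B * (d%:R * w).
  by rewrite ler_wpM2r ?mulr_ge0// ler_piMl// exprn_ile1.
have hCH : Ch * (d%:R * H%:R) <= Ch * (d%:R * (w + s ^+ 3 * t%:R)).
  by rewrite !ler_wpM2l//; apply: le_trans Hw _; rewrite lerD2l.
have hCD : 0 <= (C - Ch) * D by rewrite mulr_ge0.
rewrite -/D.
have hC3 : C * (s ^+ 3 * t%:R) = t%:R * (s ^+ 3 * Q) + B * (d%:R * w) +
  2 * (Ch * (d%:R * (w + s ^+ 3 * t%:R))) + Ch * (d%:R * w) + Ch * (s ^+ 3 * t%:R).
  by rewrite /C /w; ring.
have hCh : 0 <= Ch * (s ^+ 3 * t%:R) by rewrite mulr_ge0// (le_trans ler01).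
rewrite (mulrDr C) hC3; lra.
Qed.

End lower_bound.

(** * Green functions *)

Section green.
Context {R : realType} {d : nat}.
Notation X := (zvec 'I_d).
Variables (mu : X -> R) (c0 : R).
Hypotheses (mu_ge0 : forall z, 0 <= mu z) (mu_mass : rsum mu = 1) (c0_gt0 : 0 < c0)
  (mu_exp : abs_summable (fun z => mu z * expR (c0 * l1 z))).
Implicit Types (A : set X) (a b beta : 'I_d -> R) (x y z : X).

Let c0_ge0 : 0 <= c0 := ltW c0_gt0.
Let ebs A g x : exp_bounded c0 g -> step_summable mu A g x.
Proof. exact: exp_bounded_step_summable. Qed.
Let ebi A n g : exp_bounded c0 g -> exp_bounded c0 (iter n (step mu A) g).
Proof. exact: exp_bounded_iter. Qed.

Lemma phi_le_quad : exists2 K, 0 <= K & forall a (s : R), 0 <= s -> s <= 1 -> s <= c0 / 2 ->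
  (forall i, `|a i| <= s) -> phi mu a <= expR (K * s ^+ 2 + rdot a (drift mu)).
Proof.
have [K K0 hK] := psi_taylor mu_ge0 mu_mass c0_gt0 mu_exp.
pose Q := \sum_i \sum_j `|cov mu i j|.
have Q0 : 0 <= Q by apply: sumr_ge0 => i _; exact: sumr_ge0.
exists (K + Q); first by rewrite addr_ge0.
move=> a s s0 s1 sc ha; rewrite phi_psi expRD ler_wpM2r ?expR_ge0//.
apply: le_trans (expR_ge1Dx _).
have qs : qform mu a <= s ^+ 2 * Q.
  rewrite /qform /Q mulr_sumr; apply: ler_sum => i _.
  rewrite mulr_sumr; apply: ler_sum => j _.
  apply: le_trans (ler_norm _) _; rewrite normrM ler_wpM2r// normrM.
  by rewrite expr2 ler_pM.
have s3 : K * s ^+ 3 <= K * s ^+ 2 by rewrite ler_wpM2l// ler_wiXn2l.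
have sQ : 0 <= s ^+ 2 * Q by rewrite mulr_ge0// exprn_ge0.
have := hK a s s0 sc ha; rewrite ler_norml => /andP[_ h].
rewrite (mulrDl K Q); lra.
Qed.

Let m1 := \sum_i `|drift mu i|.
Let m10 : 0 <= m1. Proof. exact: sumr_ge0. Qed.
Let ler_m1 i : `|drift mu i| <= m1.
Proof. by rewrite /m1 (bigD1 i)//= lerDl sumr_ge0. Qed.

Lemma phi_le_expR : exists2 K, 0 <= K & forall a (s : R), 0 <= s -> s <= 1 -> s <= c0 / 2 ->
  (forall i, `|a i| <= s) -> phi mu a <= expR (K * s).
Proof.
have [K K0 hK] := phi_le_quad.
exists (K + m1); first by rewrite addr_ge0.
move=> a s s0 s1 sc ha; apply: le_trans (hK a s s0 s1 sc ha) _.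
rewrite ler_expR mulrDl lerD//; first by rewrite ler_wpM2l// expr2 ler_piMl.
rewrite /rdot /m1 mulr_suml; apply: ler_sum => i _.
by apply: le_trans (ler_norm _) _; rewrite normrM mulrC ler_wpM2l.
Qed.

(** Against the drift, the linear term - e |drift|^2 wins over the quadratic one for small e. Such a
    tilt bounds every killed Green function by a geometric series. *)
Lemma phi_lt1 : (exists i, drift mu i != 0) ->
  exists2 e0 : R, 0 < e0 & forall e, 0 < e -> e <= e0 ->
  (forall i, `|- (e * drift mu i)| <= c0) /\ phi mu (fun i => - (e * drift mu i)) < 1.
Proof.
move=> [i0 i0n]; have [K K0 hK] := phi_le_quad.
pose N2 := \sum_i drift mu i ^+ 2.
have N2_gt0 : 0 < N2.
  rewrite /N2 (bigD1 i0)//= ltr_wpDr ?sumr_ge0//; first by move=> i _; exact: sqr_ge0.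
  by rewrite lt0r sqr_ge0 sqrf_eq0 i0n.
have den : 0 < K * m1 ^+ 2 + 1 by rewrite ltr_wpDl// mulr_ge0// exprn_ge0.
have m1p : 0 < m1 + 1 by rewrite ltr_wpDl.
exists (Num.min ((m1 + 1)^-1) (Num.min (c0 / 2 / (m1 + 1)) (N2 / (2 * (K * m1 ^+ 2 + 1))))).
  by rewrite !lt_min invr_gt0 m1p !divr_gt0// mulr_gt0.
move=> e e_gt0; rewrite !le_min => /and3P[e1 ec eN].
have e0 := ltW e_gt0.
have le1 (q : R) : e <= q / (m1 + 1) -> e * m1 <= q.
  rewrite ler_pdivlMr// => h; apply: le_trans h; rewrite ler_wpM2l//; lra.
have em : e * m1 <= c0 / 2 by exact: le1.
have em1 : e * m1 <= 1 by apply: le1; rewrite mul1r.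
have c2 : c0 / 2 <= c0 by rewrite ler_pdivrMr// ler_peMr// ler1n.
have hb i : `|- (e * drift mu i)| <= e * m1.
  by rewrite normrN normrM ger0_norm// ler_wpM2l.
split; first by move=> i; apply: le_trans (hb i) (le_trans em c2).
apply: le_lt_trans (hK _ _ (mulr_ge0 e0 m10) em1 em hb) _.
have -> : rdot (fun i => - (e * drift mu i)) (drift mu) = - (e * N2).
  by rewrite /rdot /N2 mulr_sumr -sumrN; apply: eq_bigr => i _; ring.
rewrite -expR0 ltr_expR (_ : _ + _ = e * (e * (K * m1 ^+ 2) - N2)); last by ring.
rewrite pmulr_rlt0// subr_lt0.
apply: (@le_lt_trans _ _ (e * (K * m1 ^+ 2 + 1))); first by rewrite ler_wpM2l// lerDl.
by move: eN; rewrite ler_pdivlMr ?mulr_gt0//; lra.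
Qed.

Definition delta y : X -> R := fun x => (x == y)%:R.

Definition gpart A n y x : R := \sum_(t < n) iter t (step mu A) (delta y) x.

(** The Green function with target y, as a function of the starting point, extended by 0 outside
    A. *)
Definition gfun A y : X -> R := cut A (fun x => limn (fun n => gpart A n y x)).

Section bounded.
Variable a0 : 'I_d -> R.
Hypotheses (a0c : forall i, `|a0 i| <= c0) (phi_a0 : phi mu a0 < 1).

Let ebd y : exp_bounded c0 (delta y) := exp_bounded_delta c0_ge0 y.

Lemma iter_delta_ge0 A t y x : A x -> 0 <= iter t (step mu A) (delta y) x.
Proof. by move=> Ax; apply: iter_step_ge0. Qed.

Lemma iter_delta_le A t y x a : (forall i, `|a i| <= c0) -> A x ->
  iter t (step mu A) (delta y) x <= phi mu a ^+ t * expR (dot a (x - y)).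
Proof.
move=> ac Ax.
apply: (@le_trans _ _ (iter t (step mu A) (fun z => expR (- dot a y) * expR (dot a z)) x)).
  apply: (iter_step_le mu_ge0 c0_ge0 mu_exp) => //.
    exact/exp_boundedZ/exp_bounded_dot.
  move=> z _; rewrite /delta; case: eqP => [->|_]; last by rewrite mulr_ge0 ?expR_ge0.
  by rewrite -expRD addNr expR0.
rewrite iter_stepZ dotB expRD mulrA mulrC ler_wpM2r ?expR_ge0//.
exact: (iter_step_expR mu_ge0 c0_ge0 mu_exp).
Qed.

Lemma gpart_le A n y x : A x -> gpart A n y x <= (1 - phi mu a0)^-1 * expR (dot a0 (x - y)).
Proof.
move=> Ax; apply: (@le_trans _ _ (\sum_(t < n) phi mu a0 ^+ t * expR (dot a0 (x - y)))).
  by apply: ler_sum => t _; exact: iter_delta_le.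
rewrite -mulr_suml ler_wpM2r ?expR_ge0//.
have p1 : 0 < 1 - phi mu a0 by rewrite subr_gt0.
rewrite -[leRHS]mul1r ler_pdivlMr// mulrC.
have := subrX1 (phi mu a0) n; have : 0 <= phi mu a0 ^+ n by rewrite exprn_ge0// phi_ge0.
lra.
Qed.

Lemma gpartS A n y x : gpart A n.+1 y x = gpart A n y x + iter n (step mu A) (delta y) x.
Proof. by rewrite /gpart big_ord_recr. Qed.

Lemma gpart_nd A y x : A x -> {homo (fun n => gpart A n y x) : m n / (m <= n)%N >-> m <= n}.
Proof.
by move=> Ax; apply/nondecreasing_seqP => n; rewrite gpartS lerDl iter_delta_ge0.
Qed.

Lemma gpart_cvg A y x : A x -> gpart A n y x @[n --> \oo] --> gfun A y x.
Proof.
move=> Ax; rewrite /gfun /cut mem_set//.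
apply: nondecreasing_is_cvgn; first exact: gpart_nd.
by exists ((1 - phi mu a0)^-1 * expR (dot a0 (x - y))) => _ [n _ <-]; exact: gpart_le.
Qed.

Lemma gpart_le_gfun A n y x : A x -> gpart A n y x <= gfun A y x.
Proof.
move=> Ax.
have := nondecreasing_cvgn_le (gpart_nd y Ax) _ n.
rewrite (cvg_lim _ (@gpart_cvg A y x Ax))//; apply.
exact: gpart_cvg.
Qed.

Lemma gpart_ge0 A n y x : A x -> 0 <= gpart A n y x.
Proof. by move=> Ax; apply: sumr_ge0 => t _; exact: iter_delta_ge0. Qed.

Lemma gfun_ge0 A y x : 0 <= gfun A y x.
Proof.
have [Ax|Ax] := pselect (A x); last by rewrite /gfun /cut memNset.
exact: le_trans (gpart_ge0 0 y Ax) (gpart_le_gfun _ _ Ax).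
Qed.

Lemma gfun_le A y x : gfun A y x <= (1 - phi mu a0)^-1 * expR (dot a0 (x - y)).
Proof.
have [Ax|Ax] := pselect (A x); last first.
  rewrite /gfun /cut memNset// mulr_ge0 ?expR_ge0// invr_ge0 subr_ge0 ltW//.
apply: (ler_cvg_to (@gpart_cvg A y x Ax) (cvg_cst _)).
by near=> n; exact: gpart_le.
Unshelve. all: by end_near. Qed.

Lemma exp_bounded_gfun A y : exp_bounded c0 (gfun A y).
Proof.
apply: (exp_bounded_le (h := fun x => ((1 - phi mu a0)^-1 * expR (- dot a0 y)) * expR (dot a0 x))).
  move=> x; rewrite ger0_norm ?gfun_ge0//; apply: le_trans (gfun_le _ _ _) _.
  by rewrite dotB expRD [expR (dot a0 x) * _]mulrC mulrA.
exact/exp_boundedZ/exp_bounded_dot.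
Qed.

Lemma step_gpart A n y x : step mu A (gpart A n y) x + delta y x = gpart A n.+1 y x.
Proof.
rewrite /gpart (step_sum mu_ge0 c0_ge0 mu_exp); last by move=> t; exact: ebi.
by rewrite big_ord_recl addrC.
Qed.

(** The partial sums are dominated by their limit, which is exponentially bounded, so [step] passes
    to the limit. *)
Lemma gfun_eq A y x : A x -> gfun A y x = step mu A (gfun A y) x + delta y x.
Proof.
move=> Ax; have h := @gpart_cvg A y x Ax.
have h1 : gpart A n.+1 y x @[n --> \oo] --> gfun A y x by move: h; rewrite -cvg_shiftS.
have h2 : step mu A (gpart A n y) x + delta y x @[n --> \oo] -->
    step mu A (gfun A y) x + delta y x.
  apply: cvgD; last exact: cvg_cst.
  apply: (@step_cvg _ _ _ _ mu_ge0 c0_ge0 mu_exp _ _ _ _ _ (gfun A y)).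
  - exact: exp_bounded_gfun.
  - by near=> n; move=> z Az; rewrite ger0_norm ?gpart_ge0// gpart_le_gfun.
  - by move=> z Az; exact: gpart_cvg.
have E : (fun n => step mu A (gpart A n y) x + delta y x) = (fun n => gpart A n.+1 y x).
  by apply/funext => n; rewrite step_gpart.
rewrite E in h2; exact: cvg_unique h1 h2.
Unshelve. all: by end_near. Qed.

Lemma gfun_superharmonic A y : superharmonic mu A (gfun A y).
Proof.
split=> x Ax; first exact: gfun_ge0.
split; first by apply: ebs; exact: exp_bounded_gfun.
by rewrite [leRHS]gfun_eq// lerDl /delta.
Qed.

Lemma gfun_diag A y : A y -> 1 <= gfun A y y.
Proof.
move=> Ay; rewrite gfun_eq// /delta eqxx lerDr step_ge0// => z _; exact: gfun_ge0.
Qed.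

End bounded.
End green.

(** * Comparison of Green functions at two translated points *)

Section ratio.
Context {R : realType} {d : nat}.
Notation X := (zvec 'I_d).
Variables (mu : X -> R) (c0 : R).
Hypotheses (mu_ge0 : forall z, 0 <= mu z) (mu_mass : rsum mu = 1) (c0_gt0 : 0 < c0)
  (mu_exp : abs_summable (fun z => mu z * expR (c0 * l1 z))).
Variable a0 : 'I_d -> R.
Hypotheses (a0c : forall i, `|a0 i| <= c0) (phi_a0 : phi mu a0 < 1).
Implicit Types (A : set X) (a b beta : 'I_d -> R) (x y z : X) (g v : X -> R).

Let c0_ge0 : 0 <= c0 := ltW c0_gt0.
Let ebi A n g : exp_bounded c0 g -> exp_bounded c0 (iter n (step mu A) g).
Proof. exact: exp_bounded_iter. Qed.

Variables (A : set X) (w : X) (N : nat) (alpha : R).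
Hypotheses (Aw : forall y, A (y + w) <-> A y) (alpha_gt0 : 0 < alpha) (N_gt0 : (0 < N)%N)
  (jump : forall g x, exp_bounded c0 g -> (forall y, A y -> 0 <= g y) -> A x ->
     alpha * g (x + w) <= iter N (step mu A) g x).

Let itN g := iter N (step mu A) g.

(* itN = alpha T_w + rest, where T_w is the shift by w and both operators are
   positive and commute. *)
Let rest g x : R := itN g x - alpha * g (x + w).

(* In the expansion of itN^m v into words in alpha T_w and rest, a word with j
   shifts gets the weight f j. *)
Fixpoint shift_count m (f : nat -> R) v : X -> R :=
  if m is m'.+1 then fun x =>
    alpha * shift_count m' (f \o S) v (x + w) + rest (shift_count m' f v) x
  else fun x => f 0%N * v x.

Let eb_rest g : exp_bounded c0 g -> exp_bounded c0 (rest g).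
Proof.
move=> bg; apply: exp_boundedB; first exact: ebi.
exact/exp_boundedZ/exp_bounded_shift.
Qed.

Lemma exp_bounded_shift_count m f v : exp_bounded c0 v -> exp_bounded c0 (shift_count m f v).
Proof.
move=> bv; elim: m f => [|m IH] f /=; first exact: exp_boundedZ.
apply: exp_boundedD; last exact: eb_rest.
by apply: exp_boundedZ; apply: exp_bounded_shift.
Qed.

Let restD g h x : exp_bounded c0 g -> exp_bounded c0 h ->
  rest (fun x => g x + h x) x = rest g x + rest h x.
Proof.
move=> bg bh; rewrite /rest /itN (iter_stepD mu_ge0 c0_ge0 mu_exp)//; ring.
Qed.

Let restZ (k : R) g x : rest (fun x => k * g x) x = k * rest g x.
Proof. rewrite /rest /itN iter_stepZ; ring. Qed.

Let rest_shift g x : rest (fun y => g (y + w)) x = rest g (x + w).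
Proof.
rewrite /rest; congr (_ - _).
exact: (@iter_step_shift _ _ mu A N g w x Aw).
Qed.

Let rest_ge0 g x : exp_bounded c0 g -> (forall y, A y -> 0 <= g y) -> A x -> 0 <= rest g x.
Proof. by move=> bg g0 Ax; rewrite subr_ge0; exact: jump. Qed.

Lemma shift_count_ge0 m f v x : exp_bounded c0 v -> (forall y, A y -> 0 <= v y) ->
  (forall j, 0 <= f j) -> A x -> 0 <= shift_count m f v x.
Proof.
move=> bv v0; elim: m f x => [|m IH] f x f0 Ax /=; first by rewrite mulr_ge0 ?v0.
apply: addr_ge0.
  rewrite mulr_ge0 ?(ltW alpha_gt0)//; apply: IH => [j|]; first exact: f0.
  exact/Aw.
apply: rest_ge0 => //; first exact: exp_bounded_shift_count.
by move=> y Ay; exact: IH.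
Qed.

Lemma shift_countD m f f' v x : exp_bounded c0 v ->
  shift_count m (fun j => f j + f' j) v x = shift_count m f v x + shift_count m f' v x.
Proof.
move=> bv; elim: m f f' x => [|m IH] f f' x /=; first by rewrite mulrDl.
rewrite (_ : shift_count m (fun j => f j + f' j) v =
   fun x => shift_count m f v x + shift_count m f' v x); last by apply/funext => y; exact: IH.
rewrite restD; try exact: exp_bounded_shift_count.
by rewrite (IH (f \o S) (f' \o S)); ring.
Qed.

Lemma shift_countZ m (k : R) f v x : exp_bounded c0 v ->
  shift_count m (fun j => k * f j) v x = k * shift_count m f v x.
Proof.
move=> bv; elim: m f x => [|m IH] f x /=; first by rewrite mulrA.
rewrite (_ : shift_count m (fun j => k * f j) v =
   fun x => k * shift_count m f v x); last by apply/funext => y; exact: IH.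
by rewrite restZ (IH (f \o S)); ring.
Qed.

Lemma shift_count_le m f f' v x : exp_bounded c0 v -> (forall y, A y -> 0 <= v y) ->
  (forall j, f j <= f' j) -> A x -> shift_count m f v x <= shift_count m f' v x.
Proof.
move=> bv v0 ff Ax; rewrite -subr_ge0.
have -> : shift_count m f' v x - shift_count m f v x =
    shift_count m (fun j => f' j + (-1) * f j) v x.
  by rewrite shift_countD// shift_countZ// mulN1r.
by apply: shift_count_ge0 => // j; rewrite mulN1r subr_ge0.
Qed.

Lemma shift_count1 m v : shift_count m (fun=> 1) v = iter m itN v.
Proof.
elim: m => [|m IH]; first by apply/funext => x /=; rewrite mul1r.
apply/funext => x; rewrite /= (_ : (fun=> 1) \o S = (fun=> 1))// IH /rest; ring.
Qed.

(** The weight exp(h j) amounts to replacing itN by itN + alpha (exp(h) - 1) T_w, and this operator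
    multiplies an exponential of a linear form by at most the base of the power on the right. *)
Lemma shift_count_expR m (h : R) v x (b : 'I_d -> R) (C : R) :
  exp_bounded c0 v -> 0 <= h -> 0 <= C -> (forall i, `|b i| <= c0) ->
  (forall y, A y -> v y <= C * expR (dot b y)) -> A x ->
  shift_count m (fun j => expR (h * j%:R)) v x <=
  (phi mu b ^+ N + alpha * (expR h - 1) * expR (dot b w)) ^+ m * (C * expR (dot b x)).
Proof.
move=> bv h0 C0 bc vC; elim: m x => [|m IH] x Ax /=.
  by rewrite mulr0 expR0 !mul1r; exact: vC.
have -> : (fun j : nat => expR (h * j%:R)) \o S = fun j => expR h * expR (h * j%:R).
  by apply/funext => j /=; rewrite -expRD -natr1 mulrDr mulr1 addrC.
rewrite shift_countZ// /rest.
set rho := _ + alpha * _ * _ in IH *; set G := shift_count _ _ _ in IH *.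
have h1 : 0 <= expR h - 1 by rewrite subr_ge0 -expR0 ler_expR.
have rho0 : 0 <= rho.
  by rewrite addr_ge0 ?exprn_ge0 ?phi_ge0// !mulr_ge0 ?expR_ge0// ltW.
have bG : exp_bounded c0 G by exact: exp_bounded_shift_count.
have i1 : itN G x <= rho ^+ m * (C * (phi mu b ^+ N * expR (dot b x))).
  apply: (@le_trans _ _ (itN (fun y => rho ^+ m * C * expR (dot b y)) x)).
    apply: (iter_step_le mu_ge0 c0_ge0 mu_exp) => //.
      exact/exp_boundedZ/exp_bounded_dot.
    by move=> y Ay; rewrite -mulrA IH.
  rewrite /itN iter_stepZ -mulrA ler_wpM2l ?exprn_ge0// ler_wpM2l//.
  exact: (iter_step_expR mu_ge0 c0_ge0 mu_exp).
have i2 : alpha * (expR h - 1) * G (x + w) <=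
    alpha * (expR h - 1) * (rho ^+ m * (C * (expR (dot b x) * expR (dot b w)))).
  rewrite ler_wpM2l ?mulr_ge0// ?(ltW alpha_gt0)// -expRD -dotD.
  by apply: IH; apply/Aw.
rewrite exprS.
have -> : alpha * (expR h * G (x + w)) + (itN G x - alpha * G (x + w)) =
   itN G x + alpha * (expR h - 1) * G (x + w) by ring.
apply: le_trans (lerD i1 i2) _.
by rewrite le_eqVlt; apply/orP; left; apply/eqP; rewrite /rho; ring.
Qed.

(** The factor j marks one of the j shifts of a word. As the shift commutes with both operators, the
    marked one can be moved to the front, and it had m + 1 possible positions. *)
Lemma shift_count_deriv m f v x : exp_bounded c0 v ->
  shift_count m.+1 (fun j => j%:R * f j) v x =
  m.+1%:R * (alpha * shift_count m (f \o S) v (x + w)).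
Proof.
move=> bv; elim: m f x => [|m IH] f x.
  rewrite /= mul0r (_ : (fun x => 0 * v x) = (fun x => 0 * (0 * v x))).
    by rewrite restZ mul0r addr0 !mul1r.
  by apply/funext => y; rewrite !mul0r.
rewrite -[LHS]/(alpha * shift_count m.+1 ((fun j => j%:R * f j) \o S) v (x + w) +
  rest (shift_count m.+1 (fun j => j%:R * f j) v) x).
rewrite (_ : (fun j => j%:R * f j) \o S = fun j => j%:R * (f \o S) j + (f \o S) j); last first.
  by apply/funext => j /=; rewrite -natr1 mulrDl mul1r.
rewrite shift_countD// IH.
rewrite (_ : shift_count m.+1 (fun j => j%:R * f j) v =
  fun x => m.+1%:R * (alpha * shift_count m (f \o S) v (x + w))); last first.
  by apply/funext => y; exact: IH.
rewrite restZ restZ (rest_shift (shift_count m (f \o S) v)).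
rewrite -[shift_count m.+1 (f \o S) v (x + w)]/(alpha * shift_count m (f \o S \o S) v (x + w + w) +
  rest (shift_count m (f \o S) v) (x + w)).
rewrite -[m.+2%:R]natr1; ring.
Qed.

(** With f = 1, [shift_count_deriv] says that the sum of the words of length m + 1, each counted
    with its number of shifts, is (m + 1) alpha times [iter m itN v (x + w)]. That number exceeds
    alpha (1 + e) (m + 1) only on an exponentially small part, by the exponential moment; hence the
    two terms. *)
Lemma iter_itN_shift m (e h C : R) (b : 'I_d -> R) v x :
  exp_bounded c0 v -> (forall y, A y -> 0 <= v y) ->
  0 < h -> 0 <= C -> 0 <= e -> (forall i, `|b i| <= c0) ->
  (forall y, A y -> v y <= C * expR (dot b y)) -> A x ->
  iter m itN v (x + w) <= (1 + e) * iter m.+1 itN v x +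
  (alpha * h)^-1 * (expR (- (h * (alpha * (1 + e)))) *
    (phi mu b ^+ N + alpha * (expR h - 1) * expR (dot b w))) ^+ m.+1 * (C * expR (dot b x)).
Proof.
move=> bv v0 h0 C0 e0 bc vC Ax.
set rho := phi mu b ^+ N + _.
pose k := alpha * (1 + e).
(* A pointwise Chernoff bound, u <= exp(h u) / h; the factor m + 1 >= 1 is inserted so that it
   cancels afterwards. *)
have h1 : forall j : nat, j%:R * 1 <= k * m.+1%:R * 1 +
   m.+1%:R / h * expR (- (h * k * m.+1%:R)) * expR (h * j%:R).
  move=> j; rewrite !mulr1 -mulrA -expRD.
  have E : - (h * k * m.+1%:R) + h * j%:R = h * (j%:R - k * m.+1%:R) by ring.
  rewrite E; have m1 : 1 <= m.+1%:R :> R by rewrite ler1n.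
  set u := j%:R - _.
  have : u <= m.+1%:R / h * expR (h * u).
    have eu0 : 0 <= expR (h * u) / h by rewrite divr_ge0 ?expR_ge0 ?ltW.
    have hu : u <= expR (h * u) / h.
      rewrite ler_pdivlMr//; apply: le_trans (expR_ge1Dx _); lra.
    apply: le_trans hu _; rewrite -mulrA [h^-1 * _]mulrC.
    by rewrite ler_peMl.
  rewrite /u; lra.
have := shift_count_le m.+1 bv v0 h1 Ax.
rewrite shift_count_deriv// (_ : (fun=> 1) \o S = fun=> 1)// shift_count1.
rewrite shift_countD// shift_countZ// shift_countZ// shift_count1.
have h2 := shift_count_expR m.+1 bv (ltW h0) C0 bc vC Ax; rewrite -/rho in h2.
set U := iter m itN v (x + w); set V := iter m.+1 itN v x.
set W := shift_count _ _ _ _ in h2 *.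
move=> H.
have m0 : 0 < m.+1%:R :> R by rewrite ltr0n.
have H1 : alpha * U <= k * V + h^-1 * expR (- (h * k * m.+1%:R)) * W.
  rewrite -(ler_pM2l m0); apply: le_trans H _.
  by rewrite le_eqVlt; apply/orP; left; apply/eqP; ring.
have H2 : h^-1 * expR (- (h * k * m.+1%:R)) * W <=
    h^-1 * expR (- (h * k * m.+1%:R)) * (rho ^+ m.+1 * (C * expR (dot b x))).
  by rewrite ler_wpM2l// mulr_ge0 ?expR_ge0// invr_ge0 ltW.
rewrite -(ler_pM2l alpha_gt0); apply: le_trans H1 (le_trans (lerD (lexx _) H2) _).
rewrite mulrDr lerD//; first by rewrite /k mulrA.
rewrite exprMn -expRM_natl.
rewrite (_ : m.+1%:R * - (h * (alpha * (1 + e))) = - (h * k * m.+1%:R)); last by rewrite /k; ring.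
rewrite le_eqVlt; apply/orP; left; apply/eqP.
by field; rewrite !lt0r_neq0.
Qed.

Lemma gpart_mul n y x :
  gpart mu A (n * N) y x =
  \sum_(m < n) iter m itN (fun z => \sum_(r < N) iter r (step mu A) (delta y) z) x.
Proof.
elim: n => [|n IH]; first by rewrite mul0n /gpart !big_ord0.
rewrite big_ord_recr /= -IH mulSn addnC /gpart big_split_ord /=; congr (_ + _).
have -> : iter n itN = iter (n * N) (step mu A).
  by apply/funext => g; rewrite iterM.
have : forall (r : seq 'I_N) m, iter m (step mu A) (fun z => \sum_(i <- r) iter i (step mu A) (delta y) z) x =
    \sum_(i <- r) iter (m + i) (step mu A) (delta y) x.
  elim=> [|i r IHr] m.
    rewrite big_nil (_ : (fun z => _) = (fun z => 0 * delta y z)) ?iter_stepZ ?mul0r//.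
    by apply/funext => z; rewrite big_nil mul0r.
  rewrite big_cons -IHr iterD -(iter_stepD mu_ge0 c0_ge0 mu_exp).
  - by congr (iter _ _ _ _); apply/funext => z; rewrite big_cons.
  - by apply: ebi; exact: exp_bounded_delta.
  - by apply: exp_bounded_sum => j; apply: ebi; exact: exp_bounded_delta.
by move=> ->.
Qed.

(** The value h = e / (2 + e) gives exp(h) - 1 <= e / 2, and then h alpha (1 + e) - alpha e / 2 =
    alpha h e / 2; half of this gap absorbs the error [expR (K'' * s)]. *)
Let theta_le (e h K'' s p D : R) : 0 < e -> h = e / (2 + e) -> 0 <= s ->
  K'' * s <= alpha * h * e / 4 -> 0 <= p -> p <= expR (K'' * s) ->
  D <= expR (K'' * s) ->
  expR (- (h * (alpha * (1 + e)))) * (p + alpha * (expR h - 1) * D) <=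
  expR (- (alpha * h * e / 4)).
Proof.
move=> e0 hE s0 Ks p0 pK DK.
have e2 : 0 < 2 + e by rewrite addr_gt0.
have h0 : 0 < h by rewrite hE divr_gt0.
have hlt : 1 - h = 2 / (2 + e) by rewrite hE; field; rewrite lt0r_neq0.
have hpos : 0 < 1 - h by rewrite hlt divr_gt0.
have eh : expR h - 1 <= e / 2.
  have : expR h <= (1 - h)^-1.
    rewrite -[leLHS]invrK -expRN lef_pV2 ?posrE ?expR_gt0//.
    exact: expR_ge1Dx.
  rewrite hlt invf_div; suff : (2 + e) / 2 = 1 + e / 2 by lra.
  by field.
have eh0 : 0 <= expR h - 1 by rewrite subr_ge0 -expR0 ler_expR ltW.
have a0' := ltW alpha_gt0.
apply: (@le_trans _ _ (expR (- (h * (alpha * (1 + e)))) * (expR (K'' * s) * expR (alpha * (e / 2))))).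
  rewrite ler_wpM2l ?expR_ge0//.
  apply: (@le_trans _ _ (expR (K'' * s) * (1 + alpha * (expR h - 1)))).
    rewrite [leRHS]mulrDr mulr1 lerD// [leRHS]mulrC ler_wpM2l ?mulr_ge0//.
  rewrite ler_wpM2l ?expR_ge0//; apply: le_trans (expR_ge1Dx _).
  by rewrite lerD2l ler_wpM2l.
rewrite -!expRD ler_expR.
have : h * (alpha * (1 + e)) = alpha * (e / 2) + alpha * h * e / 2.
  by rewrite hE; field; rewrite lt0r_neq0.
move=> ->; have : 0 <= alpha * h * e by rewrite !mulr_ge0// ltW.
lra.
Qed.

Lemma gfun_shift_le (e : R) : 0 < e -> exists C del : R, [/\ 0 <= C, 0 < del &
  forall x y, A x -> gfun mu A y (x + w) <= (1 + e) * gfun mu A y x + C * expR (- (del * l1 (x - y)))].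
Proof.
move=> e0; have [K K0 hK] := phi_le_expR mu_ge0 mu_mass c0_gt0 mu_exp.
pose h := e / (2 + e).
have e2 : 0 < 2 + e by rewrite addr_gt0.
have h0 : 0 < h by rewrite divr_gt0.
pose K'' := K * N%:R + l1 w + 1.
have K''1 : 0 < K'' by rewrite ltr_wpDl// addr_ge0 ?l1_ge0// mulr_ge0.
pose q := alpha * h * e / 4.
have q0 : 0 < q by apply: divr_gt0 => //; apply: mulr_gt0 => //; exact: mulr_gt0.
pose s := Num.min 1 (Num.min (c0 / 2) (q / K'')).
have s_gt0 : 0 < s by rewrite lt_min ltr01 lt_min /=; apply/andP; split; exact: divr_gt0.
have s0 := ltW s_gt0.
have s1 : s <= 1 by rewrite ge_min lexx.
have sc : s <= c0 / 2 by rewrite !ge_min lexx orbT.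
have sq : K'' * s <= q by rewrite mulrC -ler_pdivlMr// !ge_min lexx !orbT.
pose Cv := \sum_(r < N) expR K ^+ r.
have Cv0 : 0 <= Cv by apply: sumr_ge0 => r _; rewrite exprn_ge0// expR_ge0.
pose theta := expR (- q).
have theta1 : theta < 1 by rewrite -expR0 ltr_expR oppr_lt0.
have theta0 : 0 <= theta by exact: expR_ge0.
pose C := (alpha * h)^-1 * Cv / (1 - theta).
have ah0 : 0 <= (alpha * h)^-1 by rewrite invr_ge0; apply: mulr_ge0; apply: ltW.
have p1 : 0 < 1 - theta by rewrite subr_gt0.
have C0 : 0 <= C by apply: divr_ge0; [exact: mulr_ge0|exact: ltW].
exists C, s; split => // x y Ax.
(* The signs give b.(x - y) = - s l1 (x - y), the source of the decay; s was taken small enough for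
   [phi mu b] not to spoil the factor theta < 1. *)
pose b i := if 0 <= (x - y) i then - s else s.
have bs i : `|b i| <= s by rewrite /b; case: ifP; rewrite ?normrN ger0_norm.
have bc i : `|b i| <= c0.
  by apply: le_trans (bs i) (le_trans sc _); rewrite ler_pdivrMr// ler_peMr ?ler1n// ltW.
have bxy : dot b (x - y) = - (s * l1 (x - y)).
  rewrite /dot /l1 mulr_sumr -sumrN; apply: eq_bigr => i _; rewrite /b.
  case: ifPn => [h1|]; first by rewrite ger0_norm ?ler0z// mulNr.
  by rewrite -ltNge => h1; rewrite ltr0_norm ?ltrz0// mulrN opprK.
have phib := hK b s s0 s1 sc bs.
pose v z := \sum_(r < N) iter r (step mu A) (delta y) z.
have bv : exp_bounded c0 v.
  by apply: exp_bounded_sum => r; apply: ebi; exact: exp_bounded_delta.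
have v0 z : A z -> 0 <= v z by move=> Az; apply: sumr_ge0 => r _; exact: iter_delta_ge0.
have vC z : A z -> v z <= (Cv * expR (- dot b y)) * expR (dot b z).
  move=> Az; rewrite -mulrA -expRD addrC -dotB /Cv mulr_suml; apply: ler_sum => r _.
  apply: le_trans (iter_delta_le mu_ge0 c0_gt0 mu_exp _ _ bc Az) _.
  rewrite ler_wpM2r ?expR_ge0// lerXn2r ?nnegrE ?phi_ge0 ?expR_ge0//.
  by apply: le_trans phib _; rewrite ler_expR ler_piMr.
have hth : expR (- (h * (alpha * (1 + e)))) *
    (phi mu b ^+ N + alpha * (expR h - 1) * expR (dot b w)) <= theta.
  apply: (@theta_le e h K'' s) => //.
  - by rewrite exprn_ge0// phi_ge0.
  - apply: (@le_trans _ _ (expR (K * s) ^+ N)).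
      by rewrite lerXn2r ?nnegrE ?phi_ge0 ?expR_ge0.
    rewrite -expRM_natl ler_expR mulrA [N%:R * K]mulrC ler_wpM2r// /K'' -addrA.
    by rewrite lerDl addr_ge0 ?l1_ge0.
  - rewrite ler_expR; apply: le_trans (ler_norm _) (le_trans (ler_dot_l1 w bs) _).
    rewrite mulrC ler_wpM2r// /K'' addrAC lerDr addr_ge0// mulr_ge0//.
have th0 : 0 <= expR (- (h * (alpha * (1 + e)))) *
    (phi mu b ^+ N + alpha * (expR h - 1) * expR (dot b w)).
  rewrite mulr_ge0 ?expR_ge0// addr_ge0 ?exprn_ge0 ?phi_ge0// mulr_ge0 ?expR_ge0// mulr_ge0 ?(ltW alpha_gt0)//.
  by rewrite subr_ge0 -expR0 ler_expR ltW.
have main n : gpart mu A (n * N) y (x + w) <= (1 + e) * gfun mu A y x + C * expR (- (s * l1 (x - y))).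
  rewrite gpart_mul -/v.
  apply: (@le_trans _ _ (\sum_(m < n) ((1 + e) * iter m.+1 itN v x +
     theta ^+ m * ((alpha * h)^-1 * Cv * expR (- (s * l1 (x - y))))))).
    apply: ler_sum => m _.
    have H := iter_itN_shift m bv v0 h0 (mulr_ge0 Cv0 (expR_ge0 (- dot b y))) (ltW e0) bc vC Ax.
    set TH := (expR (- (h * (alpha * (1 + e)))) * _) in hth th0 H.
    apply: le_trans H _; rewrite lerD2l.
    have -> : (alpha * h)^-1 * TH ^+ m.+1 * (Cv * expR (- dot b y) * expR (dot b x)) =
       TH ^+ m.+1 * ((alpha * h)^-1 * Cv * expR (- (s * l1 (x - y)))).
      by rewrite -bxy dotB expRD; ring.
    rewrite ler_wpM2r//.
      by apply: mulr_ge0; [exact: mulr_ge0|exact: expR_ge0].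
    apply: (@le_trans _ _ (theta ^+ m.+1)).
      by apply: lerXn2r; rewrite ?nnegrE.
    by rewrite ler_wiXn2l// ltW.
  rewrite big_split /= -mulr_sumr -mulr_suml lerD//.
    rewrite ler_wpM2l ?addr_ge0 ?(ltW e0)//.
    (* The iterates of orders 1 to n miss only the first block of N times, so their sum is still at
       most the Green function. *)
    apply: le_trans (gpart_le_gfun mu_ge0 c0_gt0 mu_exp a0c phi_a0 (n.+1 * N) y Ax).
    rewrite gpart_mul -/v big_ord_recl /= lerDr; exact: v0.
  rewrite mulrC /C -!mulrA ler_wpM2l// ler_wpM2l// mulrC ler_wpM2r ?expR_ge0//.
  rewrite -[leRHS]mul1r ler_pdivlMr// mulrC.
  have := subrX1 theta n; have : 0 <= theta ^+ n by rewrite exprn_ge0.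
  lra.
have Axw : A (x + w) by apply/Aw.
have cv := gpart_cvg mu_ge0 c0_gt0 mu_exp a0c phi_a0 (y := y) Axw.
apply: (ler_cvg_to cv (cvg_cst _)).
near=> n; apply: le_trans (main n).
by apply: gpart_nd => //; rewrite leq_pmulr.
Unshelve. all: by end_near. Qed.

End ratio.

Section ratio_orthant.
Context {R : realType} {d : nat}.
Notation X := (zvec 'I_d).
Variables (mu : X -> R) (c0 : R).
Hypotheses (mu_ge0 : forall z, 0 <= mu z) (mu_mass : rsum mu = 1) (c0_gt0 : 0 < c0)
  (mu_exp : abs_summable (fun z => mu z * expR (c0 * l1 z))).
Variable a0 : 'I_d -> R.
Hypotheses (a0c : forall i, `|a0 i| <= c0) (phi_a0 : phi mu a0 < 1).

(* The number of shifts by w in a word is binomial, hence concentrated, and one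
   shift more or less hardly changes the weight of a long word. *)
Lemma gfun_ratio (L : {set 'I_d}) (w : X) (e : R) : irreducible_on mu L ->
  (forall i, i \in L -> w i = 0) -> w != 0 -> 0 < e ->
  exists C del : R, [/\ 0 <= C, 0 < del & forall x y, orthant_on L x ->
    gfun mu (orthant_on L) y (x + w) <=
    (1 + e) * gfun mu (orthant_on L) y x + C * expR (- (del * l1 (x - y)))].
Proof.
move=> irr wL w0 e0.
pose one : X := [ffun=> 1].
have oneE i : one i = 1 by rewrite ffunE.
have one_in : orthant_on L one by move=> i _; rewrite oneE.
have onew_in : orthant_on L (one + w) by move=> i iL; rewrite zvecD oneE wL.
(* The weight of this path is alpha and its length is N: its translates realize the shift by w from
   any point of the domain. *)
have [s [sL ls p]] := irr one (one + w) one_in onew_in.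
apply: (@gfun_shift_le _ _ mu c0 mu_ge0 mu_mass c0_gt0 mu_exp a0 a0c phi_a0 _ w (size s)
  (path_weight mu one s)) => //.
- move=> y; split=> h i iL; have := h i iL; rewrite zvecD wL// addr0//.
- exact: path_weight_gt0.
- case: s ls {sL p} => //= h; move: w0; rewrite (_ : w = 0) ?eqxx//.
  by apply: (addrI one); rewrite addr0 -h.
- move=> g x bg g0 xL.
  have := @iter_step_path _ _ mu c0 mu_ge0 (ltW c0_gt0) mu_exp (orthant_on L) g one s (x - one) bg g0.
  rewrite ls (_ : one + w + (x - one) = x + w); last by rewrite addrAC addrCA subrr addr0.
  rewrite (_ : one + (x - one) = x); last by rewrite addrCA subrr addr0.
  apply=> y hy i iL.
  have yi : 0 < y i by move: hy; rewrite inE => /predU1P[->|/sL]; [rewrite oneE|exact].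
  by rewrite zvecD zvecB oneE ltr_wpDr// subr_ge0 -gtz0_ge1 xL.
Qed.

End ratio_orthant.

(** * Exit from the orthant *)

Section exit_potential.
Context {R : realType} {d : nat}.
Notation X := (zvec 'I_d).
Variables (mu : X -> R) (c0 : R).
Hypotheses (mu_ge0 : forall z, 0 <= mu z) (mu_mass : rsum mu = 1) (c0_gt0 : 0 < c0)
  (mu_exp : abs_summable (fun z => mu z * expR (c0 * l1 z))).
Variable L : {set 'I_d}.
Hypotheses (drift0 : forall i, i \in L -> drift mu i = 0)
  (drift_gt0 : forall i, i \notin L -> 0 < drift mu i).
Implicit Types (A : set X) (x y z : X) (g : X -> R).

Let c0_ge0 : 0 <= c0 := ltW c0_gt0.
Let ebs A g x : exp_bounded c0 g -> step_summable mu A g x.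
Proof. exact: exp_bounded_step_summable. Qed.
Let ebi A n g : exp_bounded c0 g -> exp_bounded c0 (iter n (step mu A) g).
Proof. exact: exp_bounded_iter. Qed.
Let ebst A g : exp_bounded c0 g -> exp_bounded c0 (step mu A g).
Proof. exact: exp_bounded_step. Qed.

(** The exponential of this form decreases at rate del in the coordinate i, meant to have positive
    drift, and grows at rate eps d in the direction of coordinate j given by b, with eps d small
    compared with del. *)
Definition exit_tilt (del eps : R) i j (b : bool) (k : 'I_d) : R :=
  (-1) ^+ b * (eps * d%:R) * (k == j)%:R - del * (k == i)%:R.

Lemma exit_tilt_phi : exists del eps rho : R,
  [/\ 0 < eps, eps * d%:R <= del / 2, 0 <= rho, rho < 1 &
      forall i j b, i \notin L -> (forall k, `|exit_tilt del eps i j b k| <= c0) /\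
        phi mu (exit_tilt del eps i j b) <= rho].
Proof.
have [K K0 hK] := phi_le_quad mu_ge0 mu_mass c0_gt0 mu_exp.
pose m1 := \sum_i `|drift mu i|.
have m10 : 0 <= m1 by exact: sumr_ge0.
have m1p : 0 < m1 + 1 by rewrite ltr_wpDl.
have ler_m1 i : `|drift mu i| <= m1 by rewrite /m1 (bigD1 i)//= lerDl sumr_ge0.
have [mm mm0 hmm] : exists2 mm, 0 < mm & forall i, i \notin L -> mm <= drift mu i.
  exists (\big[Num.min/1]_(i | i \notin L) drift mu i).
    by apply/bigmin_gtP; split.
  by move=> i iL; exact: bigmin_le_cond.
pose del := Num.min (1 / 2) (Num.min (c0 / 4) (mm / (16 * (K + 1)))).
have Kp : 0 < K + 1 by rewrite ltr_wpDl.
have del0 : 0 < del.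
  by rewrite !lt_min; do ![apply/andP; split]; apply: divr_gt0 => //; exact: mulr_gt0.
pose r := Num.min (1 / 2) (mm / (4 * (m1 + 1))).
have r0 : 0 < r.
  by rewrite lt_min; apply/andP; split; apply: divr_gt0 => //; exact: mulr_gt0.
pose eps := del * r / (d%:R + 1).
have d1 : 0 < d%:R + 1 :> R by rewrite ltr_wpDl.
have eps0 : 0 < eps by apply: divr_gt0 => //; exact: mulr_gt0.
have epsd : eps * d%:R <= del * r.
  rewrite /eps mulrAC ler_pdivrMr// ler_wpM2l ?mulr_ge0 ?ltW//.
  by rewrite ltrDl.
have delr : del * r <= del / 2.
  rewrite ler_wpM2l ?(ltW del0)// ge_min; apply/orP; left; lra.
have ed0 : 0 <= eps * d%:R by apply: mulr_ge0 => //; exact: ltW.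
exists del, eps, (expR (- (del * mm / 2))); split => //.
- exact: le_trans epsd delr.
- by rewrite -expR0 ltr_expR oppr_lt0; apply: divr_gt0 => //; exact: mulr_gt0.
move=> i j b iL.
have hs k : `|exit_tilt del eps i j b k| <= 2 * del.
  have h1 : `|(-1) ^+ b * (eps * d%:R) * (k == j)%:R| <= del.
    rewrite normrM [X in X * _]normrM normrX normrN1 expr1n mul1r (ger0_norm ed0).
    apply: (@le_trans _ _ (eps * d%:R)).
      by case: eqP; rewrite ?normr1 ?mulr1// normr0 mulr0.
    apply: le_trans epsd (le_trans delr _); rewrite ler_pdivrMr// ler_peMr ?(ltW del0)//.
    by rewrite ler1n.
  have h2 : `|del * (k == i)%:R| <= del.
    rewrite normrM (ger0_norm (ltW del0)).
    by case: eqP => _; rewrite ?normr1 ?mulr1// normr0 mulr0 ltW.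
  apply: le_trans (ler_normB _ _) _; lra.
have d2 : 2 * del <= c0 / 2.
  have : del <= c0 / 4 by rewrite !ge_min lexx orbT.
  lra.
have d3 : 2 * del <= 1.
  have : del <= 1 / 2 by rewrite !ge_min lexx.
  lra.
split; first by move=> k; apply: le_trans (hs k) (le_trans d2 _); lra.
apply: le_trans (hK _ (2 * del) _ d3 d2 hs) _; first by rewrite mulr_ge0// ltW.
rewrite ler_expR.
have -> : rdot (exit_tilt del eps i j b) (drift mu) =
    (-1) ^+ b * (eps * d%:R) * drift mu j - del * drift mu i.
  rewrite /rdot /exit_tilt; under eq_bigr do rewrite mulrBl.
  rewrite sumrB; congr (_ - _).
    rewrite (bigD1 j)//= eqxx mulr1 big1 ?addr0// => k /negbTE ->.
    by rewrite mulr0 mul0r.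
  rewrite (bigD1 i)//= eqxx mulr1 big1 ?addr0// => k /negbTE ->.
  by rewrite mulr0 mul0r.
have h1 : (-1) ^+ b * (eps * d%:R) * drift mu j <= del * mm / 4.
  apply: le_trans (ler_norm _) _.
  rewrite normrM [X in X * _]normrM normrX normrN1 expr1n mul1r (ger0_norm ed0).
  apply: (@le_trans _ _ (del * r * m1)); first by rewrite ler_pM.
  rewrite -!mulrA ler_wpM2l ?(ltW del0)//.
  have : r <= mm / (4 * (m1 + 1)) by rewrite ge_min lexx orbT.
  rewrite ler_pdivlMr ?mulr_gt0// => h; have := mulr_ge0 (ltW r0) m10; lra.
have h2 : del * mm <= del * drift mu i by rewrite ler_wpM2l ?(ltW del0)// hmm.
have h3 : K * (2 * del) ^+ 2 <= del * mm / 4.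
  rewrite exprMn (_ : K * _ = del * (4 * K * del)); last by ring.
  rewrite -[leRHS]mulrA ler_wpM2l ?(ltW del0)//.
  have : del <= mm / (16 * (K + 1)) by rewrite !ge_min lexx !orbT.
  rewrite ler_pdivlMr ?mulr_gt0// => h; have := mulr_ge0 K0 (ltW del0); lra.
lra.
Qed.

Let E : set X := orthant_on L.
Let O : set X := @orthant 'I_d.
Let B : set X := E `\` O.

Variables del eps rho : R.
Hypotheses (d_gt0 : (0 < d)%N) (eps_gt0 : 0 < eps) (del_ge0 : 0 <= del)
  (rho_ge0 : 0 <= rho) (rho_lt1 : rho < 1)
  (tilt_c0 : forall i j b k, i \notin L -> `|exit_tilt del eps i j b k| <= c0)
  (tilt_phi : forall i j b, i \notin L -> phi mu (exit_tilt del eps i j b) <= rho).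

(* A supersolution for the walk, at least expR (eps * l1 x) where some
   coordinate off L is nonpositive. *)
Definition exit_weight x : R :=
  \sum_(i | i \notin L) \sum_j \sum_(b : bool) expR (dot (exit_tilt del eps i j b) x).

Lemma exit_weight_ge0 x : 0 <= exit_weight x.
Proof.
by apply: sumr_ge0 => i _; apply: sumr_ge0 => j _; apply: sumr_ge0 => b _; exact: expR_ge0.
Qed.

Lemma dot_exit_tilt i j b x : dot (exit_tilt del eps i j b) x =
  (-1) ^+ b * (eps * d%:R) * (x j)%:~R - del * (x i)%:~R.
Proof.
rewrite /exit_tilt dotDl dotZl dot_unitv; congr (_ + _).
by rewrite dotNl dotZl dot_unitv.
Qed.

(** A point of B has a nonpositive coordinate i outside L. The terms of index i suffice by [l1_max],
    because - del z i is nonnegative. *)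
Lemma expR_le_exit_weight z : B z -> expR (eps * l1 z) <= exit_weight z.
Proof.
move=> [Ez Oz]; have [i hi] : exists i, ~ 0 < z i by exact/existsNP.
have zi : z i <= 0 by rewrite leNgt; exact/negP.
have iL : i \notin L by apply/negP => iL; exact/hi/Ez.
apply: le_trans (l1_max z d_gt0 (ltW eps_gt0)) _.
rewrite /exit_weight [leRHS](bigD1 i)//= -[leLHS]addr0 lerD//; last first.
  by apply: sumr_ge0 => k _; apply: sumr_ge0 => j _; apply: sumr_ge0 => b _; exact: expR_ge0.
apply: ler_sum => j _; rewrite big_bool !dot_exit_tilt /= expr0 expr1 mul1r mulN1r [leRHS]addrC.
have : del * (z i)%:~R <= 0 by rewrite mulr_ge0_le0// lerz0.
by move=> h; rewrite lerD// ler_expR; lra.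
Qed.

Lemma exp_bounded_exit_weight : exp_bounded c0 exit_weight.
Proof.
have -> : exit_weight = fun x => \sum_(i <- enum (~: L)) \sum_j \sum_(b : bool)
    expR (dot (exit_tilt del eps i j b) x).
  by apply/funext => x; rewrite /exit_weight big_enum_cond/=; apply: eq_bigl => i; rewrite inE andbT.
have: all (mem (~: L)%SET) (enum (~: L)%SET) by apply/allP => i; rewrite mem_enum.
elim: (enum _) => [|i s IH].
  move=> _; have := @exp_bounded0 R d c0; congr exp_bounded; apply/funext => x.
  by rewrite big_nil.
move=> /andP[iL /IH bs].
have bi : exp_bounded c0 (fun x => \sum_j \sum_(b : bool) expR (dot (exit_tilt del eps i j b) x)).
  apply: exp_bounded_sum => j; apply: exp_bounded_sum => b; apply: exp_bounded_dot => k.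
  by apply: tilt_c0; move: iL; rewrite /= inE.
have := exp_boundedD bi bs; congr exp_bounded; apply/funext => x.
by rewrite big_cons.
Qed.

Lemma step_exit_weight A x : step mu A exit_weight x <= rho * exit_weight x.
Proof.
have cE y : exit_weight y = \sum_(i <- enum (~: L)%SET) (fun y => \sum_j \sum_(b : bool)
    expR (dot (exit_tilt del eps i j b) y)) y.
  by rewrite /exit_weight big_enum_cond/=; apply: eq_bigl => i; rewrite inE andbT.
rewrite cE (@eq_step _ _ _ _ _ (fun y => \sum_(i <- enum (~: L)%SET) (fun y => \sum_j \sum_(b : bool)
    expR (dot (exit_tilt del eps i j b) y)) y)) => [|y _]; last exact: cE.
have: all (mem (~: L)%SET) (enum (~: L)%SET) by apply/allP => i; rewrite mem_enum.
have bi i : i \notin L -> exp_bounded c0 (fun x => \sum_j \sum_(b : bool) expR (dot (exit_tilt del eps i j b) x)).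
  move=> iL; apply: exp_bounded_sum => j; apply: exp_bounded_sum => b; apply: exp_bounded_dot => k.
  exact: tilt_c0.
suff H (s : seq 'I_d) : all (mem (~: L)%SET) s ->
  exp_bounded c0 (fun y => \sum_(i <- s) \sum_j \sum_(b : bool) expR (dot (exit_tilt del eps i j b) y)) /\
  step mu A (fun y => \sum_(i <- s) \sum_j \sum_(b : bool) expR (dot (exit_tilt del eps i j b) y)) x <=
  rho * \sum_(i <- s) \sum_j \sum_(b : bool) expR (dot (exit_tilt del eps i j b) x).
  by move=> /H[].
elim: s => [|i s IH].
  move=> _; rewrite big_nil mulr0; split.
    have := @exp_bounded0 R d c0; congr exp_bounded; apply/funext => y.
    by rewrite big_nil.
  rewrite (@eq_step _ _ _ _ _ (fun=> 0)) ?step0// => y _; by rewrite big_nil.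
move=> /andP[iL' /IH[bs hs]].
have iL : i \notin L by move: iL'; rewrite /= inE.
split.
  have := exp_boundedD (bi i iL) bs; congr exp_bounded; apply/funext => y.
  by rewrite big_cons.
rewrite (@eq_step _ _ _ _ _ (fun y => \sum_j \sum_(b : bool) expR (dot (exit_tilt del eps i j b) y) +
   \sum_(i <- s) \sum_j \sum_(b : bool) expR (dot (exit_tilt del eps i j b) y))); last first.
  by move=> y _; rewrite big_cons.
rewrite stepD; [|exact/ebs/bi|exact: ebs].
rewrite big_cons mulrDr lerD//.
have eb j b : exp_bounded c0 (fun y => expR (dot (exit_tilt del eps i j b) y)).
  by apply: exp_bounded_dot => k; exact: tilt_c0.
rewrite (step_sum mu_ge0 c0_ge0 mu_exp) => [|j]; last exact: exp_bounded_sum.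
rewrite mulr_sumr; apply: ler_sum => j _.
rewrite (step_sum mu_ge0 c0_ge0 mu_exp)// mulr_sumr; apply: ler_sum => b _.
apply: le_trans (step_expR mu_ge0 c0_ge0 mu_exp A x (fun k => tilt_c0 j b k iL)) _.
by rewrite ler_wpM2r ?expR_ge0// tilt_phi.
Qed.

Lemma iter_step_exit_weight A n x : A x ->
  iter n (step mu A) exit_weight x <= rho ^+ n * exit_weight x.
Proof.
have bw := exp_bounded_exit_weight.
elim: n x => [|n IH] x Ax /=; first by rewrite mul1r.
apply: (@le_trans _ _ (step mu A (fun y => rho ^+ n * exit_weight y) x)).
  by apply: step_le => //; apply: ebs; [exact: ebi|exact: exp_boundedZ].
by rewrite stepZ exprSr -mulrA ler_wpM2l ?exprn_ge0// step_exit_weight.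
Qed.

(** The mean of g at the exit from O, restricted to exits into B, that is inside E, at a time at
    most n; the index t stands for the exit time t + 1. *)
Definition exit_part n g x : R := \sum_(t < n) iter t (step mu O) (step mu B g) x.

Definition exit_value g x : R := limn (fun n => exit_part n g x).

Section value.
Variables (g : X -> R) (C : R).
Hypotheses (bg : exp_bounded c0 g) (C_ge0 : 0 <= C) (g_ge0 : forall z, B z -> 0 <= g z)
  (gC : forall z, B z -> g z <= C * expR (eps * l1 z)).

Lemma exit_term_ge0 t x : O x -> 0 <= iter t (step mu O) (step mu B g) x.
Proof. by move=> Ox; apply: iter_step_ge0 => // y _; exact: step_ge0. Qed.

Lemma exit_term_le t x : O x ->
  iter t (step mu O) (step mu B g) x <= C * rho ^+ t.+1 * exit_weight x.
Proof.
move=> Ox; have bw := exp_bounded_exit_weight.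
apply: (@le_trans _ _ (iter t (step mu O) (fun y => (C * rho) * exit_weight y) x)).
  apply: (iter_step_le mu_ge0 c0_ge0 mu_exp) => //; [exact: ebst|exact: exp_boundedZ|].
  move=> y Oy; rewrite -mulrA.
  apply: (@le_trans _ _ (step mu B (fun z => C * exit_weight z) y)).
    apply: step_le => //; [exact: ebs|apply: ebs; exact: exp_boundedZ|].
    by move=> z Bz; apply: le_trans (gC Bz) _; rewrite ler_wpM2l// expR_le_exit_weight.
  by rewrite stepZ ler_wpM2l// step_exit_weight.
rewrite iter_stepZ exprS -!mulrA ler_wpM2l// ler_wpM2l//.
exact: iter_step_exit_weight.
Qed.

Lemma exit_partS n x : exit_part n.+1 g x =
  exit_part n g x + iter n (step mu O) (step mu B g) x.
Proof. by rewrite /exit_part big_ord_recr. Qed.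

Lemma exit_part_nd x : O x -> {homo (fun n => exit_part n g x) : m n / (m <= n)%N >-> m <= n}.
Proof.
by move=> Ox; apply/nondecreasing_seqP => n; rewrite exit_partS lerDl exit_term_ge0.
Qed.

Let p1 : 0 < 1 - rho. Proof. by rewrite subr_gt0. Qed.

(** The function g enters only through the constant C of its exponential bound; this uniformity
    later allows the exchange of limits. *)
Lemma exit_part_tail m n x : O x ->
  exit_part (m + n) g x <= exit_part m g x + C * rho ^+ m / (1 - rho) * exit_weight x.
Proof.
move=> Ox; rewrite /exit_part big_split_ord /= lerD2l.
apply: (@le_trans _ _ (\sum_(t < n) rho ^+ t * (C * rho ^+ m * exit_weight x))).
  apply: ler_sum => t _; apply: le_trans (exit_term_le _ Ox) _.
  rewrite exprS exprD.
  have h : 0 <= C * (rho ^+ m * rho ^+ t) * exit_weight x.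
    by rewrite !mulr_ge0 ?exprn_ge0// exit_weight_ge0.
  have : rho * (C * (rho ^+ m * rho ^+ t) * exit_weight x) <= 1 * (C * (rho ^+ m * rho ^+ t) * exit_weight x).
    by rewrite ler_wpM2r// ltW.
  lra.
rewrite -mulr_suml -!mulrA mulrC -!mulrA ler_wpM2l// ler_wpM2l ?exprn_ge0//.
rewrite mulrC ler_wpM2r ?exit_weight_ge0//.
rewrite -[leRHS]mul1r ler_pdivlMr// mulrC.
have := subrX1 rho n; have : 0 <= rho ^+ n by rewrite exprn_ge0.
lra.
Qed.

Lemma exit_value_cvg x : O x -> exit_part n g x @[n --> \oo] --> exit_value g x.
Proof.
move=> Ox; apply: nondecreasing_is_cvgn; first exact: exit_part_nd.
exists (exit_part 0 g x + C * rho ^+ 0 / (1 - rho) * exit_weight x) => _ [n _ <-].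
exact: (exit_part_tail 0).
Qed.

Lemma exit_part_le n x : O x -> exit_part n g x <= exit_value g x.
Proof.
move=> Ox.
have cv : exit_part n g x @[n --> \oo] --> exit_value g x by exact: exit_value_cvg.
by have := nondecreasing_cvgn_le (exit_part_nd Ox) (cvgP _ cv) n.
Qed.

Lemma exit_value_le m x : O x ->
  exit_value g x <= exit_part m g x + C * rho ^+ m / (1 - rho) * exit_weight x.
Proof.
move=> Ox.
have cv : exit_part n g x @[n --> \oo] --> exit_value g x by exact: exit_value_cvg.
apply: (ler_cvg_to cv (cvg_cst _)); exists m => // n /= mn.
by rewrite -(subnKC mn); exact: exit_part_tail.
Qed.

End value.

Lemma step_split g x : exp_bounded c0 g -> step mu E g x = step mu O g x + step mu B g x.
Proof.
move=> bg; rewrite -rsumD; [|exact: ebs|exact: ebs].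
apply: eq_rsum => z; rewrite -mulrDr /cut; congr (_ * _).
have [Oz|Oz] := pselect (O (x + z)).
  have Ez : E (x + z) by move=> i _; exact: Oz.
  by rewrite (mem_set Ez) (mem_set Oz) memNset ?addr0// => -[].
have [Ez|Ez] := pselect (E (x + z)).
  by rewrite (mem_set Ez) (memNset Oz) mem_set ?add0r.
by rewrite (memNset Ez) (memNset Oz) memNset ?add0r// => -[].
Qed.

(** The equation g = step E g + u on O is iterated, the part of the step that leaves O inside E
    being set aside each time. It serves with u = 0 for harmonic functions and with u = [delta y]
    for Green functions. *)
Lemma exit_decomposition g u n x : exp_bounded c0 g -> exp_bounded c0 u ->
  (forall y, O y -> g y = step mu E g y + u y) -> O x ->
  g x = iter n (step mu O) g x + exit_part n g x + \sum_(t < n) iter t (step mu O) u x.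
Proof.
move=> bg bu hg; elim: n x => [|n IH] x Ox.
  by rewrite /exit_part !big_ord0 !addr0.
rewrite exit_partS big_ord_recr /= {1}IH//.
suff -> : iter n (step mu O) g x = step mu O (iter n (step mu O) g) x +
   iter n (step mu O) (step mu B g) x + iter n (step mu O) u x by ring.
rewrite -[step mu O (iter n _ g) x]/(iter n.+1 (step mu O) g x) iterSr.
rewrite -(iter_stepD mu_ge0 c0_ge0 mu_exp); [|exact: ebst|exact: ebst].
rewrite -(iter_stepD mu_ge0 c0_ge0 mu_exp)//; last by apply: exp_boundedD; exact: ebst.
have H : forall y, O y -> g y = step mu O g y + step mu B g y + u y.
  by move=> y Oy; rewrite hg// step_split.
elim: n x Ox {IH} => [|n IH] x Ox /=; first exact: H.
by apply: eq_step => y Oy; exact: IH.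
Qed.

Lemma exit_part_cvg (F : set_system nat) (FF : ProperFilter F) (k : nat -> X -> R) g D n x :
  exp_bounded c0 D -> (forall m, exp_bounded c0 (k m)) ->
  (\forall m \near F, forall y, B y -> `|k m y| <= D y) ->
  (forall y, B y -> k m y @[m --> F] --> g y) -> O x ->
  exit_part n (k m) x @[m --> F] --> exit_part n g x.
Proof.
move=> bD bk kD kg Ox; rewrite /exit_part.
apply: cvg_big => [|t _]; first exact: add_continuous.
apply: (@iter_step_cvg _ _ _ _ mu_ge0 c0_ge0 mu_exp _ _ _ _ _ _ (step mu B D)) => //.
- exact: ebst.
- apply: filterS kD => m h y _; apply: le_trans (ler_norm_rsum _) _; first exact: ebs.
  apply: rsum_le; [by apply: abs_summable_norm; exact: ebs|exact: ebs|].
  move=> z; rewrite normrM (ger0_norm (mu_ge0 z)) ler_wpM2l// /cut.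
  by case: ifPn => [/set_mem/h//|]; rewrite normr0.
- by move=> m; exact: ebst.
- move=> y _; apply: (@step_cvg _ _ _ _ mu_ge0 c0_ge0 mu_exp _ _ _ _ _ D) => //.
Qed.

End exit_potential.

(** * Growth estimates and limits of Green function ratios *)

Section growth.
Context {R : realType} {d : nat}.
Notation X := (zvec 'I_d).
Variables (mu : X -> R) (c0 : R).
Hypotheses (mu_ge0 : forall z, 0 <= mu z) (mu_mass : rsum mu = 1) (c0_gt0 : 0 < c0)
  (mu_exp : abs_summable (fun z => mu z * expR (c0 * l1 z)))
  (irr : forall L : {set 'I_d}, irreducible_on mu L).
Variable L : {set 'I_d}.
Hypothesis drift0 : forall i, i \in L -> drift mu i = 0.
Implicit Types (x y z p q w : X) (g : X -> R).

(* With cov beta = unitv i in lower_bound, climbing r levels takes a time t of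
   order r / s^2 and costs s^3 t, which is of order s r. *)
Lemma climb i (e : R) : i \in L -> 0 < e -> exists C K : R, [/\ 1 <= C, 0 <= K &
  forall r : nat, exists w : X, [/\ (forall j, j \in L -> w j = 0), l1 w <= K * (r%:R + 1) &
    forall g q, superharmonic mu (orthant_on L) g -> orthant_on L q ->
      g (q + unitv i *+ r + w) <= C * expR (e * r%:R) * g q]].
Proof.
move=> iL e0.
have [beta hbeta] := cov_mul_surj mu_ge0 c0_gt0 mu_exp i (@irr finset.set0).
have [C [s0 [C0 s0_gt0 hs]]] := lower_bound mu_ge0 mu_mass c0_gt0 mu_exp (@irr L) drift0
  (beta := beta) (fun j _ => ltac:(by rewrite hbeta)).
(* Small enough for the cost C s^3 t, about C s r, to be at most e r. *)
pose s := Num.min s0 (e / (C + 1)).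
have s_gt0 : 0 < s by rewrite lt_min s0_gt0 divr_gt0// ltr_wpDl.
have ss0 : s <= s0 by rewrite ge_min lexx.
have se : C * s <= e.
  have : s <= e / (C + 1) by rewrite ge_min lexx orbT.
  rewrite ler_pdivlMr ?ltr_wpDl// => h; have := ltW s_gt0; lra.
have [T0 hT0] := hs s s_gt0 ss0.
have s2_gt0 : 0 < s ^+ 2 by rewrite exprn_gt0.
pose m1 := \sum_j `|drift mu j|.
have m10 : 0 <= m1 by exact: sumr_ge0.
pose D := (T0%:R + 1) * s ^+ 2 + s ^+ 3 * (T0%:R + 1) + d%:R.
have s3_ge0 : 0 <= s ^+ 3 by rewrite exprn_ge0// ltW.
have T00 : 0 <= T0%:R + 1 :> R by rewrite addr_ge0.
have D0 : 0 <= D by rewrite /D !addr_ge0// mulr_ge0// ltW.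
pose K := (s ^- 2 + T0%:R + 1) * m1 + d%:R.
have K0 : 0 <= K by rewrite addr_ge0// mulr_ge0// !addr_ge0// invr_ge0 ltW.
exists (2 * expR (C * D)), K; split => //.
  have : 1 <= expR (C * D) by rewrite -expR0 ler_expR mulr_ge0.
  lra.
move=> r.
pose t := (Num.truncn (r%:R / s ^+ 2) + T0.+1)%N.
have rs0 : 0 <= r%:R / s ^+ 2 by rewrite divr_ge0// ltW.
have t1 : t%:R <= r%:R / s ^+ 2 + (T0%:R + 1).
  by rewrite /t natrD lerD// ?truncn_le// natr1.
have t2 : r%:R / s ^+ 2 <= t%:R.
  apply: le_trans (ltW (truncnS_gt _)) _.
  by rewrite /t ler_nat addnS ltnS leq_addr.
pose w : X := [ffun j => Num.floor (t%:R * drift mu j)].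
have wE j : w j = Num.floor (t%:R * drift mu j) by rewrite ffunE.
have fl (u : R) : `|(Num.floor u)%:~R - u| <= 1.
  have := floor_le_tmp u; have := floorD1_gt u; rewrite intrD => h1 h2.
  by rewrite ler_norml; apply/andP; split; lra.
exists w; split.
- by move=> j jL; rewrite wE drift0// mulr0 floor0.
- have hw j : `|(w j)%:~R| <= t%:R * `|drift mu j| + 1.
    rewrite wE; have := fl (t%:R * drift mu j); set u := t%:R * _ => h.
    have -> : t%:R * `|drift mu j| = `|u| by rewrite /u normrM ger0_norm.
    by have := ler_distD u 0 (Num.floor u)%:~R; rewrite !sub0r !normrN distrC; lra.
  rewrite /l1; apply: le_trans (ler_sum _ (fun j _ => hw j)) _.
  rewrite big_split /= sumr_const card_ord -mulr_sumr -/m1.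
  have h3 : t%:R * m1 <= (r%:R / s ^+ 2 + (T0%:R + 1)) * m1 by rewrite ler_wpM2r.
  have r0 : 0 <= r%:R :> R by [].
  have h4 : 0 <= s ^- 2 * m1 by rewrite mulr_ge0// invr_ge0 ltW.
  have h5 : 0 <= r%:R * ((T0%:R + 1) * m1 + d%:R).
    by rewrite mulr_ge0// addr_ge0// mulr_ge0.
  rewrite /K; lra.
move=> g q sg qL; have [g0 _] := sg.
set y := q + _ + w.
have yval j : (y j)%:~R = (q j)%:~R + (if j == i then r%:R else 0) + (w j)%:~R :> R.
  rewrite /y zvecD zvecD !rmorphD; congr (_ + _ + _).
  by rewrite unitv_mulrn; case: ifP.
have yL : orthant_on L y.
  move=> j jL; rewrite -(@ltr0z R) yval wE drift0// mulr0 floor0 addr0.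
  have : 0 < (q j)%:~R :> R by rewrite ltr0z qL.
  have r0 : 0 <= r%:R :> R by [].
  by case: ifP => _ h; lra.
have Tt : (T0 <= t)%N by rewrite /t addnS; apply: leqW; exact: leq_addl.
have := hT0 t g q y Tt sg qL yL; set S := \sum_j _ => H.
have hS : S <= (T0%:R + 1) * s ^+ 2 + d%:R.
  have st : `|r%:R - t%:R * s ^+ 2| <= (T0%:R + 1) * s ^+ 2.
    move: t1 t2; rewrite ler_pdivrMr// => t1 t2.
    have : t%:R * s ^+ 2 <= (r%:R / s ^+ 2 + (T0%:R + 1)) * s ^+ 2 by rewrite ler_wpM2r// ltW.
    rewrite mulrDl divfK ?lt0r_neq0// => t1'.
    by rewrite ler_norml; apply/andP; split; lra.
  apply: (@le_trans _ _ (\sum_j ((if j == i then (T0%:R + 1) * s ^+ 2 else 0) + 1))).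
    apply: ler_sum => j _; rewrite yval hbeta wE.
    have := fl (t%:R * drift mu j); set f := (Num.floor _)%:~R; set u := t%:R * drift mu j => hf.
    have -> : (q j)%:~R + (if j == i then r%:R else 0) + f - (q j)%:~R -
        t%:R * (drift mu j + s ^+ 2 * (j == i)%:R) =
        (if j == i then r%:R - t%:R * s ^+ 2 else 0) + (f - u).
      by rewrite /u; case: ifP => _ /=; ring.
    apply: le_trans (ler_normD _ _) (lerD _ hf).
    by case: ifP; rewrite ?normr0.
  rewrite big_split /= sumr_const card_ord lerD//.
  by rewrite -big_mkcond /= big_pred1_eq.
have e1 : g y <= 2 * expR (C * (s ^+ 3 * t%:R + S)) * g q.
  have := ler_wpM2l (expR_ge0 (C * (s ^+ 3 * t%:R + S))) H.
  rewrite mulrA -expRD subrr expR0 mul1r => h; apply: le_trans h _; lra.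
apply: le_trans e1 _; rewrite ler_wpM2r ?g0// -mulrA ler_wpM2l// -expRD ler_expR.
have h6 : s ^+ 3 * t%:R <= s * r%:R + s ^+ 3 * (T0%:R + 1).
  apply: le_trans (ler_wpM2l s3_ge0 t1) _; rewrite mulrDr lerD2r.
  by rewrite le_eqVlt; apply/orP; left; apply/eqP; field; rewrite lt0r_neq0.
have h7 : C * (s ^+ 3 * t%:R + S) <= C * (s * r%:R + D) by rewrite ler_wpM2l// /D; lra.
have h8 : C * s * r%:R <= e * r%:R by rewrite ler_wpM2r.
lra.
Qed.

(** The coordinates in L are lowered to 1 one after the other, by [climb] read from the top, and
    then moved to those of x0 by the Harnack inequality at bounded cost. The other coordinates are
    displaced by an amount linear in l1 z, recorded for functions that depend on them. *)
Lemma growth x0 (e : R) : orthant_on L x0 -> 0 < e ->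
  exists C K : R, [/\ 0 <= C, 0 <= K & forall z, orthant_on L z ->
  exists p, [/\ orthant_on L p, (forall j, j \in L -> p j = x0 j),
    l1 (p - x0) <= K * (l1 z + 1) &
    forall g, superharmonic mu (orthant_on L) g -> g z <= C * expR (e * l1 z) * g p]].
Proof.
move=> x0L e0.
have step_one (s : seq 'I_d) (e' : R) : 0 < e' -> uniq s -> {subset s <= L} ->
  exists C K : R, [/\ 0 <= C, 0 <= K & forall z, orthant_on L z ->
  exists p, [/\ orthant_on L p, (forall j, j \in s -> p j = 1),
    (forall j, j \in L -> j \notin s -> p j = z j),
    l1 p <= K * (l1 z + 1) &
    forall g, superharmonic mu (orthant_on L) g ->
      g z <= C * expR ((size s)%:R * e' * l1 z) * g p]].
  move=> e'0; elim: s => [|i s IH].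
    move=> _ _; exists 1, 1; split => // z zL; exists z; split => //.
      by rewrite mul1r lerDl.
    by move=> g _; rewrite !mul0r expR0 !mul1r.
  move=> /= /andP[i_s us] sL.
  have iL : i \in L by apply: sL; exact: mem_head.
  have [C [K [C0 K0 h]]] := IH us (fun j js => sL j (mem_behead (s := i :: s) js)).
  have [C' [K' [C1' K0' h']]] := climb iL e'0.
  have C0' : 0 <= C' by apply: le_trans C1'.
  exists (C * C'), (K + 2 + K'); split; rewrite ?mulr_ge0 ?addr_ge0//.
  move=> z zL; have [p [pL ps pns lp gp]] := h z zL.
  have pi : p i = z i by exact: pns.
  pose r := `|z i - 1|%N.
  have zi1 : 1 <= z i by rewrite -gtz0_ge1 zL.
  have rE : r%:Z = z i - 1 by rewrite /r gez0_abs// subr_ge0.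
  have rR : r%:R = (z i)%:~R - 1 :> R by rewrite -[LHS]/(r%:Z%:~R) rE rmorphB.
  have rl : r%:R <= l1 z :> R.
    by rewrite rR; have := ler_coord_l1 (R := R) z i; have := ler_norm ((z i)%:~R : R); lra.
  have [w [wL lw gw]] := h' r.
  (* Climbing r = z i - 1 levels from q leads back to p. *)
  pose q := p - (unitv i *+ r + w).
  have qE j : j \in L -> q j = if j == i then 1 else p j.
    move=> jL; rewrite /q zvecB zvecD unitv_mulrn wL// addr0; case: eqP => [->|_]; last by rewrite subr0.
    by rewrite pi rE opprB addrCA subrr addr0.
  have qL : orthant_on L q by move=> j jL; rewrite qE//; case: ifP => // _; exact: pL.
  exists q; split => //.
  - move=> j; rewrite inE => /predU1P[->|js]; first by rewrite qE// eqxx.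
    rewrite qE; first by case: ifP => // _; exact: ps.
    by apply: sL; rewrite inE js orbT.
  - move=> j jL; rewrite inE negb_or => /andP[ji js].
    by rewrite qE// (negbTE ji) pns.
  - have lur : l1 (unitv i *+ r) <= r%:R :> R.
      elim: (r) => [|k IHk]; first by rewrite mulr0n /l1 big1// => j _; rewrite ffunE normr0.
      rewrite mulrS -natr1; apply: le_trans (l1D _ _) _; rewrite l1_unitv; lra.
    apply: le_trans (l1B _ _) _; have := l1D (R := R) (unitv i *+ r) w.
    have h1 : K' * (r%:R + 1) <= K' * (l1 z + 1) by rewrite ler_wpM2l// lerD2r.
    have := l1_ge0 (R := R) z; lra.
  - move=> g sg; have [g0 _] := sg.
    apply: le_trans (gp g sg) _.
    have := gw g q sg qL; rewrite (_ : q + unitv i *+ r + w = p); last by rewrite -addrA subrK.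
    move=> hg.
    apply: le_trans (ler_wpM2l _ hg) _; first by rewrite mulr_ge0 ?expR_ge0.
    have h1 : expR (e' * r%:R) <= expR (e' * l1 z) by rewrite ler_expR ler_wpM2l// ltW.
    have -> : (size s).+1%:R * e' * l1 z = (size s)%:R * e' * l1 z + e' * l1 z.
      by rewrite -natr1; ring.
    rewrite expRD [leLHS](_ : _ = C * C' * expR ((size s)%:R * e' * l1 z) * g q * expR (e' * r%:R)); last by ring.
    rewrite [leRHS](_ : _ = C * C' * expR ((size s)%:R * e' * l1 z) * g q * expR (e' * l1 z)); last by ring.
    by rewrite ler_wpM2l// !mulr_ge0 ?expR_ge0 ?g0.
have [Ch Ch0 harn] := superharmonic_harnack mu_ge0 (@irr L).
(* Each of the at most d coordinates is lowered at this rate, so the total rate is at most e. *)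
have e'0 : 0 < e / (d%:R + 1) by rewrite divr_gt0// ltr_wpDl.
have [C [K [C0 K0 h]]] := step_one (enum L) _ e'0 (enum_uniq _) (fun i => ltac:(by rewrite mem_enum)).
exists (C * expR (Ch * (l1 x0 + d%:R))), (K + 2 * (l1 x0 + d%:R)).
have lx0 := l1_ge0 (R := R) x0.
split; [by rewrite mulr_ge0 ?expR_ge0|by rewrite addr_ge0// mulr_ge0// addr_ge0|].
move=> z zL; have [p [pL ps _ lp gp]] := h z zL.
pose p' : X := [ffun j => if j \in L then x0 j else p j].
have p'E j : p' j = if j \in L then x0 j else p j by rewrite ffunE.
have p'L : orthant_on L p' by move=> j jL; rewrite p'E jL x0L.
have lpp : l1 (p' - p) <= l1 x0 + d%:R :> R.
  rewrite /l1 -[d in d%:R]card_ord -sumr_const -big_split /=; apply: ler_sum => j _.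
  rewrite zvecB p'E; case: ifPn => jL; last by rewrite subrr normr0 addr_ge0.
  rewrite (ps j) ?mem_enum// rmorphB; apply: le_trans (ler_normB _ _) _.
  by rewrite normr1.
exists p'; split => //.
- by move=> j jL; rewrite p'E jL.
- apply: le_trans (l1B _ _) _.
  have h1 : l1 p' <= l1 p + (l1 x0 + d%:R) :> R.
    have -> : p' = p + (p' - p) by rewrite addrCA subrr addr0.
    by apply: le_trans (l1D _ _) _; rewrite lerD2l.
  have h2 : 0 <= l1 z * (2 * (l1 x0 + d%:R)) :> R.
    by apply: mulr_ge0; [exact: l1_ge0|apply: mulr_ge0 => //; exact: addr_ge0].
  have : 0 <= d%:R :> R by [].
  lra.
- move=> g sg; have [g0 _] := sg.
  have h1 := harn g p' p sg p'L pL.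
  have h2 : g p <= expR (Ch * (l1 x0 + d%:R)) * g p'.
    have h3 : g p <= expR (Ch * l1 (p - p')) * g p'.
      have := ler_wpM2l (expR_ge0 (Ch * l1 (p - p'))) h1.
      by rewrite mulrA -expRD subrr expR0 mul1r.
    apply: le_trans h3 _; rewrite ler_wpM2r ?g0// ler_expR ler_wpM2l//.
    by rewrite -opprB l1N.
  apply: le_trans (gp g sg) _.
  rewrite -[leLHS]mulrA -[leRHS]mulrA -[leRHS]mulrA ler_wpM2l// [leRHS]mulrCA.
  apply: (@le_trans _ _ (expR (e * l1 z) * g p)); last by rewrite ler_wpM2l ?expR_ge0.
  rewrite ler_wpM2r ?g0// ler_expR ler_wpM2r ?l1_ge0//.
  rewrite mulrCA ler_piMr ?(ltW e0)// ler_pdivrMr ?ltr_wpDl// mul1r.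
  apply: (@le_trans _ _ d%:R); last by rewrite lerDl.
  by rewrite ler_nat -cardE; apply: leq_trans (max_card _) _; rewrite card_ord.
Qed.

End growth.

(** * Domination of the normalized Green functions *)

Section domination.
Context {R : realType} {d : nat}.
Notation X := (zvec 'I_d).
Variables (mu : X -> R) (c0 : R).
Hypotheses (mu_ge0 : forall z, 0 <= mu z) (mu_mass : rsum mu = 1) (c0_gt0 : 0 < c0)
  (mu_exp : abs_summable (fun z => mu z * expR (c0 * l1 z)))
  (irr : forall L : {set 'I_d}, irreducible_on mu L).
Variable L : {set 'I_d}.
Hypotheses (drift0 : forall i, i \in L -> drift mu i = 0)
  (drift_neq0 : exists i, drift mu i != 0).
Variable xs : nat -> X.
Let E : set X := orthant_on L.
Hypothesis xsE : forall n, E (xs n).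
Variable Kd : R.
Hypotheses (Kd_ge0 : 0 <= Kd)
  (xs_dir : forall (gam : R) (T0 : nat), 0 < gam -> \forall n \near \oo,
    exists t : nat, [/\ (T0 <= t)%N,
      \sum_i `|(xs n i)%:~R - t%:R * drift mu i| <= gam * l1 (xs n) &
      t%:R <= Kd * l1 (xs n)])
  (xs_inf : forall B : R, \forall n \near \oo, B <= l1 (xs n)).
Implicit Types (x y z p q w : X) (g : X -> R).

Let G n : X -> R := gfun mu E (xs n).

Let tilt : exists2 a0 : 'I_d -> R, (forall i, `|a0 i| <= c0) & phi mu a0 < 1.
Proof.
have [e0 e00 h] := phi_lt1 mu_ge0 mu_mass c0_gt0 mu_exp drift_neq0.
have [h1 h2] := h e0 e00 (lexx _).
by exists (fun i => - (e0 * drift mu i)).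
Qed.

Let Gsup n : superharmonic mu E (G n).
Proof.
by have [a0 h1 h2] := tilt; exact: (gfun_superharmonic mu_ge0 c0_gt0 mu_exp h1 h2).
Qed.

(** [lower_bound] without tilt (beta = 0): from q the walk follows the drift, which at the time t of
    [xs_dir] leads near xs n, where G is at least 1. The cost s^3 t and the distance to the line are
    both small multiples of l1 (xs n), so the rate is as small as desired. *)
Lemma gfun_lower (gam : R) : 0 < gam -> exists2 del : R, 0 < del &
  \forall n \near \oo, forall q, E q -> l1 q <= del * l1 (xs n) ->
    expR (- (gam * l1 (xs n))) <= 2 * G n q.
Proof.
move=> gam0.
pose beta0 : 'I_d -> R := fun=> 0.
have cm0 i : cov_mul mu beta0 i = 0 by rewrite /cov_mul big1// => j _; rewrite mulr0.
have cov0 i : i \in L -> 0 <= cov_mul mu beta0 i by rewrite cm0.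
have [C [s0 [C0 s0_gt0 hs]]] := lower_bound mu_ge0 mu_mass c0_gt0 mu_exp (@irr L) drift0
  cov0.
have C1 : 0 < C + 1 by rewrite ltr_wpDl.
have Kd1 : 0 < Kd + 1 by rewrite ltr_wpDl.
pose s := Num.min (Num.min s0 1) (gam / 3 / ((C + 1) * (Kd + 1))).
have s_gt0 : 0 < s.
  by rewrite !lt_min s0_gt0 ltr01 /=; apply: divr_gt0; [exact: divr_gt0|exact: mulr_gt0].
have [T0 hT0] := hs s s_gt0 (ltac:(by rewrite !ge_min lexx)).
have s1 : s <= 1 by rewrite !ge_min lexx orbT.
have hsK : C * (s ^+ 3 * Kd) <= gam / 3.
  have h : s <= gam / 3 / ((C + 1) * (Kd + 1)) by rewrite !ge_min lexx orbT.
  rewrite ler_pdivlMr ?mulr_gt0// in h.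
  have s3 : 0 <= s ^+ 3 by apply: exprn_ge0; exact: ltW.
  have s31 : s ^+ 3 <= s by rewrite -[leRHS]expr1 ler_wiXn2l// ltW.
  apply: le_trans h; rewrite [leRHS](_ : _ = (C + 1) * (s * (Kd + 1))); last by ring.
  have h1 : s ^+ 3 * Kd <= s * (Kd + 1) by apply: ler_pM => //; rewrite lerDl.
  by apply: (ler_pM C0 (mulr_ge0 s3 Kd_ge0) _ h1); rewrite lerDl.
pose gam' := gam / 3 / (C + 1).
have gam'0 : 0 < gam' by apply: divr_gt0 => //; exact: divr_gt0.
have Cg : C * gam' <= gam / 3.
  rewrite /gam' mulrCA ler_piMr ?divr_ge0 ?(ltW gam0)//.
  by rewrite ler_pdivrMr// mul1r lerDl.
exists gam' => //.
have := xs_dir T0 gam'0; apply: filterS => n [t [Tt ht tK]] q Eq lq.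
have := hT0 t (G n) q (xs n) Tt (Gsup n) Eq (xsE n).
set S := \sum_i _ => H.
have hS : S <= 2 * gam' * l1 (xs n).
  apply: (@le_trans _ _ (\sum_i (`|(xs n i)%:~R - t%:R * drift mu i| + `|(q i)%:~R|))).
    apply: ler_sum => i _; rewrite cm0 mulr0 addr0 addrAC.
    by apply: le_trans (ler_normB _ _) _.
  by rewrite big_split /= -/(l1 q); lra.
have g1 : 1 <= G n (xs n).
  by have [a0 h1 h2] := tilt; exact: (gfun_diag mu_ge0 c0_gt0 mu_exp h1 h2 (xsE n)).
apply: le_trans H.
apply: (@le_trans _ _ (expR (- (C * (s ^+ 3 * t%:R + S))))); last first.
  by rewrite ler_peMr ?expR_ge0.
rewrite ler_expR lerN2 mulrDr.
have h1 : C * (s ^+ 3 * t%:R) <= gam / 3 * l1 (xs n).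
  apply: (@le_trans _ _ (C * (s ^+ 3 * Kd) * l1 (xs n))).
    rewrite -[leRHS]mulrA ler_wpM2l// -[leRHS]mulrA ler_wpM2l//.
    by apply: exprn_ge0; exact: ltW.
  by rewrite ler_wpM2r ?l1_ge0.
have h2 : C * S <= 2 * (gam / 3 * l1 (xs n)).
  apply: le_trans (ler_wpM2l C0 hS) _.
  rewrite (_ : C * _ = 2 * (C * gam' * l1 (xs n))); last by ring.
  by rewrite ler_wpM2l// ler_wpM2r ?l1_ge0.
lra.
Qed.

(** The error term of [gfun_ratio] decays at a fixed rate in l1 (xs n), whereas [gfun_lower] bounds
    G n q from below at any smaller rate; the error is thus absorbed in the factor 1 + e. *)
Lemma gfun_ratio_near (w : X) (e : R) : (forall i, i \in L -> w i = 0) -> w != 0 -> 0 < e ->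
  exists2 del : R, 0 < del & \forall n \near \oo, forall q, E q -> l1 q <= del * l1 (xs n) ->
    G n (q + w) <= (1 + e) * G n q.
Proof.
move=> wL w0 e0; have [a0 a0c phi0] := tilt.
have e2 : 0 < e / 2 by rewrite divr_gt0.
have [C [del [C0 del0 hr]]] := gfun_ratio mu_ge0 mu_mass c0_gt0 mu_exp a0c phi0 (@irr L) wL w0 e2.
have [del1 del10 hl] := gfun_lower (divr_gt0 del0 (ltr0n _ 4)).
exists (Num.min (1 / 2) del1); first by rewrite lt_min divr_gt0.
have C1 : 0 < C + 1 by rewrite ltr_wpDl.
have h3 := xs_inf (ln (4 * (C + 1) / e) / (del / 4)).
near=> n.
have n3 : ln (4 * (C + 1) / e) / (del / 4) <= l1 (xs n) by near: n; exact: h3.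
have nl : forall q, E q -> l1 q <= del1 * l1 (xs n) -> expR (- (del / 4 * l1 (xs n))) <= 2 * G n q.
  by near: n; exact: hl.
move=> q Eq lq.
have G0 : 0 <= G n q by have [h _] := Gsup n; exact: h.
have lq1 : l1 q <= 1 / 2 * l1 (xs n) :> R.
  by apply: le_trans lq _; rewrite ler_wpM2r ?l1_ge0// ge_min lexx.
have lq2 : l1 q <= del1 * l1 (xs n).
  by apply: le_trans lq _; rewrite ler_wpM2r ?l1_ge0// ge_min lexx orbT.
apply: le_trans (hr q (xs n) Eq) _; rewrite -/(G n).
suff : C * expR (- (del * l1 (q - xs n))) <= e / 2 * G n q by lra.
have h4 : l1 (xs n) <= l1 (q - xs n) + l1 q :> R.
  by rewrite -(l1N (q - xs n)) opprB; apply: le_trans (l1D _ _); rewrite subrK.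
(* As l1 (q - xs n) >= l1 (xs n) / 2, the error splits into two equal factors: one is compared with
   G n q, the other tends to 0. *)
have h5 : expR (- (del * l1 (q - xs n))) <=
    expR (- (del / 4 * l1 (xs n))) * expR (- (del / 4 * l1 (xs n))).
  rewrite -expRD ler_expR.
  have : del * (1 / 2 * l1 (xs n)) <= del * l1 (q - xs n).
    by rewrite ler_wpM2l ?(ltW del0)//; lra.
  lra.
have h6 : (C + 1) * expR (- (del / 4 * l1 (xs n))) <= e / 4.
  have ce : 0 < 4 * (C + 1) / e by rewrite divr_gt0// mulr_gt0.
  have : 4 * (C + 1) / e <= expR (del / 4 * l1 (xs n)).
    move: n3; rewrite ler_pdivrMr ?divr_gt0// => n3.
    by rewrite -[leLHS]lnK ?posrE// ler_expR [leRHS]mulrC.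
  rewrite ler_pdivrMr// => h; rewrite expRN ler_pdivrMr ?expR_gt0//.
  by lra.
have e4 : 0 <= e / 4 by rewrite divr_ge0// ltW.
apply: le_trans (ler_wpM2l C0 h5) _; rewrite mulrA.
apply: (@le_trans _ _ (e / 4 * (2 * G n q))); last by lra.
apply: ler_pM; rewrite ?mulr_ge0 ?expR_ge0//; last exact: nl.
by apply: le_trans h6; rewrite ler_wpM2r ?expR_ge0// lerDl.
Unshelve. all: by end_near. Qed.

Variable x0 : X.
Hypothesis x0E : E x0.

(** Unit steps off L preserve the domain and cost a factor 1 + e <= exp(e) each, as long as the path
    stays in the ball where [gfun_ratio_near] applies. *)
Lemma gfun_walk (e : R) : 0 < e -> exists2 del : R, 0 < del &
  \forall n \near \oo, forall q, E q -> (forall j, j \in L -> q j = x0 j) ->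
    l1 (q - x0) + l1 x0 <= del * l1 (xs n) -> G n q <= expR (e * l1 (q - x0)) * G n x0.
Proof.
move=> e0.
have /choice[del hdel] : forall i : 'I_d, exists del : R, 0 < del /\ (i \notin L ->
   \forall n \near \oo, forall q, E q -> l1 q <= del * l1 (xs n) ->
    G n (q + unitv i) <= (1 + e) * G n q /\ G n (q - unitv i) <= (1 + e) * G n q).
  move=> i; have [iL|iL] := boolP (i \in L); first by exists 1.
  have uL j : j \in L -> unitv i j = 0.
    by move=> jL; rewrite unitv_val; case: eqP => // ji; rewrite -ji jL in iL.
  have uL' j : j \in L -> (- unitv i) j = 0.
    by move=> jL; rewrite -sub0r zvecB uL// ffunE.
  have u0 : unitv i != 0 by apply/eqP => /ffunP/(_ i); rewrite unitv_val eqxx ffunE.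
  have u0' : - unitv i != 0 by rewrite oppr_eq0.
  have [d1 d10 h1] := gfun_ratio_near uL u0 e0.
  have [d2 d20 h2] := gfun_ratio_near uL' u0' e0.
  exists (Num.min d1 d2); split; first by rewrite lt_min d10.
  move=> _; apply: filterS2 h1 h2 => n h1 h2 q Eq lq; split.
    by apply: h1 => //; apply: le_trans lq _; rewrite ler_wpM2r ?l1_ge0// ge_min lexx.
  by apply: h2 => //; apply: le_trans lq _; rewrite ler_wpM2r ?l1_ge0// ge_min lexx orbT.
pose del1 := \big[Num.min/1]_i del i.
have del10 : 0 < del1 by apply/bigmin_gtP; split => // i _; have [] := hdel i.
have del1_le i : del1 <= del i by exact: bigmin_le_cond.
exists del1 => //.
have hall : \forall n \near \oo, forall i : 'I_d, i \notin L -> forall q, E q -> l1 q <= del1 * l1 (xs n) ->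
    G n (q + unitv i) <= (1 + e) * G n q /\ G n (q - unitv i) <= (1 + e) * G n q.
  apply: filter_forall => i; have [iL|iL] := boolP (i \in L).
    by apply: filterE => n.
  have [_ h] := hdel i; apply: filterS (h iL) => n {}h _ q Eq lq; apply: h => //.
  by apply: le_trans lq _; rewrite ler_wpM2r ?l1_ge0.
apply: filterS hall => n hall q.
pose N (x : X) := (\sum_i `|x i|)%N.
have NE z : l1 z = (N z)%:R :> R.
  rewrite /l1 /N natr_sum; apply: eq_bigr => i _.
  by rewrite -intr_norm -natr_absz.
have [m] := ubnP (N (q - x0)); elim: m q => // m IH q hm Eq qL lq.
have [->|qx] := eqVneq q x0.
  by rewrite subrr /l1 big1 ?mulr0 ?expR0 ?mul1r// => i _; rewrite ffunE normr0.
have [i qxi] : exists i, q i != x0 i.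
  apply/existsP; rewrite -negb_forall; apply: contra qx => /forallP h.
  by apply/eqP/ffunP => i; apply/eqP/h.
have iL : i \notin L by apply: contra qxi => iL; rewrite qL.
pose q' := if q i < x0 i then q + unitv i else q - unitv i.
have q'E j : j != i -> q' j = q j.
  by move=> /negbTE ji; rewrite /q'; case: ifP => _; rewrite ?zvecB ?zvecD unitv_val ji ?subr0 ?addr0.
have q'L j : j \in L -> q' j = x0 j.
  by move=> jL; rewrite q'E ?qL//; apply: contraNneq iL => <-.
have Eq' : E q' by move=> j jL; rewrite q'L// x0E.
have q'N : N (q - x0) = (N (q' - x0)).+1.
  rewrite /N (bigD1 i)//= [in RHS](bigD1 i)//= -addSn; congr addn.
    rewrite /q'; clear - qxi.
    by case: (ltP (q i) (x0 i)) => h; rewrite !(zvecB, zvecD) unitv_val eqxx; lia.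
  by apply: eq_bigr => j ji; rewrite !zvecB q'E.
have lq' : l1 (q - x0) = l1 (q' - x0) + 1 :> R by rewrite !NE q'N natr1.
have lq'2 : l1 (q' - x0) + l1 x0 <= del1 * l1 (xs n) by apply: le_trans lq; rewrite lq'; lra.
have IHq : G n q' <= expR (e * l1 (q' - x0)) * G n x0.
  by apply: IH => //; rewrite -ltnS -q'N.
have lq'3 : l1 q' <= del1 * l1 (xs n).
  by apply: le_trans lq'2; apply: le_trans (l1D _ _); rewrite subrK.
have st : G n q <= (1 + e) * G n q'.
  have [h1 h2] := hall i iL q' Eq' lq'3.
  rewrite /q' in h1 h2 *; case: ifP h1 h2 => _ h1 h2.
    by rewrite addrK in h2.
  by rewrite subrK in h1.
have G0 : 0 <= G n x0 by have [h _] := Gsup n; exact: h.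
apply: le_trans st _.
apply: (@le_trans _ _ ((1 + e) * (expR (e * l1 (q' - x0)) * G n x0))).
  by rewrite ler_wpM2l// addr_ge0// ltW.
rewrite mulrA ler_wpM2r// lq' mulrDr mulr1 expRD mulrC ler_wpM2l ?expR_ge0//.
exact: expR_ge1Dx.
Qed.

(** If l1 z <= eta l1 (xs n), [growth] leads to a point with the L-coordinates of x0, and
    [gfun_walk] from there to x0. Otherwise l1 (xs n) < l1 z / eta, and the a priori bounds of G n z
    from above and of G n x0 from below suffice, their rate g0 being small compared with e and e
    eta. *)
Lemma gfun_domination (e : R) : 0 < e -> exists C : R,
  \forall n \near \oo, forall z, E z -> G n z <= C * expR (e * l1 z) * G n x0.
Proof.
move=> e_gt0; have e0 := ltW e_gt0.
have e2 : 0 < e / 2 by rewrite divr_gt0.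
have [Cg [K [Cg0 K0 hg]]] := growth mu_ge0 mu_mass c0_gt0 mu_exp irr drift0 x0E e2.
have K1 : 0 < K + 1 by rewrite ltr_wpDl.
have e2K : 0 < e / 2 / (K + 1) by rewrite divr_gt0.
have [del del0 hw] := gfun_walk e2K.
pose eta := del / (2 * (K + 1)).
have eta0 : 0 < eta by rewrite /eta divr_gt0// mulr_gt0.
have [e1 e10 hphi] := phi_lt1 mu_ge0 mu_mass c0_gt0 mu_exp drift_neq0.
pose m1 := \sum_i `|drift mu i|.
have m10 : 0 <= m1 by exact: sumr_ge0.
have m1p : 0 < m1 + 1 by rewrite ltr_wpDl.
pose g0 := e / 4 * (Num.min 1 eta).
have me : 0 < Num.min 1 eta by rewrite lt_min ltr01.
have g00 : 0 < g0 by apply: mulr_gt0 => //; rewrite divr_gt0.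
have g01 : g0 <= e / 4 by rewrite ler_piMr ?divr_ge0// ge_min lexx.
have g0eta : g0 <= e / 4 * eta by rewrite ler_wpM2l ?divr_ge0// ge_min lexx orbT.
pose e3 := Num.min e1 (g0 / (m1 + 1)).
have e30 : 0 < e3 by rewrite lt_min e10 divr_gt0.
have [a0c phi0] := hphi e3 e30 (ltac:(by rewrite ge_min lexx)).
set a0 := (fun i => _) in a0c phi0.
have a0g i : `|a0 i| <= g0.
  rewrite /a0 normrN normrM (ger0_norm (ltW e30)).
  apply: (@le_trans _ _ (g0 / (m1 + 1) * (m1 + 1))); last by rewrite divfK// lt0r_neq0.
  apply: ler_pM => //; first exact: ltW.
    by rewrite ge_min lexx orbT.
  by rewrite /m1 (bigD1 i)//= -addrA lerDl addr_ge0// sumr_ge0.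
have [del2 del20 hl] := gfun_lower g00.
pose C0 := (1 - phi mu a0)^-1.
have C00 : 0 <= C0 by rewrite invr_ge0 subr_ge0 ltW.
exists (Cg * expR (e / 2) + 2 * C0).
have hb1 := xs_inf (l1 x0 / del2).
have hb2 := xs_inf ((K + 1 + l1 x0) * 2 / del).
near=> n; move=> z Ez.
have wn : forall q, E q -> (forall j, j \in L -> q j = x0 j) ->
    l1 (q - x0) + l1 x0 <= del * l1 (xs n) -> G n q <= expR (e / 2 / (K + 1) * l1 (q - x0)) * G n x0.
  by near: n; exact: hw.
have ln_ : forall q, E q -> l1 q <= del2 * l1 (xs n) -> expR (- (g0 * l1 (xs n))) <= 2 * G n q.
  by near: n; exact: hl.
have b1 : l1 x0 / del2 <= l1 (xs n) by near: n; exact: hb1.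
have b2 : (K + 1 + l1 x0) * 2 / del <= l1 (xs n) by near: n; exact: hb2.
have G0 : 0 <= G n x0 by have [h _] := Gsup n; exact: h.
have [near_|far] := leP (l1 z) (eta * l1 (xs n)).
  have [p [Ep pL lp gp]] := hg z Ez.
  have h1 := gp (G n) (Gsup n).
  have h2 : G n p <= expR (e / 2 / (K + 1) * l1 (p - x0)) * G n x0.
    apply: wn => //.
    have h3 : K * l1 z <= del / 2 * l1 (xs n).
      apply: (@le_trans _ _ ((K + 1) * (eta * l1 (xs n)))).
        by apply: ler_pM => //; rewrite ?l1_ge0// lerDl.
      rewrite /eta le_eqVlt; apply/orP; left; apply/eqP.
      by field; rewrite lt0r_neq0.
    move: b2; rewrite ler_pdivrMr//; lra.
  have h3 : expR (e / 2 / (K + 1) * l1 (p - x0)) <= expR (e / 2) * expR (e / 2 * l1 z).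
    rewrite -expRD ler_expR; apply: (@le_trans _ _ (e / 2 * (l1 z + 1))); last by lra.
    rewrite -[leLHS]mulrA ler_wpM2l ?divr_ge0// ler_pdivrMl//; apply: le_trans lp _.
    by rewrite ler_wpM2r ?addr_ge0 ?l1_ge0// lerDl.
  apply: le_trans h1 _.
  apply: (@le_trans _ _ (Cg * expR (e / 2 * l1 z) * (expR (e / 2) * expR (e / 2 * l1 z) * G n x0))).
    rewrite ler_wpM2l ?mulr_ge0 ?expR_ge0//; apply: le_trans h2 _.
    by rewrite ler_wpM2r.
  rewrite [leLHS](_ : _ = Cg * expR (e / 2) * (expR (e / 2 * l1 z) * expR (e / 2 * l1 z)) * G n x0); last by ring.
  rewrite -expRD -mulrDl -splitr ler_wpM2r// ler_wpM2r ?expR_ge0// lerDl mulr_ge0//.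
have h1 : G n z <= C0 * expR (g0 * (l1 z + l1 (xs n))).
  apply: le_trans (gfun_le mu_ge0 c0_gt0 mu_exp a0c phi0 _ _ _) _.
  rewrite ler_wpM2l// ler_expR; apply: le_trans (ler_norm _) _.
  apply: le_trans (ler_dot_l1 _ a0g) _; rewrite ler_wpM2l ?(ltW g00)//.
  exact: l1B.
have h2 : expR (- (g0 * l1 (xs n))) <= 2 * G n x0.
  apply: ln_ => //; move: b1; rewrite ler_pdivrMr// mulrC//.
have h3 : expR (g0 * (l1 z + l1 (xs n))) <= expR (e * l1 z) * expR (- (g0 * l1 (xs n))).
  rewrite -expRD ler_expR.
  have h4 : g0 * l1 z <= e / 4 * l1 z by rewrite ler_wpM2r ?l1_ge0.
  have h5 : g0 * l1 (xs n) <= e / 4 * l1 z.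
    apply: (@le_trans _ _ (e / 4 * (eta * l1 (xs n)))).
      by rewrite mulrA ler_wpM2r ?l1_ge0.
    by rewrite ler_wpM2l ?divr_ge0// ltW.
  have := mulr_ge0 e0 (l1_ge0 z); lra.
apply: le_trans h1 _.
apply: (@le_trans _ _ (C0 * (expR (e * l1 z) * (2 * G n x0)))).
  rewrite ler_wpM2l//; apply: le_trans h3 _; rewrite ler_wpM2l ?expR_ge0//.
rewrite [leLHS](_ : _ = 2 * C0 * expR (e * l1 z) * G n x0); last by ring.
by rewrite ler_wpM2r// ler_wpM2r ?expR_ge0// lerDr mulr_ge0// expR_ge0.
Unshelve. all: by end_near. Qed.

End domination.

Lemma fmap_ultra (T S : Type) (f : T -> S) (U : set_system T) :
  UltraFilter U -> UltraFilter (f @ U).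
Proof.
move=> UU; apply: Build_UltraFilter => G GF UG.
apply/seteqP; split => [A GA|]; last exact: UG.
have [//|UA] := in_ultra_setVsetC (f @^-1` A) UU.
have /UG GA' : (f @ U) (~` A) by [].
by have [x []] := filter_ex (filterI GA GA').
Qed.

(** * Harmonic functions of the induced chain and the function h *)

Section harmonic.
Context {R : realType} {d : nat}.
Notation X := (zvec 'I_d).
Variables (mu : X -> R) (c0 : R).
Hypotheses (mu_ge0 : forall z, 0 <= mu z) (mu_mass : rsum mu = 1) (c0_gt0 : 0 < c0)
  (mu_exp : abs_summable (fun z => mu z * expR (c0 * l1 z)))
  (irr : forall L : {set 'I_d}, irreducible_on mu L).
Variable L : {set 'I_d}.
Hypotheses (drift0 : forall i, i \in L -> drift mu i = 0)
  (drift_neq0 : exists i, drift mu i != 0) (d_gt0 : (0 < d)%N).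
Implicit Types (x y z p q w : X) (F g : X -> R).

Let c0_ge0 : 0 <= c0 := ltW c0_gt0.
Let E : set X := orthant_on L.
Let O : set X := @orthant 'I_d.

Variables del eps rho : R.
Hypotheses (eps_gt0 : 0 < eps) (eps_del : eps * d%:R <= del / 2)
  (rho_ge0 : 0 <= rho) (rho_lt1 : rho < 1)
  (tilt_c0 : forall i j b k, i \notin L -> `|exit_tilt del eps i j b k| <= c0)
  (tilt_phi : forall i j b, i \notin L -> phi mu (exit_tilt del eps i j b) <= rho).

Let del_gt0 : 0 < del.
Proof.
by have : 0 < eps * d%:R; [rewrite mulr_gt0// ltr0n|move: eps_del; lra].
Qed.

Let OE x : O x -> E x. Proof. by move=> Ox i _; exact: Ox. Qed.

Let ebs A g x : exp_bounded c0 g -> step_summable mu A g x.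
Proof. exact: exp_bounded_step_summable. Qed.

(* Harmonic functions of the induced chain, seen as functions on Z^d. *)
Definition lifted_harmonic F := [/\ (forall z, 0 <= F z), (forall z, ~ E z -> F z = 0),
  (forall z, E z -> 0 < F z),
  (forall z z', E z -> E z' -> (forall i, i \in L -> z i = z' i) -> F z = F z') &
  (forall x, E x -> step_summable mu E F x /\ step mu E F x = F x)].

(** At most eps for the control of exits by [exit_weight], at most c0 for summability. *)
Let e1 := Num.min eps c0.
Let e1_gt0 : 0 < e1. Proof. by rewrite lt_min eps_gt0. Qed.

Let exp_bounded_e1 (C : R) g : 0 <= C -> (forall z, 0 <= g z) ->
  (forall z, g z <= C * expR (e1 * l1 z)) ->
  exp_bounded c0 g /\ forall z, g z <= C * expR (eps * l1 z).
Proof.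
move=> C0 g0 gC; split.
  exists C => z; rewrite ger0_norm//; apply: le_trans (gC z) _.
  by rewrite ler_wpM2l// ler_expR ler_wpM2r ?l1_ge0// ge_min lexx orbT.
move=> z; apply: le_trans (gC z) _.
by rewrite ler_wpM2l// ler_expR ler_wpM2r ?l1_ge0// ge_min lexx.
Qed.

(** The point p given by [growth] has the L-coordinates of [one], so F p = F one. *)
Lemma lifted_harmonic_growth F : lifted_harmonic F ->
  exists C, [/\ 0 <= C, exp_bounded c0 F & forall z, F z <= C * expR (eps * l1 z)].
Proof.
move=> [F0 FE Fpos FL Fh].
pose one : X := [ffun=> 1].
have oneE : E one by move=> i _; rewrite ffunE.
have [C [K [C0 K0 h]]] := growth mu_ge0 mu_mass c0_gt0 mu_exp irr drift0 oneE e1_gt0.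
have sF : superharmonic mu E F.
  by split=> [x _|x Ex]; [exact: F0|have [? ->] := Fh x Ex].
have CF : 0 <= C * F one by rewrite mulr_ge0.
exists (C * F one).
have [|||? ?] := @exp_bounded_e1 (C * F one) F => //.
move=> z; have [Ez|Ez] := pselect (E z); last first.
  by rewrite FE// mulr_ge0// expR_ge0.
have [p [pE pL _ gp]] := h z Ez; apply: le_trans (gp F sF) _.
by rewrite (FL p one pE oneE pL) mulrAC.
Qed.

Section lifted.
Variables (F : X -> R).
Hypothesis HF : lifted_harmonic F.

Let ev x := exit_value mu L F x.
Let h x := F x - ev x.

Lemma exit_value_lifted_cvg x : O x -> exit_part mu L n F x @[n --> \oo] --> ev x.
Proof.
move=> Ox; have [C [C0 bF FC]] := lifted_harmonic_growth HF; have [F0 _ _ _ _] := HF.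
apply: (exit_value_cvg mu_ge0 c0_gt0 mu_exp d_gt0 eps_gt0 (ltW del_gt0) rho_ge0 rho_lt1 tilt_c0 tilt_phi bF C0) => //.
Qed.

Lemma iter_lifted n x : O x -> iter n (step mu O) F x = F x - exit_part mu L n F x.
Proof.
move=> Ox; have [C [C0 bF FC]] := lifted_harmonic_growth HF; have [F0 _ _ _ Fh] := HF.
have /= := @exit_decomposition _ _ mu c0 mu_ge0 c0_gt0 mu_exp L F (fun=> 0) n x bF (exp_bounded0 _) _ Ox.
have S0 : \sum_(t < n) iter t (step mu O) (fun=> 0) x = 0.
  rewrite big1// => t _; rewrite (_ : (fun=> 0) = (fun y => 0 * F y)).
    by rewrite iter_stepZ mul0r.
  by apply/funext => y; rewrite mul0r.
rewrite S0 addr0 => H; rewrite [X in X - _]H ?addrK// => y Oy.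
by rewrite addr0; have [_ ->] := Fh y (OE Oy).
Qed.

Lemma iter_lifted_cvg x : O x -> iter n (step mu O) F x @[n --> \oo] --> h x.
Proof.
move=> Ox; have -> : (fun n => iter n (step mu O) F x) = (fun n => F x - exit_part mu L n F x).
  by apply/funext => n; exact: iter_lifted.
by apply: cvgB; [exact: cvg_cst|exact: exit_value_lifted_cvg].
Qed.

Lemma exit_value_lifted_ge0 x : O x -> 0 <= h x /\ 0 <= ev x.
Proof.
move=> Ox; have [F0 _ _ _ _] := HF.
split.
  apply: (ler_cvg_to (cvg_cst 0) (iter_lifted_cvg Ox)); near=> n.
  by apply: iter_step_ge0.
apply: (ler_cvg_to (cvg_cst 0) (exit_value_lifted_cvg Ox)); near=> n.
by apply: sumr_ge0 => t _; apply: iter_step_ge0 => // y _; exact: step_ge0.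
Unshelve. all: by end_near. Qed.

(** The iterates of [step mu O] on F are dominated by F and tend to h; one more step does not change
    the limit. *)
Lemma lifted_h_harmonic x : O x -> step_summable mu O h x /\ step mu O h x = h x.
Proof.
move=> Ox; have [C [C0 bF FC]] := lifted_harmonic_growth HF; have [F0 _ _ _ _] := HF.
have hF y : O y -> `|h y| <= F y.
  move=> Oy; have [h0 e0] := exit_value_lifted_ge0 Oy.
  by rewrite ger0_norm// /h gerBl.
split; first by apply: (step_summable_le mu_ge0 hF); exact: ebs.
have c1 : iter n.+1 (step mu O) F x @[n --> \oo] --> h x.
  by have := iter_lifted_cvg Ox; rewrite -cvg_shiftS.
have c2 : step mu O (iter n (step mu O) F) x @[n --> \oo] --> step mu O h x.
  apply: (@step_cvg _ _ _ _ mu_ge0 c0_ge0 mu_exp _ _ _ _ _ F) => //.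
    near=> n => y Oy; rewrite ger0_norm; last exact: iter_step_ge0.
    rewrite iter_lifted// gerBl.
    by apply: sumr_ge0 => t _; apply: iter_step_ge0 => // z _; exact: step_ge0.
  by move=> y Oy; exact: iter_lifted_cvg.
exact: (cvg_unique _ c2 c1).
Unshelve. all: by end_near. Qed.

Lemma lifted_h_gt0 x : O x -> 0 < h x.
Proof.
move=> Ox; have [C [C0 bF FC]] := lifted_harmonic_growth HF; have [F0 _ Fpos FL _] := HF.
have p1 : 0 < 1 - rho by rewrite subr_gt0.
(* These points recede from the faces of positive drift with fixed coordinates in L: F is constant
   on them, while [exit_weight] decays exponentially in k since del - eps d >= del / 2. *)
pose y (k : nat) : X := [ffun i => if i \in L then 1 else k.+1%:Z].
have yE k i : y k i = if i \in L then 1 else k.+1%:Z by rewrite ffunE.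
have Oy k : O (y k) by move=> i; rewrite yE; case: ifP.
have Fy k : F (y k) = F (y 0%N).
  by apply: FL; [exact: OE|exact: OE|move=> i iL; rewrite !yE iL].
have Fy0 : 0 < F (y 0%N) by apply: Fpos; exact: OE.
have wy k : exit_weight L del eps (y k) <= (d * d * 2)%:R * expR (- (del / 2 * k.+1%:R)).
  rewrite /exit_weight; apply: (@le_trans _ _
    (\sum_(i | i \notin L) \sum_(j < d) \sum_(b : bool) expR (- (del / 2 * k.+1%:R)))).
    apply: ler_sum => i iL; apply: ler_sum => j _; apply: ler_sum => b _.
    rewrite dot_exit_tilt ler_expR !yE (negbTE iL).
    have yj : (0 : R) <= (if j \in L then 1 else k.+1%:Z)%:~R /\
        (if j \in L then 1 else k.+1%:Z)%:~R <= k.+1%:R :> R.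
      by case: ifP => _; split => //; rewrite ?ler1n// ler1n.
    have [y0 y1] := yj; set Y := (_%:~R) in y0 y1 *.
    have h1 : (-1) ^+ b * (eps * d%:R) * Y <= del / 2 * k.+1%:R.
      apply: le_trans (ler_norm _) _; rewrite normrM normrM normrX normrN1 expr1n mul1r.
      by rewrite ger0_norm ?mulr_ge0 ?(ltW eps_gt0)// ger0_norm// ler_pM// mulr_ge0// ltW.
    rewrite -[k.+1%:Z%:~R]/(k.+1%:R); lra.
  rewrite [X in _ <= X](_ : _ = \sum_(i < d) \sum_(j < d) \sum_(b : bool) expR (- (del / 2 * k.+1%:R))).
    rewrite [leRHS](bigID (fun i => i \notin L))/= lerDl; apply: sumr_ge0 => i _.
    by apply: sumr_ge0 => j _; apply: sumr_ge0 => b _; exact: expR_ge0.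
  rewrite !sumr_const !card_ord card_bool -!mulrnA -[RHS]mulr_natl.
  by congr (_%:R * _); rewrite mulnC mulnA.
have [k hk] : exists k, 0 < h (y k).
  pose A := C / (1 - rho) * (d * d * 2)%:R / F (y 0%N).
  pose k := Num.truncn (A / (del / 2)).
  exists k.
  have ev_le : ev (y k) <= C / (1 - rho) * exit_weight L del eps (y k).
    have := @exit_value_le _ _ mu c0 mu_ge0 c0_gt0 mu_exp L del eps rho d_gt0 eps_gt0 (ltW del_gt0)
       rho_ge0 rho_lt1 tilt_c0 tilt_phi F C bF C0 (fun z _ => F0 z) (fun z _ => FC z) 0 (y k) (Oy k).
    by rewrite /exit_part big_ord0 add0r expr0 mulr1.
  have CR : 0 <= C / (1 - rho) by rewrite divr_ge0// ltW.
  have dk : A < expR (del / 2 * k.+1%:R).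
    apply: lt_le_trans (expR_ge1Dx _).
    have := truncnS_gt (A / (del / 2)); rewrite -/k ltr_pdivrMr ?divr_gt0// mulrC; lra.
  rewrite /h subr_gt0 Fy; apply: le_lt_trans ev_le _.
  apply: le_lt_trans (ler_wpM2l CR (wy k)) _.
  rewrite expRN mulrA ltr_pdivrMr ?expR_gt0//.
  by move: dk; rewrite /A ltr_pdivrMr// (mulrC (F (y 0%N))).
(* Irreducibility in O carries the positivity from y k to x. *)
have [s [sO ls ps]] := @irr [set: 'I_d]%SET x (y k) (fun i _ => Ox i) (fun i _ => Oy k i).
have inO z : orthant_on [set: 'I_d]%SET z -> O z by move=> hz i; apply: hz; rewrite inE.
have sh : superharmonic mu O h.
  split=> z Oz; first by have [] := exit_value_lifted_ge0 Oz.
  by have [? ->] := lifted_h_harmonic Oz.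
have := @superharmonic_path _ _ mu mu_ge0 O h x s 0 sh; rewrite !addr0 ls.
move=> H; apply: lt_le_trans (H _).
  by rewrite mulr_gt0// path_weight_gt0.
move=> z; rewrite addr0 inE => /predU1P[->//|/sO]; exact: inO.
Qed.

End lifted.

End harmonic.

(** * Limits of the Green function ratios along an ultrafilter *)

Section limit.
Context {R : realType} {d : nat}.
Notation X := (zvec 'I_d).
Variables (mu : X -> R) (c0 : R).
Hypotheses (mu_ge0 : forall z, 0 <= mu z) (mu_mass : rsum mu = 1) (c0_gt0 : 0 < c0)
  (mu_exp : abs_summable (fun z => mu z * expR (c0 * l1 z)))
  (irr : forall L : {set 'I_d}, irreducible_on mu L).
Variable L : {set 'I_d}.
Hypotheses (drift0 : forall i, i \in L -> drift mu i = 0)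
  (drift_neq0 : exists i, drift mu i != 0) (d_gt0 : (0 < d)%N).
Implicit Types (x y z p q w : X) (F g : X -> R).

Let c0_ge0 : 0 <= c0 := ltW c0_gt0.
Let E : set X := orthant_on L.
Let O : set X := @orthant 'I_d.
Let B : set X := E `\` O.

Variables del eps rho : R.
Hypotheses (eps_gt0 : 0 < eps) (eps_del : eps * d%:R <= del / 2)
  (rho_ge0 : 0 <= rho) (rho_lt1 : rho < 1)
  (tilt_c0 : forall i j b k, i \notin L -> `|exit_tilt del eps i j b k| <= c0)
  (tilt_phi : forall i j b, i \notin L -> phi mu (exit_tilt del eps i j b) <= rho).

Variable xs : nat -> X.
Hypothesis xsO : forall n, O (xs n).
Variable Kd : R.
Hypotheses (Kd_ge0 : 0 <= Kd)
  (xs_dir : forall (gam : R) (T0 : nat), 0 < gam -> \forall n \near \oo,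
    exists t : nat, [/\ (T0 <= t)%N,
      \sum_i `|(xs n i)%:~R - t%:R * drift mu i| <= gam * l1 (xs n) &
      t%:R <= Kd * l1 (xs n)])
  (xs_inf : forall B : R, \forall n \near \oo, B <= l1 (xs n)).

Let del_ge0 : 0 <= del.
Proof.
by have : 0 <= eps * d%:R; [rewrite mulr_ge0// ltW|move: eps_del; lra].
Qed.

Let OE x : O x -> E x. Proof. by move=> Ox i _; exact: Ox. Qed.
Let xsE n : E (xs n) := OE (xsO n).

Let tilt : exists2 a0 : 'I_d -> R, (forall i, `|a0 i| <= c0) & phi mu a0 < 1.
Proof.
have [e0 e00 h] := phi_lt1 mu_ge0 mu_mass c0_gt0 mu_exp drift_neq0.
have [h1 h2] := h e0 e00 (lexx _).
by exists (fun i => - (e0 * drift mu i)).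
Qed.

Let Gsup y : superharmonic mu E (gfun mu E y).
Proof.
by have [a0 h1 h2] := tilt; exact: (gfun_superharmonic mu_ge0 c0_gt0 mu_exp h1 h2).
Qed.

Lemma gfun_gt0 y x : E y -> E x -> 0 < gfun mu E y x.
Proof.
move=> Ey Ex; have [C C0 harn] := superharmonic_harnack mu_ge0 (@irr L).
apply: lt_le_trans (harn _ x y (Gsup y) Ex Ey).
have [a0 h1 h2] := tilt.
rewrite mulr_gt0 ?expR_gt0//; apply: lt_le_trans (gfun_diag mu_ge0 c0_gt0 mu_exp h1 h2 Ey).
exact: ltr01.
Qed.

Let ebG y : exp_bounded c0 (gfun mu E y).
Proof. by have [a0 h1 h2] := tilt; exact: (exp_bounded_gfun mu_ge0 c0_gt0 mu_exp h1 h2). Qed.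

(** In [exit_decomposition] with u = [delta y], the term still in O after n steps tends to 0
    geometrically, by a tilt with [phi] less than 1. *)
Lemma gfun_orthant y x : O x ->
  exit_part mu L n (gfun mu E y) x @[n --> \oo] --> gfun mu E y x - gfun mu O y x.
Proof.
move=> Ox; have [a0 h1 h2] := tilt.
have hg z : O z -> gfun mu E y z = step mu E (gfun mu E y) z + delta y z.
  by move=> Oz; apply: (gfun_eq mu_ge0 c0_gt0 mu_exp h1 h2); exact: OE.
have dec n := @exit_decomposition _ _ mu c0 mu_ge0 c0_gt0 mu_exp L (gfun mu E y) (delta y) n x
  (ebG y) (exp_bounded_delta c0_ge0 y) hg Ox.
have -> : (fun n => exit_part mu L n (gfun mu E y) x) =
   (fun n => gfun mu E y x - gpart mu O n y x - iter n (step mu O) (gfun mu E y) x).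
  by apply/funext => n; rewrite [X in X - _ - _](dec n) /gpart -/O; ring.
rewrite -[X in _ --> X]subr0; apply: cvgB.
  apply: cvgB; first exact: cvg_cst.
  exact: (gpart_cvg mu_ge0 c0_gt0 mu_exp h1 h2 Ox).
pose C := (1 - phi mu a0)^-1 * expR (- dot a0 y).
have C0 : 0 <= C by rewrite mulr_ge0 ?expR_ge0// invr_ge0 subr_ge0 ltW.
apply: (@squeeze_cvgr _ _ _ _ (fun=> 0) (fun n => phi mu a0 ^+ n * (C * expR (dot a0 x)))).
- near=> n; apply/andP; split.
    by apply: iter_step_ge0 => // z _; have [a1 k1 k2] := tilt; exact: (gfun_ge0 mu_ge0 c0_gt0 mu_exp k1 k2).
  apply: (@le_trans _ _ (iter n (step mu O) (fun z => C * expR (dot a0 z)) x)).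
    apply: (iter_step_le mu_ge0 c0_ge0 mu_exp) => //.
      by apply: exp_boundedZ; exact: exp_bounded_dot.
    move=> z _; apply: le_trans (gfun_le mu_ge0 c0_gt0 mu_exp h1 h2 _ _ _) _.
    by rewrite dotB expRD /C; rewrite le_eqVlt; apply/orP; left; apply/eqP; ring.
  rewrite iter_stepZ mulrCA ler_wpM2l//.
  exact: (iter_step_expR mu_ge0 c0_ge0 mu_exp).
- exact: cvg_cst.
- rewrite -[X in _ --> X](mul0r (C * expR (dot a0 x))).
  apply: cvgM; last exact: cvg_cst.
  by apply: cvg_expr; rewrite ger0_norm// phi_ge0.
Unshelve. all: by end_near. Qed.

Variable x0 : X.
Hypothesis x0O : O x0.

Let k n z := gfun mu E (xs n) z / gfun mu E (xs n) x0.

Let Gx0_gt0 n : 0 < gfun mu E (xs n) x0. Proof. exact: gfun_gt0 (xsE n) (OE x0O). Qed.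

Let k_ge0 n z : 0 <= k n z.
Proof.
have [a0 h1 h2] := tilt.
by rewrite divr_ge0 ?(ltW (Gx0_gt0 n))// (gfun_ge0 mu_ge0 c0_gt0 mu_exp h1 h2).
Qed.

Let e1 := Num.min eps c0.
Let e1_gt0 : 0 < e1. Proof. by rewrite lt_min eps_gt0. Qed.

Let kE n : k n = fun z => (gfun mu E (xs n) x0)^-1 * gfun mu E (xs n) z.
Proof. by apply/funext => z; rewrite mulrC. Qed.

Let k_bound : exists2 C, 0 <= C & \forall n \near \oo, forall z, k n z <= C * expR (e1 * l1 z).
Proof.
have [C hC] := gfun_domination mu_ge0 mu_mass c0_gt0 mu_exp irr drift0 drift_neq0 xsE Kd_ge0 xs_dir
  xs_inf (OE x0O) e1_gt0.
exists `|C| => //; apply: filterS hC => n hC z.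
have CC : 0 <= `|C| * expR (e1 * l1 z) by rewrite mulr_ge0 ?expR_ge0.
have [Ez|Ez] := pselect (E z); last by rewrite /k /gfun /cut memNset// mul0r.
rewrite ler_pdivrMr//; apply: le_trans (hC z Ez) _.
by rewrite ler_wpM2r ?(ltW (Gx0_gt0 n))// ler_wpM2r ?expR_ge0// ler_norm.
Qed.

Variable U : set_system nat.
Hypotheses (UU : UltraFilter U) (Uoo : \oo `<=` U).

Let UF : ProperFilter U. Proof. exact: ultra_proper. Qed.

(** The values at z eventually lie in a segment, and an ultrafilter on a compact set converges. *)
Let k_cvg z : exists v : R, k n z @[n --> U] --> v.
Proof.
have [C C0 hC] := k_bound.
have := @segment_compact R 0 (C * expR (e1 * l1 z)); rewrite compact_ultra.
move=> /(_ ((fun n => k n z) @ U) (fmap_ultra _ UU)).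
have near_ : ((fun n => k n z) @ U) `[0, C * expR (e1 * l1 z)]%classic.
  apply: Uoo; apply: filterS hC => n hC; rewrite /= in_itv/=.
  by rewrite k_ge0 hC.
by move=> /(_ near_)[v [_ hv]]; exists v.
Qed.

Lemma martin_limit : exists2 F, lifted_harmonic mu L F & forall x, O x ->
  gfun mu O (xs n) x / gfun mu O (xs n) x0 @[n --> U] -->
  (F x - exit_value mu L F x) / (F x0 - exit_value mu L F x0).
Proof.
have [K hK] := choice k_cvg.
have [C C0 hC] := k_bound.
have hCU : \forall n \near U, forall z, k n z <= C * expR (e1 * l1 z) by exact: Uoo.
have K0 z : 0 <= K z.
  by apply: (ler_cvg_to (cvg_cst 0) (hK z)); apply: filterE => n; exact: k_ge0.
have Kx0 : K x0 = 1.
  apply: (cvg_unique _ (hK x0)) => //.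
  rewrite (_ : (fun n => k n x0) = fun=> 1); first exact: cvg_cst.
  by apply/funext => n; rewrite /k divff// lt0r_neq0.
have KC z : K z <= C * expR (e1 * l1 z).
  apply: (ler_cvg_to (hK z) (cvg_cst _)).
  by apply: filterS hCU => n; exact.
have KE z : ~ E z -> K z = 0.
  move=> Ez; apply: (cvg_unique _ (hK z)) => //.
  rewrite (_ : (fun n => k n z) = fun=> 0); first exact: cvg_cst.
  by apply/funext => n; rewrite /k /gfun /cut memNset// mul0r.
have bD : exp_bounded c0 (fun z => C * expR (e1 * l1 z)).
  exists C => z; rewrite ger0_norm ?mulr_ge0 ?expR_ge0// ler_wpM2l// ler_expR.
  by rewrite ler_wpM2r ?l1_ge0// ge_min lexx orbT.
have bK : exp_bounded c0 K.
  by apply: exp_bounded_le bD => z; rewrite ger0_norm.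
have bk n : exp_bounded c0 (k n) by rewrite kE; exact: exp_boundedZ.
have eps_bd g z : (g z <= C * expR (e1 * l1 z)) -> g z <= C * expR (eps * l1 z).
  move=> h; apply: le_trans h _.
  by rewrite ler_wpM2l// ler_expR ler_wpM2r ?l1_ge0// ge_min lexx.
have Kharm x : E x -> step_summable mu E K x /\ step mu E K x = K x.
  move=> Ex; split; first exact: (exp_bounded_step_summable mu_ge0 c0_ge0 mu_exp).
  have c1 : step mu E (k n) x @[n --> U] --> step mu E K x.
    apply: (@step_cvg _ _ _ _ mu_ge0 c0_ge0 mu_exp _ _ _ _ _ _ _ bD).
      by apply: filterS hCU => n h y _; rewrite ger0_norm ?k_ge0.
    by move=> y _; exact: hK.
  apply: (cvg_unique _ c1) => //.
  (* For large n the point xs n is far from x, and the term [delta] of the Green equation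
     disappears. *)
  have far : \forall n \near U, k n x = step mu E (k n) x.
    apply: Uoo; have := xs_inf (l1 x + 1); apply: filterS => n hn.
    have [a0 h1 h2] := tilt.
    rewrite {2}kE stepZ {1}/k mulrC; congr (_ * _).
    rewrite (gfun_eq mu_ge0 c0_gt0 mu_exp h1 h2 (xs n) Ex) /delta.
    case: eqP => [xE|_]; last by rewrite addr0.
    by move: hn; rewrite -xE => hn; exfalso; lra.
  apply: (cvg_trans _ (hK x)); apply: near_eq_cvg; exact: far.
have sK : superharmonic mu E K.
  by split=> [x _|x Ex]; [exact: K0|have [? ->] := Kharm x Ex].
have Kpos z : E z -> 0 < K z.
  move=> Ez; have [Ch Ch0 harn] := superharmonic_harnack mu_ge0 (@irr L).
  apply: lt_le_trans (harn K z x0 sK Ez (OE x0O)).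
  by rewrite Kx0 mulr1 expR_gt0.
(* Both w and - w are admissible, which yields the equality K (z + w) = K z. *)
have Kle w z : (forall i, i \in L -> w i = 0) -> E z -> K (z + w) <= K z.
  move=> wL Ez; have [->|w0] := eqVneq w 0; first by rewrite addr0.
  apply/ler_addgt0Pr => e e0.
  have e'0 : 0 < e / K z by rewrite divr_gt0// Kpos.
  have [de de0 hde] := gfun_ratio_near mu_ge0 mu_mass c0_gt0 mu_exp irr drift0 drift_neq0 xsE Kd_ge0
    xs_dir xs_inf wL w0 e'0.
  have -> : K z + e = (1 + e / K z) * K z.
    by rewrite mulrDl mul1r divfK// lt0r_neq0// Kpos.
  apply: (ler_cvg_to (hK (z + w)) (cvgM (cvg_cst (1 + e / K z)) (hK z))).
  apply: Uoo; have := xs_inf (l1 z / de); apply: filterS2 hde => n hde hn.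
  rewrite /= /k mulrA ler_wpM2r ?invr_ge0 ?(ltW (Gx0_gt0 n))//; apply: hde => //.
  by move: hn; rewrite ler_pdivrMr// mulrC.
have KL z z' : E z -> E z' -> (forall i, i \in L -> z i = z' i) -> K z = K z'.
  move=> Ez Ez' zz'; apply/eqP; rewrite eq_le; apply/andP; split.
    have -> : z = z' + (z - z') by rewrite addrCA subrr addr0.
    by apply: Kle => // i iL; rewrite zvecB zz'// subrr.
  have -> : z' = z + (z' - z) by rewrite addrCA subrr addr0.
  by apply: Kle => // i iL; rewrite zvecB zz'// subrr.
have LK : lifted_harmonic mu L K by [].
exists K => // .
have evK x : O x -> exit_part mu L n K x @[n --> \oo] --> exit_value mu L K x.
  move=> Ox.
  exact: (exit_value_cvg mu_ge0 c0_gt0 mu_exp d_gt0 eps_gt0 del_ge0 rho_ge0 rho_lt1 tilt_c0 tilt_phi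
    bK C0 (fun z _ => K0 z) (fun z _ => eps_bd K z (KC z)) Ox).
have exit_cst n c g x : exit_part mu L n (fun z => c * g z) x = c * exit_part mu L n g x.
  rewrite /exit_part mulr_sumr; apply: eq_bigr => t _; rewrite -iter_stepZ.
  by congr (iter _ _ _ _); apply/funext => y; rewrite stepZ.
have p1 : 0 < 1 - rho by rewrite subr_gt0.
(* Both numerator and denominator are normalized by G_E at x0; the limit for x is then divided by
   the limit for x0, which is positive. *)
have main x : O x -> gfun mu O (xs n) x / gfun mu E (xs n) x0 @[n --> U] --> K x - exit_value mu L K x.
  move=> Ox.
  pose r n := gfun mu O (xs n) x / gfun mu E (xs n) x0.
  have rE n : exit_part mu L m (k n) x @[m --> \oo] --> k n x - r n.
    rewrite (_ : k n x - r n = (gfun mu E (xs n) x0)^-1 * (gfun mu E (xs n) x - gfun mu O (xs n) x)).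
      rewrite (_ : (fun m => exit_part mu L m (k n) x) =
        (fun m => (gfun mu E (xs n) x0)^-1 * exit_part mu L m (gfun mu E (xs n)) x)).
        by apply: cvgM; [exact: cvg_cst|exact: gfun_orthant].
      by apply/funext => m; rewrite kE exit_cst.
    by rewrite /r /k -mulrBl mulrC.
  have evk n : exit_value mu L (k n) x = k n x - r n by exact: cvg_lim (rE n).
  have rE' n : r n = k n x - exit_value mu L (k n) x by rewrite evk; ring.
  rewrite -/r (_ : r = fun n => k n x - exit_value mu L (k n) x); last exact/funext.
  apply: cvgB; first exact: hK.
  apply/cvgrPdist_le => e e_gt0.
  (* The tail bound is the same for K and for all k n with n large, so one m serves for all; the
     partial sums of order m converge along U. *)
  have cw : (fun m => C * rho ^+ m / (1 - rho) * exit_weight L del eps x) @ \oo --> (0 : R).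
    rewrite -[X in _ --> X](mulr0 (C * (1 - rho)^-1 * exit_weight L del eps x)).
    rewrite (_ : (fun m => _) = fun m => (C * (1 - rho)^-1 * exit_weight L del eps x) * rho ^+ m).
      apply: cvgM; first exact: cvg_cst.
      by apply: cvg_expr; rewrite ger0_norm.
    by apply/funext => m; ring.
  have e2 : 0 < e / 2 by rewrite divr_gt0.
  have [m _ hm] : \forall m \near \oo, C * rho ^+ m / (1 - rho) * exit_weight L del eps x <= e / 2.
    move/cvgrPdist_le : cw => /(_ _ e2); apply: filterS => m.
    by rewrite sub0r normrN; apply: le_trans; exact: ler_norm.
  have {hm} tail := hm m (leqnn m).
  have cm : exit_part mu L m (k n) x @[n --> U] --> exit_part mu L m K x.
    apply: (@exit_part_cvg _ _ mu c0 mu_ge0 c0_gt0 mu_exp L U UF k K _ m x bD bk _ _ Ox).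
      by apply: filterS hCU => n h y _; rewrite ger0_norm ?k_ge0.
    by move=> y _; exact: hK.
  have vK1 := exit_part_le mu_ge0 c0_gt0 mu_exp d_gt0 eps_gt0 del_ge0 rho_ge0 rho_lt1 tilt_c0 tilt_phi
    bK C0 (fun z _ => K0 z) (fun z _ => eps_bd K z (KC z)) m Ox.
  have vK2 := exit_value_le mu_ge0 c0_gt0 mu_exp d_gt0 eps_gt0 del_ge0 rho_ge0 rho_lt1 tilt_c0 tilt_phi
    bK C0 (fun z _ => K0 z) (fun z _ => eps_bd K z (KC z)) m Ox.
  move/cvgrPdist_le : cm => /(_ _ e2) cm.
  apply: filterS2 hCU cm => n hn cm.
  have kn z : B z -> k n z <= C * expR (eps * l1 z) by move=> _; exact: eps_bd (k n) z (hn z).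
  have vk1 := exit_part_le mu_ge0 c0_gt0 mu_exp d_gt0 eps_gt0 del_ge0 rho_ge0 rho_lt1 tilt_c0 tilt_phi
    (bk n) C0 (fun z _ => k_ge0 n z) kn m Ox.
  have vk2 := exit_value_le mu_ge0 c0_gt0 mu_exp d_gt0 eps_gt0 del_ge0 rho_ge0 rho_lt1 tilt_c0 tilt_phi
    (bk n) C0 (fun z _ => k_ge0 n z) kn m Ox.
  move: cm; rewrite !ler_norml => /andP[c1 c2]; apply/andP; split; lra.
move=> x Ox.
have h0 := lifted_h_gt0 mu_ge0 mu_mass c0_gt0 mu_exp irr drift0 d_gt0 eps_gt0 eps_del
  rho_ge0 rho_lt1 tilt_c0 tilt_phi LK x0O.
rewrite (_ : (fun n => _) = fun n => (gfun mu O (xs n) x / gfun mu E (xs n) x0) *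
    (gfun mu O (xs n) x0 / gfun mu E (xs n) x0)^-1).
  by apply: cvgM; [exact: main|apply: cvgV; [exact: lt0r_neq0|exact: main]].
apply/funext => n; have Gn0 := lt0r_neq0 (Gx0_gt0 n).
by rewrite invf_div mulrA divfK.
Qed.

End limit.

(** * The Markov chain S *)

(** Splitting over the countably many values of V plays the role of conditioning on V. *)
Lemma ge0_integral_fibers disp (T : measurableType disp) (R : realType)
    (m : {measure set T -> \bar R}) (I : countType) (D : set T) (V : T -> I) (f : T -> \bar R) :
  measurable D -> (forall i, measurable (V @^-1` [set i])) -> measurable_fun D f ->
  (forall w, D w -> (0 <= f w)%E) ->
  (\int[m]_(w in D) f w = \esum_(i in [set: I]) \int[m]_(w in D `&` V @^-1` [set i]) f w)%E.
Proof.
move=> mD mV mf f0.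
pose F n := if pickle_inv n is Some i then D `&` V @^-1` [set i] else set0 : set T.
have DE : \bigcup_n F n = D.
  apply/seteqP; split=> [w [n _]|w Dw].
    by rewrite /F; case: pickle_inv => // i [].
  by exists (pickle (V w)) => //; rewrite /F pickleK_inv.
have mF n : measurable (F n).
  rewrite /F; case: pickle_inv => [i|]; last exact: measurable0.
  exact: measurableI.
have tF : trivIset [set: nat] F.
  move=> i j _ _ [w []]; rewrite /F.
  have := @pickle_invK I i; have := @pickle_invK I j.
  case: (pickle_inv i) => [a /=|//]; case: (pickle_inv j) => [b /=|//].
  by move=> <- <- [_ <-] [_ ->].
have mf' : measurable_fun (\bigcup_n F n) f by rewrite DE.
have f0' w : (\bigcup_n F n) w -> (0 <= f w)%E by rewrite DE; exact: f0.
rewrite -{1}DE ge0_integral_bigcup//.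
rewrite nneseries_esumT; last first.
  by move=> n; apply: integral_ge0 => w Fw; apply: f0; rewrite -DE; exists n.
rewrite [RHS](_ : _ = (\esum_(n in range (@pickle I)) \int[m]_(w in F n) f w)%E).
  rewrite [RHS]esum_mkcond; apply: eq_esum => n _; case: ifPn => // /negP h.
  have -> : F n = set0.
    rewrite /F; have := @pickle_invK I n; case: (pickle_inv n) => // i /= ni.
    by exfalso; apply: h; rewrite inE; exists i.
  exact: integral_set0.
rewrite (reindex_esum [set: I] _ pickle).
  by apply: eq_esum => i _; rewrite /F pickleK_inv.
split; first by move=> i _; exists i.
  by move=> i j _ _; exact: (pcan_inj pickleK_inv).
by move=> _ [i _ <-]; exists i.
Qed.

Section walk.
Context {R : realType} {d : nat} {disp : measure_display} {T : measurableType disp}.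
Notation X := (zvec 'I_d).
Variables (mu : X -> R) (P : X -> probability T R) (S : nat -> T -> X).
Hypotheses (mu_ge0 : forall z, 0 <= mu z)
  (S_walk : is_markov_chain (walk_kernel mu) P S).
Implicit Types (A : set X) (x y z : X).

Local Open Scope ereal_scope.

(** [step] in the extended reals, so that integrals can be computed before any summability is known;
    [estep_EFin] translates back. *)
Definition estep A (g : X -> \bar R) x := \esum_(z in A) ((mu (z - x))%:E * g z).

Lemma measurable_S n (A : set X) : measurable (S n @^-1` A).
Proof.
have [mS _] := S_walk.
have -> : S n @^-1` A = \bigcup_(i : X) (if i \in A then S n @^-1` [set i] else set0).
  apply/seteqP; split=> [w /= Aw|w [i _]].
    by exists (S n w) => //; rewrite mem_set.
  by case: ifPn => // /set_mem Ai /= ->.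
apply: countable_bigcupT_measurable => // i; case: ifP => _; last exact: measurable0.
exact: mS.
Qed.

Lemma measurable_fun_S n D (F : X -> \bar R) : measurable D ->
  measurable_fun D (fun w => F (S n w)).
Proof. by move=> mD _ Y mY; apply: measurableI => //; exact: (measurable_S n (F @^-1` Y)). Qed.

(** The trajectory is prescribed up to time k and only constrained afterwards: k = n gives a
    cylinder, whose probability is known, and k = 0 fixes only the starting point. *)
Definition path_event (A : nat -> set X) (y : nat -> X) (k n : nat) : set T :=
  [set w | (forall s, (s <= k)%N -> S s w = y s) /\
     forall s, (k < s)%N -> (s <= n)%N -> A s (S s w)].

Lemma measurable_path_event (A : nat -> set X) (y : nat -> X) k n : measurable (path_event A y k n).
Proof.
have -> : path_event A y k n =
  (\bigcap_s (if (s <= k)%N then S s @^-1` [set y s] else setT)) `&`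
  (\bigcap_s (if (k < s <= n)%N then S s @^-1` (A s) else setT)).
  apply/seteqP; split=> w /= [h1 h2]; split.
  - by move=> s _; case: ifP => // sk; exact: h1.
  - by move=> s _; case: ifP => // /andP[? ?]; exact: h2.
  - by move=> s sk; have := h1 s I; rewrite sk.
  - by move=> s sk sn; have := h2 s I; rewrite sk sn.
apply: measurableI; apply: bigcap_measurable => // s _; case: ifP => _;
  by [exact: measurable_S|exact: measurableT].
Qed.

(** The Markov property is given through the probabilities of cylinders only. Backward induction on
    k: splitting by the value of S at time k + 1 lengthens the prescribed path by one. *)
Lemma integral_path_event x (A : nat -> set X) (F : X -> \bar R) (H : nat -> X -> \bar R) n :
  (forall z, 0 <= F z) -> (forall k z, 0 <= H k z) -> (forall z, H n z = F z) ->
  (forall k z, (k < n)%N -> H k z = estep (A k.+1) (H k.+1) z) ->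
  forall k (y : nat -> X), (k <= n)%N ->
  \int[P x]_(w in path_event A y k n) F (S n w) =
  ((y 0%N == x)%:R * \prod_(s < k) walk_kernel mu (y s) (y s.+1))%:E * H k (y k).
Proof.
move=> F0 H0 Hn Hk k; have [mS PS] := S_walk.
move: {2}(n - k)%N (erefl (n - k)%N) => m; elim: m k => [|m IH] k nk y kn.
  have {nk} {}kn : k = n by apply/eqP; rewrite eqn_leq kn -subn_eq0 nk.
  rewrite -kn; have -> : path_event A y k k = [set w | forall s, (s <= k)%N -> S s w = y s].
    apply/seteqP; split=> w /=; first by case.
    by move=> h; split => // s ks sk; move: (leq_trans ks sk); rewrite ltnn.
  have mC : measurable [set w | forall s, (s <= k)%N -> S s w = y s].
    have := measurable_path_event A y k k; congr measurable.
    apply/seteqP; split=> w /=; first by case.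
    by move=> h; split => // s ks sk; move: (leq_trans ks sk); rewrite ltnn.
  rewrite (eq_integral (cst (F (y k)))) => [|w]; last first.
    by rewrite inE /= => h; rewrite h.
  rewrite integral_cst// muleC; congr (_ * _)%E; [exact: PS|by rewrite kn Hn].
have kn' : (k < n)%N by rewrite -subn_gt0 nk.
pose y' (z : X) (s : nat) := if s == k.+1 then z else y s.
have y'0 z : y' z 0%N = y 0%N by [].
have ev z : path_event A y k n `&` S k.+1 @^-1` [set z] =
    if z \in A k.+1 then path_event A (y' z) k.+1 n else set0.
  apply/seteqP; split=> [w [[h1 h2] /= Sz]|w].
    rewrite mem_set; last by rewrite -Sz; exact: h2.
    split=> s; last by move=> ks; apply: h2; exact: ltnW.
    rewrite leq_eqVlt /y' => /orP[/eqP ->|]; first by rewrite eqxx.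
    by rewrite ltnS => sk; rewrite ltn_eqF ?ltnS//; exact: h1.
  case: ifPn => // /set_mem Az [h1 h2].
  have Sz : S k.+1 w = z by rewrite h1// /y' eqxx.
  split=> //; split=> s.
    by move=> sk; rewrite h1 ?(leqW sk)// /y' ltn_eqF// ltnS.
  rewrite leq_eqVlt => /orP[/eqP <- _|ks sn]; first by rewrite Sz.
  exact: h2.
rewrite (ge0_integral_fibers (P x) (measurable_path_event A y k n) (fun i => measurable_S k.+1 [set i])
  (measurable_fun_S n F (measurable_path_event A y k n)) (fun w _ => F0 _)).
rewrite Hk// /estep.
set W := ((y 0%N == x)%:R * _)%R.
have W0 : (0 <= W)%R.
  by apply: mulr_ge0 => //; apply: prodr_ge0 => s _; exact: mu_ge0.
have -> : (\esum_(i in [set: X]) \int[P x]_(w in path_event A y k n `&` S k.+1 @^-1` [set i]) F (S n w)) =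
   \esum_(z in A k.+1) (W%:E * ((mu (z - y k))%:E * H k.+1 z)).
  rewrite [RHS]esum_mkcond; apply: eq_esum => z _; rewrite ev.
  case: ifPn => Az; last exact: integral_set0.
  rewrite IH//; last by rewrite subnS nk.
  have -> : y' z k.+1 = z by rewrite /y' eqxx.
  rewrite muleA; congr (_ * _); rewrite -EFinM /W big_ord_recr /= y'0 -mulrA; congr (_ * (_ * _))%:E.
    apply: eq_bigr => s _; rewrite /y' !ltn_eqF// ?ltnS//; by rewrite ?(ltnW (ltn_ord s)) ?ltn_ord.
  by rewrite /walk_kernel /y' eqxx ltn_eqF.
by rewrite ge0_esumZ// => z _; rewrite mule_ge0// lee_fin.
Qed.

Lemma integral_walk x (A : nat -> set X) (F : X -> \bar R) (H : nat -> X -> \bar R) n :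
  (forall z, 0 <= F z) -> (forall k z, 0 <= H k z) -> (forall z, H n z = F z) ->
  (forall k z, (k < n)%N -> H k z = estep (A k.+1) (H k.+1) z) ->
  measurable [set w | forall s, (s <= n)%N -> A s (S s w)] /\
  \int[P x]_(w in [set w | forall s, (s <= n)%N -> A s (S s w)]) F (S n w) =
    if x \in A 0%N then H 0%N x else 0.
Proof.
move=> F0 H0 Hn Hk; set D := [set w | _].
have mD : measurable D.
  have -> : D = \bigcap_s (if (s <= n)%N then S s @^-1` (A s) else setT).
    apply/seteqP; split=> w /= h s; first by move=> _; case: ifP => // sn; exact: h.
    by move=> sn; have := h s I; rewrite sn.
  apply: bigcap_measurable => // s _; case: ifP => _; last exact: measurableT.
  exact: measurable_S.
split=> //.
rewrite (ge0_integral_fibers (P x) mD (fun i => measurable_S 0%N [set i])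
  (measurable_fun_S n F mD) (fun w _ => F0 _)).
rewrite (_ : \esum_(i in _) _ = \esum_(z in [set x]) if z \in A 0%N then H 0%N z else 0).
  by rewrite esum_set1//; case: ifP.
rewrite [RHS]esum_mkcond; apply: eq_esum => z _.
have [Az|Az] := pselect (A 0%N z); last first.
  rewrite (_ : D `&` _ = set0) ?integral_set0.
    by rewrite [z \in A 0%N]memNset//; case: ifP.
  by apply/seteqP; split=> // w [/(_ 0%N isT) + /= Sz]; rewrite Sz.
have -> : D `&` S 0%N @^-1` [set z] = path_event A (fun=> z) 0 n.
  apply/seteqP; split=> w [h1 h2]; split.
  - by move=> s; rewrite leqn0 => /eqP ->.
  - by move=> s _; exact: h1.
  - by move=> [_|s sn]; [rewrite h1|exact: h2].
  - exact: h1.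
rewrite (integral_path_event x F0 H0 Hn Hk)// big_ord0 mulr1 [z \in A 0%N]mem_set//.
case: ifPn => [/set_mem/= ->|zx]; first by rewrite eqxx mul1e.
by rewrite (negPf (_ : z != x)) ?mul0e//; apply: contraNN zx => /eqP ->; rewrite mem_set.
Qed.

Lemma exit_ge (L : {set 'I_d}) w t :
  (forall n, (n < t)%N -> orthant_on L (S n w)) -> (t%:R : R)%:E <= exit (R := R) S L w.
Proof.
move=> h; apply: le_bigmin => [|i iL]; first exact: leey.
apply: le_ereal_inf_tmp => _ [n /= Sn <-]; rewrite lee_fin ler_nat leqNgt.
by apply/negP => nt; have := h n nt i iL; rewrite ltNge Sn.
Qed.

Lemma exit_le (L : {set 'I_d}) w t : ~ orthant_on L (S t w) -> exit (R := R) S L w <= (t%:R : R)%:E.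
Proof.
move=> /existsNP[i /not_implyP[iL /negP]]; rewrite -leNgt => Sn.
apply: le_trans (bigmin_le_cond _ _ iL) _.
by apply: ereal_inf_lbound; exists t.
Qed.

Lemma exit_gtP (L : {set 'I_d}) w t :
  (t%:R : R)%:E < exit (R := R) S L w <-> forall n, (n <= t)%N -> orthant_on L (S n w).
Proof.
split=> [h n nt|h].
  apply: contrapT => /exit_le hn; move: (lt_le_trans h hn).
  by rewrite lte_fin ltr_nat ltnNge nt.
apply: (@lt_le_trans _ _ (t.+1%:R : R)%:E _ _ _ (exit_ge _)) => [|n]; last exact: h.
  by rewrite lte_fin ltr_nat.
Qed.

Lemma orthant_onT x : orthant_on [set: 'I_d]%SET x <-> orthant x.
Proof. by split=> h i => [|_]; apply: h; rewrite inE. Qed.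

Lemma estepE A (g : X -> R) x : (forall z, A z -> (0 <= g z)%R) ->
  estep A (EFin \o g) x = \esum_(z in [set: X]) (mu z * cut A g (x + z))%:E.
Proof.
move=> g0; rewrite /estep esum_mkcond.
rewrite (@esum_bij _ _ (fun z => x + z)%R (fun z => z - x)%R); last 3 first.
- by move=> z; rewrite addrC addKr.
- by move=> z; rewrite addrC subrK.
- by move=> z; case: ifPn => // /set_mem Az; rewrite mule_ge0// lee_fin// g0.
apply: eq_esum => z _; rewrite /cut /=.
have -> : (x + z - x = z)%R by rewrite addrC addKr.
by case: ifPn => // _; rewrite mulr0.
Qed.

Lemma estep_EFin A (g : X -> R) x : (forall z, A z -> (0 <= g z)%R) ->
  step_summable mu A g x -> estep A (EFin \o g) x = (step mu A g x)%:E.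
Proof.
move=> g0 sg; rewrite estepE// esum_rsum// => z.
by rewrite mulr_ge0// /cut; case: ifPn => // /set_mem; exact: g0.
Qed.

Variables (c0 : R).
Hypotheses (c0_gt0 : (0 < c0)%R)
  (mu_exp : abs_summable (fun z => mu z * expR (c0 * l1 z))%R).
Let c0_ge0 : (0 <= c0)%R := ltW c0_gt0.

Let O : set X := @orthant 'I_d.

Lemma iter_step_nneg A n (g : X -> R) z : (forall y, 0 <= g y)%R ->
  (0 <= iter n (step mu A) g z)%R.
Proof.
by move=> g0; elim: n z => [|n IH] z //=; apply: (step_ge0 mu_ge0) => y _; exact: IH.
Qed.

Section green.
Variable a0 : 'I_d -> R.
Hypotheses (a0c : (forall i, `|a0 i| <= c0)%R) (phi_a0 : (phi mu a0 < 1)%R).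

Lemma green_gfun x y : O x -> O y -> green P S x y = (gfun mu O y x)%:E.
Proof.
move=> Ox Oy.
have term t : P x [set w | S t w = y /\ (t%:R : R)%:E < exit (R := R) S [set: 'I_d]%SET w] =
    (iter t (step mu O) (delta y) x)%:E.
  have d0 z : (0 <= delta y z :> R)%R by rewrite ler0n.
  pose H k z := (iter (t - k) (step mu O) (delta y) z)%:E.
  have H0 k z : 0 <= H k z by rewrite lee_fin iter_step_nneg.
  have Hk k z : (k < t)%N -> H k z = estep O (H k.+1) z.
    move=> kt; rewrite /H -subnSK//= -estep_EFin//.
      by move=> u _; exact: iter_step_nneg.
    apply: (exp_bounded_step_summable mu_ge0 c0_ge0 mu_exp).
    apply: (exp_bounded_iter mu_ge0 c0_ge0 mu_exp).
    exact: exp_bounded_delta.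
  have Hn z : H t z = (EFin \o (delta y : X -> R)) z by rewrite /H subnn.
  have F0 z : 0 <= (EFin \o (delta y : X -> R)) z by rewrite lee_fin.
  have [mD] := integral_walk (A := fun=> O) x F0 H0 Hn Hk.
  rewrite mem_set// /H subn0 => <-.
  rewrite (eq_integral (fun w => (\1_(S t @^-1` [set y]) w)%:E)); last first.
    move=> w _; rewrite /= /delta indicE; congr ((_ : bool)%:R%:E).
    by apply/eqP/idP => [Sy|/set_mem//]; rewrite mem_set.
  rewrite integral_indic//; last exact: measurable_S.
  congr (P x _); apply/seteqP; split=> w /= [Sy].
    by move=> /exit_gtP h; split=> // s st; apply/orthant_onT/h.
  by move=> h; split=> //; apply/exit_gtP => s st; apply/orthant_onT/h.
rewrite /green (eq_eseriesr (g := fun t => (iter t (step mu O) (delta y) x)%:E)) => [|t _]; last exact: term.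
have h : gpart mu O n y x @[n --> \oo] --> gfun mu O y x :=
  gpart_cvg mu_ge0 c0_gt0 mu_exp a0c phi_a0 Ox.
apply: cvg_lim => //.
rewrite (_ : (fun n => _) = EFin \o (fun n => gpart mu O n y x)).
  by apply/fine_cvgP; split; [near=> n|exact: h].
by apply/funext => n; rewrite /= /gpart big_mkord sumEFin.
Unshelve. all: by end_near. Qed.

End green.

Lemma exit_eq w n : (forall s, (s < n)%N -> O (S s w)) -> ~ O (S n w) ->
  exit (R := R) S [set: 'I_d]%SET w = (n%:R)%:E.
Proof.
move=> hO nO; apply/eqP; rewrite eq_le exit_le ?exit_ge// => [s sn|/orthant_onT//].
exact/orthant_onT/hO.
Qed.

Section exit_expectation.
Variables (L : {set 'I_d}) (f : zvec {i | i \in L} -> R) (F : X -> R) (x : X) (v : R).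
Let E : set X := orthant_on L.
Let B : set X := E `\` O.
Hypotheses (F0 : forall z, (0 <= F z)%R) (bF : exp_bounded c0 F)
  (Ff : forall z, E z -> F z = f (restr L z)) (Ox : O x)
  (hv : exit_part mu L n F x @[n --> \oo] --> v).

(** With these constraints, D n is the event that O is left at time n exactly, into B. *)
Let A n s := if (s < n)%N then O else B.
Let D n := [set w | forall s, (s <= n)%N -> A n s (S s w)].

Lemma exit_eventE : [set w | exit (R := R) S [set: 'I_d]%SET w < exit (R := R) S L w] = \bigcup_n D n.
Proof.
apply/seteqP; split=> [w /= h|w [n _ hn] /=].
  have ex : exists n, `[< ~ O (S n w) >].
    apply: contrapT => /forallNP no.
    have hO t n : (n < t)%N -> orthant_on [set: 'I_d]%SET (S n w).
      by move=> _; apply/orthant_onT; apply: contrapT => nO; apply: (no n); exact/asboolP.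
    have := exit_ge (hO 0%N); have /= := fun t => exit_ge (hO t).
    case: (exit S [set: 'I_d]%SET w) h => [r|//|//]; last by move=> + _ _; rewrite ltNge leey.
    move=> _ /(_ (Num.truncn r).+1); rewrite !lee_fin => h1 r0.
    by have := truncnS_gt r; rewrite ltNge h1.
  case: (ex_minnP ex) => n /asboolP nO nmin.
  have lO s : (s < n)%N -> O (S s w).
    by move=> sn; apply: contrapT => /asboolP/nmin; rewrite leqNgt sn.
  exists n => // s; rewrite /A leq_eqVlt => /orP[/eqP ->|sn]; last by rewrite sn; exact: lO.
  rewrite ltnn; split=> //.
  by move: h; rewrite (exit_eq lO nO) => /exit_gtP; exact.
have lO s : (s < n)%N -> O (S s w) by move=> sn; have := hn s (ltnW sn); rewrite /A sn.
have := hn n (leqnn n); rewrite /A ltnn => -[En nO].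
rewrite (exit_eq lO nO); apply/exit_gtP => s; rewrite leq_eqVlt => /orP[/eqP ->//|sn].
by move=> i _; exact: lO.
Qed.

Lemma exit_expectationE : exit_expectation P S f x = v%:E.
Proof.
have SF n w : D n w -> f (restr L (S_exit (R := R) S w)) = F (S n w).
  move=> hw; have lO s : (s < n)%N -> O (S s w).
    by move=> sn; have := hw s (ltnW sn); rewrite /A sn.
  have := hw n (leqnn n); rewrite /A ltnn => -[En nO].
  by rewrite /S_exit (exit_eq lO nO) /= natrK Ff.
(* The event D 0 contributes nothing because the start x is in O; the exit at time m + 1 contributes
   the term of index m of [exit_part]. *)
have val n : measurable (D n) /\ \int[P x]_(w in D n) (f (restr L (S_exit (R := R) S w)))%:E =
    if n is m.+1 then (iter m (step mu O) (step mu B F) x)%:E else 0.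
  pose H k z := (if (k < n)%N then iter (n - k.+1) (step mu O) (step mu B F) z else F z)%:E.
  have ebF m := exp_bounded_iter mu_ge0 c0_ge0 mu_exp O m
    (exp_bounded_step mu_ge0 c0_ge0 mu_exp B bF).
  have s0 z : (0 <= step mu B F z)%R by apply: (step_ge0 mu_ge0).
  have H0 k z : 0 <= H k z.
    by rewrite /H lee_fin; case: ifP => _; [exact: iter_step_nneg|exact: F0].
  have Hk k z : (k < n)%N -> H k z = estep (A n k.+1) (H k.+1) z.
    move=> kn; rewrite /H kn /A; have [kn'|kn'] := ltnP k.+1 n.
      rewrite -subnSK//= -estep_EFin//; first by move=> u _; exact: iter_step_nneg.
      exact: (exp_bounded_step_summable mu_ge0 c0_ge0 mu_exp).
    have -> : n = k.+1 by apply/eqP; rewrite eqn_leq kn'.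
    rewrite subnn /= -estep_EFin//.
    exact: (exp_bounded_step_summable mu_ge0 c0_ge0 mu_exp).
  have Hn z : H n z = (EFin \o F) z by rewrite /H ltnn.
  have F0' z : 0 <= (EFin \o F) z by rewrite lee_fin.
  have [mD] := integral_walk x F0' H0 Hn Hk.
  rewrite -/(D n) => eD; split=> //.
  rewrite (eq_integral (fun w => (EFin \o F) (S n w))) => [|w /set_mem hw].
    rewrite eD /H /A; clear - Ox; case: n => [|m] /=.
      by rewrite memNset// => -[].
    by rewrite mem_set// subSS subn0.
  by rewrite /= (SF _ _ hw).
rewrite /exit_expectation exit_eventE ge0_integral_bigcup//=; first last.
- move=> i j _ _ [w []].
  wlog ij : i j / (i < j)%N => [hwlog wi wj|hi hj].
    by have [ij|ij|//] := ltngtP i j; [exact: hwlog wi wj|exact/esym/(hwlog _ _ ij)].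
  have := hj i (ltnW ij); rewrite /A ij => Oi.
  by have := hi i (leqnn i); rewrite /A ltnn => -[_ /(_ Oi)].
- by move=> w [n _ /SF ->]; rewrite lee_fin.
- apply/measurable_fun_bigcup => [n|n]; first by have [] := val n.
  apply: (eq_measurable_fun (fun w => (EFin \o F) (S n w))) => [w /set_mem/SF -> //|].
  by apply: measurable_fun_S; have [] := val n.
- by move=> n; have [] := val n.
apply: cvg_lim => //; rewrite -cvg_shiftS.
rewrite (_ : (fun n => _) = EFin \o (fun n => exit_part mu L n F x)).
  by apply/fine_cvgP; split; [near=> n|exact: hv].
apply/funext => n; rewrite /= /exit_part big_mkord big_ord_recl (val 0%N).2 add0e -sumEFin.
by apply: eq_bigr => i _; rewrite (val _).2.
Unshelve. all: by end_near. Qed.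

End exit_expectation.

End walk.

(** * The induced chain *)

Lemma ge0_ssum (R : realType) (X : choiceType) (A : set X) (g : X -> R) :
  (forall x, A x -> 0 <= g x) -> ssum A g = (\esum_(x in A) (g x)%:E)%E.
Proof.
move=> g0; rewrite /ssum [X in (_ - X)%E]esum1 ?sube0.
  by apply: eq_esum => x Ax; rewrite funeposE/= max_l// lee_fin g0.
by move=> x Ax; rewrite funenegE/= max_r// lee_fin oppr_le0 g0.
Qed.

Lemma ssum_rsum (R : realType) (X : choiceType) (g : X -> R) :
  abs_summable g -> ssum [set: X] g = (rsum g)%:E.
Proof.
move=> sg.
have sp (h : X -> R) : (forall x, `|h x| = `|g x|) ->
    ((fine (\esum_(x in [set: X]) (Num.max (h x) 0)%:E))%:E =
    \esum_(x in [set: X]) (Num.max (h x) 0)%:E)%E.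
  move=> hg; have m0 x : 0 <= Num.max (h x) 0 by rewrite le_max lexx orbT.
  have sh : abs_summable (fun x => Num.max (h x) 0).
    apply: abs_summable_le (abs_summable_norm sg) => x.
    by rewrite ger0_norm// ge_max -hg ler_norm normr_ge0.
  by rewrite esum_rsum// -rsum_ge0E.
rewrite /rsum EFinB /ssum !sp// => [|x]; last by rewrite normrN.
by congr (_ - _)%E; apply: eq_esum => x _; rewrite ?funeposE ?funenegE/= EFin_max.
Qed.

Section measure_data.
Context {R : realType} {d : nat}.
Notation X := (zvec 'I_d).
Variables (mu : X -> R).

Lemma pmf_rsum : is_pmf mu -> rsum mu = 1.
Proof.
move=> [mu0 mu1].
have s : abs_summable mu by apply: (@abs_summable_esum _ _ _ +oo%E) => //; rewrite mu1 ltry.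
by apply: EFin_inj; rewrite -esum_rsum.
Qed.

(** As mu has mass 1, the point 0 is in the set where the Laplace transform is at most 1, so it is
    finite on a ball around 0. With c0 = (e / 2) / d, [l1_max] needs it only at the multiples by e /
    2 and - e / 2 of the basis vectors. *)
Lemma laplace_exp_moment : (0 < d)%N -> is_pmf mu ->
  (exists U : set 'rV[R]_d, [/\ open U, [set a | (laplace mu a <= 1)%E] `<=` U &
         forall a, U a -> (laplace mu a < +oo)%E]) ->
  exists2 c0 : R, 0 < c0 & abs_summable (fun z => mu z * expR (c0 * l1 z)).
Proof.
move=> d0 [mu0 mu1] [U [oU DU fU]].
have U0 : U 0.
  apply: DU => /=; rewrite /laplace -mu1; apply: le_esum => z _.
  by rewrite big1 ?expR0 ?mulr1// => i _; rewrite mxE mul0r.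
have /nbhs_ballP[e /= e0 eU] : nbhs (0 : 'rV[R]_d) U by exact: open_nbhs_nbhs.
have d0' : 0 < d%:R :> R by rewrite ltr0n.
exists (e / 2 / d%:R); first by rewrite !divr_gt0.
have cE : e / 2 / d%:R * d%:R = e / 2 :> R by rewrite divfK// gt_eqF.
have sm (s : R) i : `|s| < e -> abs_summable (fun z : X => mu z * expR (s * (z i)%:~R)).
  move=> se; apply: (@abs_summable_esum _ _ _ +oo%E) => [z|]; first by rewrite mulr_ge0// expR_ge0.
  have := fU (\row_j (s * (j == i)%:R)) _.
  rewrite /laplace; under eq_esum => z _.
    rewrite (bigD1 i)//= !mxE eqxx mulr1 big1 ?addr0.
    over.
    by move=> j ji; rewrite !mxE (negPf ji) mulr0 mul0r.
  apply; apply: eU; split=> /= [|a j]; first exact: e0.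
  rewrite /ball /= !mxE sub0r normrN normrM.
  by apply: le_lt_trans se; case: (j == i); rewrite ?normr1 ?mulr1// normr0 mulr0.
apply: (@abs_summable_le _ _ _ (fun z => \sum_i (mu z * expR (e / 2 * (z i)%:~R) +
   mu z * expR (- (e / 2) * (z i)%:~R)))).
  move=> z; rewrite ger0_norm ?mulr_ge0 ?expR_ge0//.
  under eq_bigr do rewrite -mulrDr.
  rewrite -mulr_sumr ler_wpM2l//; have := l1_max (c := e / 2 / d%:R) z d0.
  by rewrite cE; apply; rewrite !divr_ge0// ltW.
have he : `|e / 2| < e by rewrite ger0_norm ?divr_ge0 ?ltW//; lra.
by apply: abs_summable_sum => i; apply: abs_summableD; apply: sm; rewrite ?normrN.
Qed.

Lemma mean_drift i : abs_summable (fun z => mu z * (z i)%:~R) -> mean mu 0 i = drift mu i.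
Proof.
move=> s; rewrite mxE (_ : (fun x => _) = (fun z => mu z * (z i)%:~R)).
  by rewrite ssum_rsum.
by apply/funext => z; rewrite mxE.
Qed.

(** A finite sum of nonnegative terms entails summability, so harmonicity as stated in terms of
    [ssum] matches [step]. *)
Lemma ssum_step (mu_ge0 : forall z, 0 <= mu z) (A : set X) (g : X -> R) x (v : R) :
  (forall z, A z -> 0 <= g z) ->
  ssum A (fun y => walk_kernel mu x y * g y) = v%:E <->
  step_summable mu A g x /\ step mu A g x = v.
Proof.
move=> g0; have c0 z : 0 <= mu z * cut A g (x + z).
  by rewrite mulr_ge0// /cut; case: ifPn => // /set_mem; exact: g0.
rewrite ge0_ssum; last by move=> y Ay; rewrite mulr_ge0// ?g0//; exact: mu_ge0.
have -> : (\esum_(y in A) (walk_kernel mu x y * g y)%:E)%E = estep mu A (EFin \o g) x.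
  by apply: eq_esum => y _; rewrite EFinM.
rewrite estepE//; split=> [h|[s <-]]; last by rewrite esum_rsum.
have s : step_summable mu A g x by apply: (@abs_summable_esum _ _ _ +oo%E) => //; rewrite h ltry.
by split=> //; apply: EFin_inj; rewrite -h esum_rsum.
Qed.

Section induced.
Hypotheses (mu_ge0 : forall z, 0 <= mu z) (mu_summable : abs_summable mu).
Variable L : {set 'I_d}.
Notation XL := (zvec {i | i \in L}).
Let E : set X := orthant_on L.

Lemma orthant_restr x : @orthant {i | i \in L} (restr L x) <-> E x.
Proof.
split=> h i; last by rewrite ffunE; apply: h; exact: valP.
by move=> iL; have := h (exist _ i iL); rewrite ffunE.
Qed.

(** A section of [restr], used to read a function of the coordinates in L as a function on the
    induced state space. *)
Definition extend (u : XL) : X := [ffun i => if insub i is Some j then u j else 1].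

Lemma restr_extend u : restr L (extend u) = u.
Proof.
by apply/ffunP => i; rewrite !ffunE; case: insubP => [j _ /val_inj -> //|]; rewrite (valP i).
Qed.

Lemma marginalE u : (\esum_(x in [set x | restr L x = u]) (mu x)%:E = (marginal mu u)%:E)%E.
Proof.
rewrite /marginal fineK// ge0_fin_numE; last by apply: esum_ge0 => x _; rewrite lee_fin.
apply: le_lt_trans mu_summable; rewrite esum_mkcond; apply: le_esum => x _.
by case: ifPn => _; rewrite lee_fin ?ler_norm.
Qed.

(** The sum over E is grouped by the fibres of [restr]; translating the fibre of u by - x gives the
    fibre that defines the marginal weight. *)
Lemma esum_marginal (f : XL -> R) x : (forall u, orthant u -> 0 <= f u) ->
  (\esum_(u in @orthant {i | i \in L}) (walk_kernel (@marginal R d mu L) (restr L x) u * f u)%:E =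
   \esum_(y in E) (walk_kernel mu x y * f (restr L y))%:E)%E.
Proof.
move=> f0.
transitivity (\esum_(u in @orthant {i | i \in L}) \esum_(y in [set y | restr L y = u])
   (walk_kernel mu x y * f (restr L y))%:E)%E.
  apply: eq_esum => u Ou; rewrite EFinM -marginalE muleC -ge0_esumZ ?f0//; last first.
    by move=> y _; rewrite lee_fin.
  rewrite (reindex_esum [set y | restr L y = u] _ (fun y => y - x)).
    by apply: eq_esum => y <-; rewrite -EFinM mulrC.
  split=> [y /= <-|y z _ _ /addIr//|y /= hy].
    by apply/ffunP => i; rewrite !ffunE.
  exists (y + x); last by rewrite addrK.
  apply/ffunP => i; move/ffunP: hy => /(_ i); rewrite !ffunE => ->.
  by rewrite subrK.
rewrite esum_esum; last first.
  move=> u y Ou yu; rewrite lee_fin mulr_ge0//; first exact: mu_ge0.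
  by rewrite yu f0.
rewrite (reindex_esum E _ (fun y => (restr L y, y)))//.
split=> [y Ey|y z _ _ [_ //]|[u y] /= [Ou yu]].
  by split=> //=; exact/orthant_restr.
by exists y; [apply/orthant_restr; rewrite yu|rewrite yu].
Qed.

Lemma ssum_marginal (f : XL -> R) x : (forall u, orthant u -> 0 <= f u) ->
  ssum (@orthant {i | i \in L}) (fun u => walk_kernel (@marginal R d mu L) (restr L x) u * f u) =
  ssum E (fun y => walk_kernel mu x y * cut E (fun z => f (restr L z)) y).
Proof.
move=> f0; have m0 u : 0 <= @marginal R d mu L u.
  by apply: fine_ge0; apply: esum_ge0 => z _; rewrite lee_fin.
rewrite !ge0_ssum.
- rewrite esum_marginal//; apply: eq_esum => y Ey.
  by rewrite /cut mem_set.
- move=> y Ey; rewrite mulr_ge0//; first exact: mu_ge0.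
  by rewrite /cut mem_set// f0//; exact/orthant_restr.
- by move=> u Ou; rewrite mulr_ge0//; [exact: m0|exact: f0].
Qed.

Lemma lifted_positive_harmonic (f : XL -> R) :
  positive_harmonic (@orthant {i | i \in L}) (walk_kernel (@marginal R d mu L)) f <->
  lifted_harmonic mu L (cut E (fun z => f (restr L z))).
Proof.
set F := cut E _; have FE z : E z -> F z = f (restr L z) by move=> Ez; rewrite /F /cut mem_set.
have Eext u : orthant u -> E (extend u) by move=> Ou; apply/orthant_restr; rewrite restr_extend.
split=> [[fp fh]|[F0 _ Fp _ Fh]].
  have Fp z : E z -> 0 < F z by move=> Ez; rewrite FE//; apply: fp; exact/orthant_restr.
  split=> //.
  - move=> z; have [Ez|nE] := pselect (E z); first exact/ltW/Fp.
    by rewrite /F /cut memNset.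
  - by move=> z nE; rewrite /F /cut memNset.
  - move=> z z' Ez Ez' zz; rewrite !FE//; congr f; apply/ffunP => i.
    by rewrite !ffunE zz//; exact: valP.
  - move=> x Ex; apply/(ssum_step mu_ge0); first by move=> z /Fp/ltW.
    rewrite -ssum_marginal ?FE//; last by move=> u /fp/ltW.
    by apply: fh; exact/orthant_restr.
have fp u : orthant u -> 0 < f u.
  by move=> /Eext Eu; rewrite -[u]restr_extend -FE//; exact: Fp.
split=> // u Ou; have Eu := Eext _ Ou.
rewrite -{1}[u]restr_extend ssum_marginal; last by move=> v /fp/ltW.
rewrite -/F -{2}[u]restr_extend -FE//; apply/(ssum_step mu_ge0); last exact: Fh.
by move=> z _; exact: F0.
Qed.

Lemma lifted_harmonicE F : lifted_harmonic mu L F ->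
  F = cut E (fun z => F (extend (restr L z))).
Proof.
move=> [_ F0 _ FL _]; apply/funext => z; rewrite /cut; case: ifPn => [/set_mem Ez|/negP nE].
  apply: FL => //; first by apply/orthant_restr; rewrite restr_extend; apply/orthant_restr.
  by move=> i iL; rewrite ffunE insubT /= ffunE.
by apply: F0 => Ez; apply: nE; rewrite inE.
Qed.

End induced.
End measure_data.

(** If the preimage of a neighbourhood were not in F, its complement could be added to F, and an
    ultrafilter containing both would contradict the hypothesis. *)
Lemma cvg_ultrafilters (I : Type) (T : topologicalType) (F : set_system I) (f : I -> T) (l : T) :
  ProperFilter F -> (forall U, UltraFilter U -> F `<=` U -> f @ U --> l) -> f @ F --> l.
Proof.
move=> FF h A nA; apply: contrapT => nF.
pose B := f @^-1` A; pose G := within (~` B) F.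
have PG : ProperFilter G.
  split; last exact: within_filter.
  move=> G0; apply: nF; have {}G0 : F [set n | (~` B) n -> set0 n] := G0.
  by apply: (@filterS _ F _ _ _ _ G0) => n Hn; apply: contrapT => nB; case: (Hn nB).
have [U [UU GU]] := ultraFilterLemma PG.
have FU : F `<=` U.
  move=> C FC; apply: GU; rewrite /G /within.
  by apply: (@filterS _ F _ _ _ _ FC) => n Cn _.
have UB : U B := h U UU FU A nA.
have UnB : U (~` B) by apply: GU; rewrite /G /within; apply: (@filterS _ F _ _ _ _ (@filterT _ F _)) => n _.
by have [n [Bn]] := @filter_ex _ U _ _ (filterI UB UnB); exact.
Qed.

(** * Sequences going to infinity in the direction of the mean *)

Section direction.
Context {R : realType} {d : nat}.
Notation X := (zvec 'I_d).
Implicit Types (x : X) (v : 'rV[R]_d).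

Lemma enorm_ge0 v : 0 <= enorm v. Proof. exact: sqrtr_ge0. Qed.

Lemma enorm_vec_of_le x : enorm (vec_of x : 'rV[R]_d) <= l1 x.
Proof.
rewrite /enorm -[leRHS]ger0_norm ?l1_ge0// -sqrtr_sqr ler_wsqrtr//.
rewrite expr2 {1}/l1 mulr_suml; apply: ler_sum => i _.
by rewrite mxE -[leLHS]real_normK ?num_real// expr2 ler_wpM2l// ler_coord_l1.
Qed.

Lemma enorm_gt0 v : v != 0 -> 0 < enorm v.
Proof.
move=> v0; rewrite lt0r enorm_ge0 andbT; apply: contraNN v0.
rewrite sqrtr_eq0 => h; apply/eqP/rowP => i; rewrite mxE; apply/eqP.
rewrite -sqrf_eq0 eq_le sqr_ge0 andbT; apply: le_trans h.
by rewrite (bigD1 i)//= lerDl sumr_ge0// => j _; exact: sqr_ge0.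
Qed.

Variables (xs : nat -> X) (M : 'rV[R]_d).
Hypotheses (M0 : M != 0) (xs_esc : escaping (R := R) xs) (xs_M : has_direction xs M).

Lemma escaping_l1 (B : R) : \forall n \near \oo, B <= l1 (xs n).
Proof.
have [_ /cvgryPge/(_ B)] := xs_esc; apply: filterS => n h.
exact: le_trans h (enorm_vec_of_le _).
Qed.

(** The time t is the integer part of |x_n| / |M|. The distance of t M to x_n comes from the error
    in the direction and from the rounding; each takes half of gam |x_n| for large n. *)
Lemma direction_times (gam : R) (T0 : nat) : 0 < gam -> \forall n \near \oo, exists t : nat,
  [/\ (T0 <= t)%N, \sum_i `|(xs n i)%:~R - t%:R * M 0 i| <= gam * l1 (xs n) &
      t%:R <= (enorm M)^-1 * l1 (xs n)].
Proof.
move=> gam0; have m0 := enorm_gt0 M0.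
pose eta := gam / 2 / d.+1%:R.
have eta0 : 0 < eta by rewrite !divr_gt0.
pose C := \sum_i `|M 0 i|.
have [_ /cvgryPge hN] := xs_esc.
near=> n.
have N1 : 1 <= enorm (vec_of (xs n) : 'rV[R]_d) by near: n; exact: hN.
have NC : 2 * C / gam <= enorm (vec_of (xs n) : 'rV[R]_d) by near: n; exact: hN.
have NT : T0%:R * enorm M <= enorm (vec_of (xs n) : 'rV[R]_d) by near: n; exact: hN.
have Nl := enorm_vec_of_le (xs n).
have hd : `|(enorm M)^-1 *: M - (enorm (vec_of (xs n) : 'rV[R]_d))^-1 *: vec_of (xs n)| < eta.
  by near: n; move/cvgrPdist_lt : xs_M; apply.
set N := enorm (vec_of (xs n)) in N1 NC NT Nl hd.
have N0 : 0 < N by exact: lt_le_trans N1.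
have hdi i : `|(xs n i)%:~R - N / enorm M * M 0 i| <= eta * N.
  have h : `|(enorm M)^-1 * M 0 i - N^-1 * (xs n i)%:~R| <= eta.
    apply: le_trans (ltW hd); rewrite {2}/Num.norm /= mx_normrE.
    by apply: le_trans (le_bigmax _ _ (0, i)); rewrite /= !mxE.
  rewrite distrC.
  have -> : N / enorm M * M 0 i - (xs n i)%:~R = N * ((enorm M)^-1 * M 0 i - N^-1 * (xs n i)%:~R).
    by field; rewrite !gt_eqF.
  by rewrite normrM (gtr0_norm N0) mulrC ler_wpM2r// ltW.
pose t := Num.truncn (N / enorm M).
have q0 : 0 <= N / enorm M by rewrite divr_ge0// ltW.
have /andP[tl tu] := truncn_itv q0.
exists t; split.
- rewrite truncn_ge_nat// ler_pdivlMr//.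
- apply: (@le_trans _ _ (\sum_i (eta * N + `|M 0 i|))).
    apply: ler_sum => i _.
    have -> : (xs n i)%:~R - t%:R * M 0 i =
      ((xs n i)%:~R - N / enorm M * M 0 i) + (N / enorm M - t%:R) * M 0 i by ring.
    apply: le_trans (ler_normD _ _) _; apply: lerD; first exact: hdi.
    rewrite normrM ler_piMl// ger0_norm ?subr_ge0//.
    by rewrite lerBlDr addrC -natr1 in tu *; exact: ltW.
  rewrite big_split /= sumr_const card_ord -/C.
  apply: (@le_trans _ _ (gam / 2 * N + gam / 2 * N)).
    apply: lerD.
      rewrite -[leLHS]mulr_natr mulrAC ler_wpM2r ?(ltW N0)//.
      rewrite /eta -[leLHS]mulrA ler_piMr ?divr_ge0 ?(ltW gam0)// mulrC ler_pdivrMr//.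
      by rewrite mul1r ler_nat.
    by move: NC; rewrite ler_pdivrMr// => ?; lra.
  by rewrite -mulrDl -splitr ler_wpM2l// ltW.
- rewrite mulrC; apply: le_trans tl _; rewrite ler_wpM2r// invr_ge0 ltW//.
Unshelve. all: by end_near. Qed.

End direction.

Theorem theorem1 (R : realType) (d : nat) (d_ge1 : (1 <= d)%N)
  (mu : zvec 'I_d -> R) (mu_pmf : is_pmf mu)
  (disp : measure_display) (T : measurableType disp)
  (P : zvec 'I_d -> probability T R) (S : nat -> T -> zvec 'I_d)
  (S_walk : is_markov_chain (walk_kernel mu) P S)
  (x0 : zvec 'I_d) (x0_pos : orthant x0)
  (irr : forall L : {set 'I_d}, irreducible_on mu L)
  (laplace_fin : exists U : set 'rV[R]_d,
     [/\ open U, [set a | (laplace mu a <= 1)%E] `<=` U &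
         forall a, U a -> (laplace mu a < +oo)%E])
  (mean_neq0 : mean mu != 0)
  (mean_ge0 : forall i, 0 <= mean mu 0 i) :
  let M := mean mu in
  let L := zero_coords M in
  let E := @orthant {i | i \in L} in
  let pX := walk_kernel (@marginal R d mu L) in
  let G_limits f xs := forall x, orthant x ->
    martin_kernel P S x0 x (xs n) @[n --> \oo] -->
      h_of P S f x / h_of P S f x0 in
  [/\ forall f, positive_harmonic E pX f ->
        (forall x, orthant x ->
           exit_expectation P S f x \is a fin_num) /\
        positive_harmonic (@orthant 'I_d) (walk_kernel mu) (h_of P S f),
      forall xs, fundamental P S x0 xs -> has_direction xs M ->
        exists2 f, positive_harmonic E pX f & G_limits f xs
    & forall f, positive_harmonic E pX f ->
        (forall g, positive_harmonic E pX g ->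
           exists c : R, forall u, E u -> g u = c * f u) ->
        forall xs, escaping (R := R) xs -> has_direction xs M ->
          fundamental P S x0 xs /\ G_limits f xs].

Proof.
have [mu_ge0 _] := mu_pmf; have mass := pmf_rsum mu_pmf.
have [c0 c0_gt0 mu_exp] := laplace_exp_moment d_ge1 mu_pmf laplace_fin.
have smu := abs_summable_mu mu_ge0 c0_gt0 mu_exp.
have mean_eq i : mean mu 0 i = drift mu i.
  exact: mean_drift (abs_summable_coord mu_ge0 c0_gt0 mu_exp i).
move=> M L E pX G_limits.
have drift0 i : i \in L -> drift mu i = 0 by rewrite inE mean_eq => /eqP.
have drift_gt0 i : i \notin L -> 0 < drift mu i.
  by rewrite inE mean_eq => h; rewrite lt0r h -mean_eq mean_ge0.
have drift_neq0 : exists i, drift mu i != 0.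
  apply: contrapT => /forallNP h; move/eqP: mean_neq0; apply; apply/rowP => i.
  by rewrite mean_eq [RHS]mxE; apply/eqP/negPn/negP/h.
have [del [eps [rho [eps_gt0 eps_del rho_ge0 rho_lt1 tilt]]]] :=
  exit_tilt_phi mu_ge0 mass c0_gt0 mu_exp drift_gt0.
have tilt_c0 i j b k (iL : i \notin L) := (tilt i j b iL).1 k.
have tilt_phi i j b (iL : i \notin L) := (tilt i j b iL).2.
have [e1 e1_gt0 /(_ e1 e1_gt0 (lexx _))[a0c phi_a0]] := phi_lt1 mu_ge0 mass c0_gt0 mu_exp drift_neq0.
pose F (f : zvec {i | i \in L} -> R) : zvec 'I_d -> R := cut (orthant_on L) (fun z => f (restr L z)).
have liftP f := lifted_positive_harmonic mu_ge0 smu f : positive_harmonic E pX f <-> lifted_harmonic mu L (F f).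
have FE f z : orthant z -> F f z = f (restr L z) by move=> Oz; rewrite /F /cut mem_set// => i _.
have ev_cvg K := exit_value_lifted_cvg mu_ge0 mass c0_gt0 mu_exp irr drift0 d_ge1 eps_gt0 eps_del
  rho_ge0 rho_lt1 tilt_c0 tilt_phi (F := K).
have evE f x : positive_harmonic E pX f -> orthant x ->
    exit_expectation P S f x = (exit_value mu L (F f) x)%:E.
  move=> /liftP hf Ox.
  have [C [_ bF _]] := lifted_harmonic_growth mu_ge0 mass c0_gt0 mu_exp irr drift0 eps_gt0 hf.
  have [F0 _ _ _ _] := hf.
  apply: (exit_expectationE mu_ge0 S_walk c0_gt0 mu_exp F0 bF _ Ox (ev_cvg _ hf _ Ox)).
  by move=> z Ez; rewrite /F /cut mem_set.
have hE f x : positive_harmonic E pX f -> orthant x ->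
    h_of P S f x = F f x - exit_value mu L (F f) x.
  by move=> hf Ox; rewrite /h_of evE// FE.
have h_gt0 f x : positive_harmonic E pX f -> orthant x -> 0 < h_of P S f x.
  move=> hf Ox; rewrite hE//; move/liftP in hf.
  exact: (lifted_h_gt0 mu_ge0 mass c0_gt0 mu_exp irr drift0 d_ge1 eps_gt0 eps_del
    rho_ge0 rho_lt1 tilt_c0 tilt_phi hf Ox).
have kernelE xs x : escaping (R := R) xs -> orthant x ->
    (fun n => martin_kernel P S x0 x (xs n)) =
    (fun n => gfun mu (orthant (I:='I_d)) (xs n) x / gfun mu (orthant (I:='I_d)) (xs n) x0).
  move=> [xsO _] Ox; apply/funext => n; rewrite /martin_kernel.
  by rewrite !(green_gfun mu_ge0 S_walk c0_gt0 mu_exp a0c phi_a0 _ (xsO n)).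
have limit xs U : escaping (R := R) xs -> has_direction xs M -> UltraFilter U -> \oo `<=` U ->
    exists2 f, positive_harmonic E pX f & forall x, orthant x ->
      martin_kernel P S x0 x (xs n) @[n --> U] --> h_of P S f x / h_of P S f x0.
  move=> xs_esc xs_dir UU Uoo.
  have Kd0 : 0 <= (enorm M)^-1 by rewrite invr_ge0 enorm_ge0.
  have dir gam T0 : 0 < gam -> \forall n \near \oo, exists t : nat, [/\ (T0 <= t)%N,
      \sum_i `|(xs n i)%:~R - t%:R * drift mu i| <= gam * l1 (xs n) &
      t%:R <= (enorm M)^-1 * l1 (xs n)].
    move=> gam0; have := direction_times mean_neq0 xs_esc xs_dir T0 gam0.
    by apply: filterS => n [t [h1 h2 h3]]; exists t; split=> //; under eq_bigr do rewrite -mean_eq.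
  have [K hK hlim] := martin_limit mu_ge0 mass c0_gt0 mu_exp irr drift0 drift_neq0 d_ge1 eps_gt0 eps_del
    rho_ge0 rho_lt1 tilt_c0 tilt_phi xs_esc.1 Kd0 dir (escaping_l1 xs_esc) x0_pos UU Uoo.
  (* The limit K lives on the lattice; [extend] turns it into a function on the induced state
     space. *)
  have KF := lifted_harmonicE hK.
  exists (fun u => K (extend u)); first by apply/liftP; rewrite /F -KF.
  have hf : positive_harmonic E pX (fun u => K (extend u)) by apply/liftP; rewrite /F -KF.
  by move=> x Ox; rewrite kernelE// !hE// /F -KF; exact: hlim.
split.
- move=> f hf; split=> [x Ox|]; first by rewrite evE.
  split=> [x Ox|x Ox]; first exact: h_gt0.
  apply/(ssum_step mu_ge0); first by move=> z Oz; exact/ltW/h_gt0.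
  have [s e] := lifted_h_harmonic mu_ge0 mass c0_gt0 mu_exp irr drift0 d_ge1 eps_gt0 eps_del
    rho_ge0 rho_lt1 tilt_c0 tilt_phi ((liftP f).1 hf) Ox.
  rewrite (hE f x)//; split.
    by apply: (step_summable_le mu_ge0 _ s) => z Oz; rewrite gtr0_norm ?h_gt0// hE.
  by rewrite -[RHS]e; apply: eq_step => z Oz; rewrite hE.
- move=> xs [xs_esc xs_cvg] xs_dir.
  (* The limit exists by assumption, so a single ultrafilter identifies it. *)
  have [U [UU Uoo]] := ultraFilterLemma (eventually_filter).
  have [f hf hlim] := limit xs U xs_esc xs_dir UU Uoo.
  exists f => // x Ox; have /cvg_ex[l hl] := xs_cvg x Ox.
  have UF := ultra_proper (F := U).
  have -> : h_of P S f x / h_of P S f x0 = l; last exact: hl.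
  apply: (@cvg_unique _ _ ((fun n => martin_kernel P S x0 x (xs n)) @ U)) => //; first exact: hlim.
  by move=> A /hl /Uoo.
- move=> f hf uniq xs xs_esc xs_dir.
  have lim : G_limits f xs.
    (* Each ultrafilter gives its own g; by uniqueness it is a multiple of f, and the multiple
       cancels in the ratio. *)
    move=> x Ox; apply: cvg_ultrafilters => U UU Uoo.
    have [g hg hlim] := limit xs U xs_esc xs_dir UU Uoo.
    have [c gf] := uniq g hg.
    suff hc y : orthant y -> h_of P S g y = c * h_of P S f y.
      have h0 := h_gt0 _ _ hg x0_pos.
      have c_neq0 : c != 0 by apply: contraTneq h0 => c0'; rewrite hc// c0' mul0r ltxx.
      by have := hlim x Ox; rewrite !hc// -mulf_div divff// mul1r.
    move=> Oy; rewrite !hE//.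
    have Fg : F g = fun z => c * F f z.
      apply/funext => z; rewrite /F /cut; case: ifPn => [/set_mem Ez|_]; last by rewrite mulr0.
      by rewrite gf//; exact/orthant_restr.
    rewrite mulrBr Fg; congr (_ - _).
    have hg' := (liftP g).1 hg; rewrite Fg in hg'.
    (* Homogeneity of [exit_value] comes from that of [exit_part] and the uniqueness of limits. *)
    apply: (@cvg_unique _ (@norm_hausdorff _ R) _ _ _ _ (ev_cvg _ hg' y Oy)).
    have -> : (fun n => exit_part mu L n (fun z => c * F f z) y) = (fun n => c * exit_part mu L n (F f) y).
      apply/funext => n; rewrite /exit_part mulr_sumr; apply: eq_bigr => t _.
      rewrite -iter_stepZ; congr (iter t _ _ y); apply/funext => z; exact: stepZ.
    by apply: cvgM; [exact: cvg_cst|exact: ev_cvg ((liftP f).1 hf) y Oy].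
  split=> //; split=> // x Ox; apply/cvg_ex; exists (h_of P S f x / h_of P S f x0); exact: lim.
Qed.
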